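(* Let $0<\alpha<1$, $\theta>0$ with $0<\alpha\theta<1$, and let $H$ be a probability measure on $(0,\infty)$. The density of $M_1(\varrho^{(\alpha\theta)}_{\alpha,H})\overset{d}{=}B_{\alpha\theta,1-\alpha\theta}M_{\alpha\theta}(\varrho_\alpha)[M_\theta(H)]^{1/\alpha}$ (independent factors) is $$\frac1\pi\sin\big(\pi\theta\alpha[1-\Upsilon_\alpha(x)]\big)\,e^{-\theta\alpha\mathscr{S}^H_\alpha(x)}\,x^{\alpha\theta-1},\qquad x>0.$$ When $\theta=1$, the density of $M_1(\varrho^{(\alpha)}_{\alpha,H})\overset{d}{=}X_\alpha[M_1(H)]^{1/\alpha}$ can also be expressed as $$\frac{\sin(\pi\alpha)}{\pi}\int_0^\infty\frac{x^{\alpha-1}r}{x^{2\alpha}+2x^\alpha r\cos(\alpha\pi)+r^2}\,f_{M_1}(r|H)\,dr,$$ where $f_{M_1}(\cdot|H)$ is the density of $M_1(H)$.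
   Context: Standing assumption: $\int\log(1+x)H(dx)<\infty$. $B_{a,b}$: Beta$(a,b)$. For a probability measure $K$ on $[0,\infty)$ with $\int\log(1+x)K(dx)<\infty$ and $\tau>0$, $M_\tau(K)$ is the mean of a Dirichlet process with shape $\tau K$, characterized by $\mathbb{E}[(1+\lambda M_\tau(K))^{-\tau}]=\exp(-\tau\int\log(1+\lambda x)K(dx))$, $\lambda>0$; $K^{(p)}:=pK+(1-p)\delta_0$ for $0<p\le1$. $X_\alpha$ is the ratio of two iid positive $\alpha$-stable variables, with density $\varrho_\alpha(y)=\frac{\sin(\pi\alpha)}{\pi}\frac{y^{\alpha-1}}{y^{2\alpha}+2y^\alpha\cos(\pi\alpha)+1}$, $y>0$. $\varrho_{\alpha,H}(x)=\frac{\sin(\pi\alpha)}{\pi}\int_0^\infty\frac{x^{\alpha-1}r}{x^{2\alpha}+2x^\alpha r\cos(\alpha\pi)+r^2}H(dr)$, $x>0$, is the density of $X_\alpha R^{1/\alpha}$ with $R\sim H$ independent of $X_\alpha$; its cdf is $\Upsilon_\alpha(x)=1-\frac{1}{\pi\alpha}\int_0^\infty\cot^{-1}\!\big(\cot(\pi\alpha)+\frac{x^\alpha/r}{\sin(\pi\alpha)}\big)H(dr)$, with $\cot^{-1}$ valued in $(0,\pi)$. $\mathscr{S}^H_\alpha(x)=\mathbb{E}[\log|x-X_\alpha R^{1/\alpha}|]=\frac{1}{2\alpha}\int_0^\infty\log(x^{2\alpha}+2x^\alpha r\cos(\alpha\pi)+r^2)H(dr)$. *)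

(* Defs.v *)
From HB Require Import structures.
From mathcomp Require Import all_boot all_order all_algebra.
From mathcomp Require Import all_classical all_reals all_analysis.

Set Implicit Arguments.
Unset Strict Implicit.
Unset Printing Implicit Defensive.

Import Order.TTheory GRing.Theory Num.Theory.
Import numFieldNormedType.Exports.

Local Open Scope classical_set_scope.
Local Open Scope ring_scope.

Section laws.
Context {R : realType}.
Local Notation leb := (@lebesgue_measure R).
Local Notation law := (probability (measurableTypeR R) R).
Implicit Types (a b al tau p r x y : R) (f : R -> R) (H m : law).
Implicit Types (K : set (measurableTypeR R) -> \bar R).

(* A density on (0, oo) is a function whose values on (-oo, 0] are irrelevant;
   [density_law f] is a measure when f is nonnegative and measurable there. *)
Definition density_law f (A : set (measurableTypeR R)) : \bar R :=
  (\int[leb]_(x in A `&` `]0%R, +oo[) (f x)%:E)%E.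

Definition has_density m f : Prop :=
  [/\ forall x, 0 < x -> 0 <= f x,
      @measurable_fun _ _ (measurableTypeR R) (measurableTypeR R) `]0, +oo[ f &
      forall A, measurable A -> m A = density_law f A].

(* The Beta(a, b) law for real a, b > 0: the beta distribution of the library
   only has natural number parameters. *)
Definition beta_weight a b x : R := x `^ (a - 1) * (1 - x) `^ (b - 1).

Definition beta_law a b : set (measurableTypeR R) -> \bar R :=
  density_law ((fun x => beta_weight a b x /
    \int[leb]_(y in `]0, 1[) beta_weight a b y) \_ `]0, 1[).

(* K^(p) = p K + (1 - p) delta_0 *)
Definition mix_zero p K (A : set (measurableTypeR R)) : \bar R :=
  (p%:E * K A + (1 - p)%:E * \d_(0%R : measurableTypeR R) A)%E.

(* [m] is the law of M_tau(K), the mean of a Dirichlet process with shape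
   tau K, as characterized by its generalized Cauchy-Stieltjes transform.
   The right-hand side is taken in the extended reals, so that a divergent
   logarithmic integral gives exp(-oo) = 0 and not a junk value. *)
Definition dirichlet_mean_law tau K m : Prop :=
  m `]-oo, 0[%classic = 0%E /\
  forall lam : R, 0 < lam ->
    (\int[m]_(x in `[0%R, +oo[) ((1 + lam * x) `^ (- tau))%:E =
     expeR (- (tau%:E * \int[K]_(x in `[0%R, +oo[) (ln (1 + lam * x))%:E)))%E.

(* The density of the ratio X_al of two iid positive al-stable variables. *)
Definition rho al y : R :=
  sin (pi * al) / pi *
  (y `^ (al - 1) / (y `^ (2 * al) + 2 * y `^ al * cos (pi * al) + 1)).

(* For x, r > 0, (sin (pi al) / pi) * rho_kernel al x r is the density at x of
   X_al r^(1/al). *)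
Definition rho_kernel al x r : R :=
  x `^ (al - 1) * r /
  (x `^ (2 * al) + 2 * x `^ al * r * cos (al * pi) + r ^+ 2).

(* The density of X_al R^(1/al), with R of law H independent of X_al. *)
Definition rhoH al H x : R :=
  sin (pi * al) / pi * \int[H]_(r in `]0, +oo[) rho_kernel al x r.

(* The cdf of X_al R^(1/al). *)
Definition Upsilon al H x : R := fine (density_law (rhoH al H) `]-oo, x]%classic).

(* E[log |x - X_al R^(1/al)|] *)
Definition logpot al H x : R :=
  \int[leb]_(y in `]0, +oo[) (ln `|x - y| * rhoH al H y).

(* The law of X W^(1/al) for independent X and W with laws [mX] and [mW]. *)
Definition prod_root_law al (mX mW : set (measurableTypeR R) -> \bar R)
    (A : set (measurableTypeR R)) : \bar R :=
  pushforward (mX \x mW)%E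
    (fun w : measurableTypeR R * measurableTypeR R =>
       w.1 * w.2 `^ al^-1 : measurableTypeR R) A.

(* The law of B Y W^(1/al) for independent B, Y, W with the given laws. *)
Definition prod3_root_law al (mB mY mW : set (measurableTypeR R) -> \bar R)
    (A : set (measurableTypeR R)) : \bar R :=
  pushforward (mB \x (mY \x mW))%E
    (fun w : measurableTypeR R * (measurableTypeR R * measurableTypeR R) =>
       w.1 * w.2.1 * w.2.2 `^ al^-1 : measurableTypeR R) A.

End laws.

(* Main.v *)
(* Write M for M_1(rho_{al,H}^(al theta)). Since E log(1 + lam X_al r^(1/al)) =
   log(1 + lam^al r) / al, the characterization of M reads
   E[1 / (1 + lam M)] = exp(- theta E log(1 + lam^al R)), R ~ H. The factors of
   the product representations turn 1 / (1 + z) successively into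
   (1 + z)^(- al theta), (1 + z^al)^(- theta) and this exponential, and the
   transform lam |-> E[1 / (1 + lam X^be)] determines a law on [0, oo): the
   polynomials in (1 + lam x^be)^-1 approximate the indicators of half lines.

   The density comes from rotating a contour: the function
   exp(- theta E log(1 + R w^(- al))) / (1 + lam (- w)^al) is holomorphic on the
   upper half plane, up to the negative half line because al < 1. On w = - t its
   imaginary part is pi t times the claimed density over 1 + lam t^al; on w = t
   it is pi t times exp(- theta E log(1 + R t^(- al))) times the density at t
   of T = X_al lam^(-1/al), and both have the same integral with respect to
   dt / t. As exp(- theta E log(1 + R t^(- al))) = E[1 / (1 + M / t)], the second
   one gives E[1 / (1 + M / T)] = E[1 / (1 + lam M^al)], because 1 / X_al has the
   law of X_al. *)
Require Import Defs.
From HB Require Import structures.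
From mathcomp Require Import all_boot all_order all_algebra.
From mathcomp Require Import all_classical all_reals all_analysis.
From mathcomp Require Import measurable_realfun ring lra.

Set Implicit Arguments.
Unset Strict Implicit.
Unset Printing Implicit Defensive.

Import Order.TTheory GRing.Theory Num.Theory.
Import numFieldNormedType.Exports.

Local Open Scope classical_set_scope.
Local Open Scope ring_scope.

(** No complex function appears: a function of w = t e^(ip) is carried as a pair of real functions
    of t and p, and Cauchy's theorem becomes Fubini on a rectangle, with the Cauchy-Riemann
    equations read off explicit derivatives. Everything is assembled from log (1 + e^w), whose
    bounds for |p| < pi feed all dominations. Two rotations are made. The one with kernel log (1 -
    w) / (1 + c w^al) evaluates E log (1 + lam X_al) and E log |x - X_al|: the choice of the half
    line on which the denominator is real decides which of the two survives. The first value
    differentiated in lam gives E[1 / (1 + lam X_al)]. The singularity w = 1 of this kernel lies on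
    the contour, so the angle only tends to 0, under an explicit majorant. The other rotation, for
    the density of M, keeps all its angles within al pi < pi and uses the closed half plane; the
    delicate point there is the decay at w = 0, which has no rate because H is arbitrary. The
    candidate density is not known beforehand to have mass 1, so uniqueness compares a law with a
    mere measure. *)

Section calculus.
Context {R : realType}.
Local Notation leb := (@lebesgue_measure R).
Implicit Types (a b : R) (f F : R -> R).

(** * Integrals over exhausting segments, and contour rotation *)

Lemma measurable_funV d (T : measurableType d) (D : set T) (f : T -> R) :
  measurable_fun D f -> measurable_fun D (fun x => (f x)^-1).
Proof.
move=> mf.
(* [powR_inv1] wants a nonnegative base, hence the square. Where f vanishes both sides are 0, the
   inverse of 0 being 0. *)
rewrite (_ : (fun x => _) = (fun x => f x * (f x ^+ 2) `^ (-1))); last first.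
  apply/funext => x; rewrite powR_inv1 ?sqr_ge0//.
  have [->|x0] := eqVneq (f x) 0; first by rewrite mul0r invr0.
  by rewrite expr2 invfM mulrA divff// mul1r.
apply: measurable_funM => //.
apply: (measurableT_comp (measurable_powR _)).
exact: measurable_funX.
Qed.

Lemma is_derive_continuous f (df x : R) :
  is_derive x 1 f df -> {for x, continuous f}.
Proof.
by move=> [dfx _]; exact/differentiable_continuous/derivable1_diffP.
Qed.

Lemma FTC_segment f F a b : a <= b ->
  (forall x, a <= x <= b -> {for x, continuous f}) ->
  (forall x, a <= x <= b -> is_derive x 1 F (f x)) ->
  (\int[leb]_(x in `[a, b]) (f x)%:E = (F b - F a)%:E)%E.
Proof.
rewrite le_eqVlt => /predU1P[<- _ _|ab cf dF].
  by rewrite set_itv1 integral_set1 subrr.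
have cF x : a <= x <= b -> {for x, continuous F}.
  by move=> /dF; exact: is_derive_continuous.
rewrite (@continuous_FTC2 _ f F)//.
- apply: continuous_in_subspaceT => x; rewrite inE/= in_itv/=; exact: cf.
- split.
  + move=> x; rewrite in_itv/= => /andP[ax xb].
    by have [] := dF x; rewrite ?(ltW ax) ?(ltW xb).
  + by apply: cvg_at_right_filter; apply: cF; rewrite lexx ltW.
  + by apply: cvg_at_left_filter; apply: cF; rewrite lexx ltW.
- move=> x; rewrite in_itv/= => /andP[ax xb].
  by have /dF[_ <-] : a <= x <= b; rewrite ?derive1E ?(ltW ax) ?(ltW xb).
Qed.

(** Monotone convergence along growing segments. The value [l] may be infinite, so no integrability
    has to be established in advance. *)
Lemma ge0_integral_exhaust f (u w : nat -> R) (D : set R) (l : \bar R) :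
  {homo u : m n / (m <= n)%N >-> n <= m} ->
  {homo w : m n / (m <= n)%N >-> m <= n} ->
  D = \bigcup_n `[u n, w n]%classic ->
  (forall x, D x -> 0 <= f x) -> measurable_fun D f ->
  (\int[leb]_(x in `[u n, w n]) (f x)%:E @[n --> \oo] --> l)%E ->
  (\int[leb]_(x in D) (f x)%:E = l)%E.
Proof.
move=> hu hw DE f0 mf cl.
have sub n : `[u n, w n] `<=` D by move=> x; rewrite DE; exists n.
have := @ge0_nondecreasing_set_cvg_integral _ (measurableTypeR R) R
  (fun n => `[u n, w n]%classic) (EFin \o f) leb.
rewrite -DE => /(_ _ _ _ _)/cvg_lim <- //.
- by apply: cvg_lim => //; exact: cl.
- move=> m n mn; apply/subsetPset => x/=; rewrite !in_itv/= => /andP[h1 h2].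
  by rewrite (le_trans (hu _ _ mn))//= (le_trans h2)// hw.
- by move=> n; apply/measurable_EFinP; apply: measurable_funS mf => //;
    rewrite DE; apply: bigcup_measurable.
- by move=> n x /= xn; rewrite lee_fin f0//; exact: (sub n).
Qed.

(** For a nonnegative integrand the limits of a primitive along one pair of sequences determine the
    improper integral. *)
Lemma ge0_FTC_exhaust f F (u w : nat -> R) (D : set R) (l l' : R) :
  {homo u : m n / (m <= n)%N >-> n <= m} ->
  {homo w : m n / (m <= n)%N >-> m <= n} ->
  (forall n, u n <= w n) ->
  D = \bigcup_n `[u n, w n]%classic ->
  (forall x, D x -> 0 <= f x) -> measurable_fun D f ->
  (forall x, D x -> {for x, continuous f}) ->
  (forall x, D x -> is_derive x 1 F (f x)) ->
  F (u n) @[n --> \oo] --> l -> F (w n) @[n --> \oo] --> l' ->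
  (\int[leb]_(x in D) (f x)%:E = (l' - l)%:E)%E.
Proof.
move=> hu hw uw DE f0 mf cf dF Fl Fl'.
apply: (ge0_integral_exhaust hu hw DE) => //.
have sub n : `[u n, w n] `<=` D by move=> x; rewrite DE; exists n.
have E n : (\int[leb]_(x in `[u n, w n]) (f x)%:E = (F (w n) - F (u n))%:E)%E.
  by apply: FTC_segment => // x xn; [apply: cf|apply: dF];
    apply: (sub n); rewrite /= in_itv.
under eq_fun do rewrite E.
by apply/fine_cvgP; split; [exact: nearW|exact: cvgB].
Qed.

Lemma itv0yE :
  `]0, +oo[%classic = \bigcup_n `[n.+1%:R^-1, n.+1%:R]%classic :> set R.
Proof.
apply/seteqP; split => x/=; last first.
  move=> [n _ /=]; rewrite !in_itv/= andbT => /andP[+ _].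
  by apply: lt_le_trans; rewrite invr_gt0.
rewrite in_itv/= andbT => x0.
(* The sum exceeds both x and 1/x, so a single integer serves both end points. *)
pose n := Num.truncn (x + x^-1); exists n => //=; rewrite in_itv/=.
have : x + x^-1 < n.+1%:R by apply: truncnS_gt.
move=> h; apply/andP; split.
  rewrite -[leRHS]invrK lef_pV2 ?posrE ?invr_gt0// ltW//.
  by rewrite (le_lt_trans _ h)// lerDr ltW.
by rewrite ltW// (le_lt_trans _ h)// lerDl invr_ge0 ltW.
Qed.

(* Contour rotation: if [a + i b] is holomorphic at [t e^(ip)], then
   [t d_t a = d_p b] (polar Cauchy-Riemann, [d = d_t a]); integrate [d] over the
   rectangle in both orders. *)
Lemma rotation (a b d : R -> R -> R) (C t1 t2 p1 p2 : R) :
  0 < t1 -> t1 <= t2 -> p1 <= p2 ->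
  measurable_fun setT
    (fun p : measurableTypeR R * measurableTypeR R => d p.1 p.2) ->
  (forall t p, t1 <= t <= t2 -> p1 <= p <= p2 ->
    [/\ is_derive t 1 (a ^~ p) (d t p), is_derive p 1 (b t) (t * d t p),
        {for t, continuous (d ^~ p)}, {for p, continuous (d t)} &
        `|d t p| <= C]) ->
  (\int[leb]_(t in `[t1, t2]) (t^-1 * (b t p2 - b t p1))%:E =
   \int[leb]_(p in `[p1, p2]) (a t2 p - a t1 p)%:E)%E.
Proof.
move=> t10 t12 p12 md H.
pose I := `[t1, t2]%classic : set (measurableTypeR R).
pose J := `[p1, p2]%classic : set (measurableTypeR R).
(* Extension by 0 from the rectangle to the plane, where Fubini applies; the bound [C] on the
   rectangle makes it integrable. *)
pose h := (fun p : measurableTypeR R * measurableTypeR R =>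
  (d p.1 p.2)%:E) \_ (I `*` J).
have mI : measurable I by exact: measurable_itv.
have mJ : measurable J by exact: measurable_itv.
have mIJ : measurable (I `*` J) by exact: measurableX.
have mh : measurable_fun setT h.
  by apply/(measurable_restrictT _ mIJ)/measurable_EFinP; exact: measurable_funTS.
have hI : (leb \x leb)%E.-integrable setT h.
  apply/(integrable_mkcond _ mIJ).
  suff : (leb \x leb)%E.-integrable (I `*` J) (EFin \o (fun p => d p.1 p.2)) by [].
  apply: measurable_bounded_integrable => //.
  - change ((leb \x leb)%E (I `*` J) < +oo)%E.
    have -> : (leb \x leb)%E (I `*` J) = (leb I * leb J)%E.
      exact: product_measure1E.
    by rewrite !lebesgue_measure_itv/=; case: ifP => _;
      case: ifP => _; rewrite ?mule0 ?mul0e ?lte_pinfty// -!EFinB -EFinM ltry.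
  - exact: measurable_funTS.
  - exists C; split; first exact: num_real.
    move=> x Cx [t p]/= [] It Jp; have [||_ _ _ _] := H t p.
    + by move: It; rewrite /I/= in_itv.
    + by move: Jp; rewrite /J/= in_itv.
    + by move/le_trans; apply; exact: ltW.
have := Fubini hI.
have -> : (\int[leb]_x \int[leb]_y h (x, y) =
   \int[leb]_(t in `[t1, t2]) (t^-1 * (b t p2 - b t p1))%:E)%E.
  rewrite [RHS]integral_mkcond; apply: eq_integral => t _.
  rewrite /patch; case: ifPn => tI; last first.
    rewrite integral0_eq// => p _; rewrite /h patchE ifF//.
    by apply/negP => /[!inE] -[/= It _]; move/negP: tI; apply; rewrite inE.
  move: tI; rewrite inE/= in_itv/= => tI.
  transitivity (\int[leb]_(p in `[p1, p2]) (d t p)%:E)%E.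
    rewrite [RHS]integral_mkcond; apply: eq_integral => p _.
    rewrite /h !patchE; congr (if _ then _ else _).
    by apply/idP/idP => /[!inE]/=; [case|move=> ?; split; rewrite // /I/= in_itv].
  have t0 : t != 0 by apply: lt0r_neq0; case/andP: tI => + _; exact: lt_le_trans.
  rewrite mulrBr; apply: (@FTC_segment (d t) (fun p => t^-1 * b t p)) => // p pJ.
    by have [] := H _ _ tI pJ.
  have [_ dp _ _ _] := H _ _ tI pJ.
  by apply: is_derive_eq; rewrite /GRing.scale/= mulKf.
move=> ->.
rewrite [RHS]integral_mkcond; apply: eq_integral => p _.
rewrite /patch; case: ifPn => pJ; last first.
  rewrite integral0_eq// => t _; rewrite /h patchE ifF//.
  by apply/negP => /[!inE] -[/= _ Jp]; move/negP: pJ; apply; rewrite inE.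
move: pJ; rewrite inE/= in_itv/= => pJ.
transitivity (\int[leb]_(t in `[t1, t2]) (d t p)%:E)%E.
  rewrite [RHS]integral_mkcond; apply: eq_integral => t _.
  rewrite /h !patchE; congr (if _ then _ else _).
  by apply/idP/idP => /[!inE]/=; [case|move=> ?; split; rewrite // /J/= in_itv].
by apply: (@FTC_segment (d ^~ p) (a ^~ p)) => // t tI; have [] := H _ _ tI pJ.
Qed.

End calculus.

(** * Uniqueness of a measure on [0, oo) from its transforms *)

Section uniqueness.
Context {R : realType}.
Implicit Types (lam a x y u C : R).

Lemma bernoulli_le (n : nat) u : 0 <= u <= 1 -> 1 - n%:R * u <= (1 - u) ^+ n.
Proof.
move=> /andP[u0 u1]; elim: n => [|n ih]; first by rewrite mul0r subr0 expr0.
rewrite exprSr; apply: (@le_trans _ _ ((1 - n%:R * u) * (1 - u))).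
  rewrite -natr1; have : 0 <= n%:R * u * u by rewrite !mulr_ge0.
  by nra.
by rewrite ler_wpM2r// subr_ge0.
Qed.

(** Through (1 - u)^n <= exp(- n u) and 1 + n u <= exp(n u). *)
Lemma expr_onem_le (n : nat) u : 0 <= u <= 1 -> (1 - u) ^+ n <= (1 + n%:R * u)^-1.
Proof.
move=> /andP[u0 u1].
have h : 0 < 1 + n%:R * u by rewrite ltr_pwDl// mulr_ge0.
rewrite -[leRHS]mul1r ler_pdivlMr//.
apply: (@le_trans _ _ (expR (- u) ^+ n * expR (n%:R * u))).
  apply: ler_pM => //; [by rewrite exprn_ge0// subr_ge0|exact: ltW| |].
    by rewrite lerXn2r ?nnegrE ?subr_ge0 ?expR_ge0// expR_ge1Dx.
  exact: expR_ge1Dx.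
by rewrite -expRM_natl -expRD mulrN addNr expR0.
Qed.

(* The polynomial steps [1 - (1 - y^n)^(n 2^n)] of the classical proof of the
   Stone-Weierstrass theorem, jumping at [y = 1/2]. *)
Lemma poly_step_cvg y : 0 < y <= 1 ->
  (1 - (1 - y ^+ n) ^+ (n * 2 ^ n) : R) @[n --> \oo] --> ((2^-1 <= y)%R%:R : R).
Proof.
move=> /andP[y0 y1].
have yn n : 0 <= y ^+ n <= 1 by rewrite exprn_ge0 ?exprn_ile1 ?(ltW y0).
case: leP => h /=.
(* For y >= 1/2 the subtracted power is at most 1 / (1 + n (2y)^n) <= 1 / (n + 1), by
   [expr_onem_le]. *)
- rewrite -[X in _ --> X]subr0; apply: cvgB; first exact: cvg_cst.
  apply: (@squeeze_cvgr _ _ _ _ (cst 0) (@harmonic R)); last 2 first.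
  + exact: cvg_cst.
  + exact: cvg_harmonic.
  apply: nearW => n; rewrite /= exprn_ge0 ?subr_ge0; last by case/andP: (yn n).
  rewrite /harmonic /=; apply: (le_trans (expr_onem_le _ (yn n))).
  rewrite lef_pV2 ?posrE ?ltr0n//; last first.
    by rewrite ltr_pwDl// mulr_ge0//; case/andP: (yn n).
  rewrite -natr1 addrC lerD2l natrM natrX -mulrA ler_peMr//.
  by rewrite -exprMn exprn_ege1// -ler_pdivrMl// mulr1.
- rewrite -[X in _ --> X](subrr (1 : R)); apply: cvgB; first exact: cvg_cst.
  pose c := - ln (2 * y).
  have y2 : 0 < 2 * y by rewrite mulr_gt0.
  have c0 : 0 < c by rewrite oppr_gt0 ln_lt0// y2/= -ltr_pdivlMl// mulr1.
  (* For y < 1/2 Bernoulli leaves the error n (2y)^n = n exp(- n c), and exp(n c) >= 1 + (n c)^2 / 2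
     makes it O(1/n). At n = 0 both sides are 0, as the inverse of 0 is 0. *)
  have q n : n%:R * (2 * y) ^+ n <= 2 / c ^+ 2 / n%:R.
    case: n => [|n]; first by rewrite mul0r invr0 mulr0.
    have -> : (2 * y) ^+ n.+1 = (expR (n.+1%:R * c))^-1.
      by rewrite expRM_natl /c expRN lnK ?posrE// exprVn invrK.
    rewrite ler_pdivlMr ?ltr0n// ler_pdivlMr ?exprn_gt0//.
    rewrite mulrAC -mulrA -mulrA mulrCA ler_pdivrMl ?expR_gt0//.
    have /(_ _)/le_trans := @expR_ge1Dxn R (n.+1%:R * c) 1.
    move=> /(_ (expR (n.+1%:R * c))); rewrite lexx.
    move=> /(_ _ isT) => /(_ _)/=.
    rewrite mulr_ge0 ?(ltW c0)//= => /(_ isT).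
    set e := expR _; set m : R := n.+1%:R => {}h.
    have : (2`! = 2)%N by []; move: h => /[swap] -> h.
    by nra.
  apply: (@squeeze_cvgr _ _ _ _ (fun n => 1 - 2 / c ^+ 2 * n%:R^-1) (cst 1)).
  + apply: nearW => n /=; rewrite exprn_ile1 ?subr_ge0 ?gerBl//; last 2 first.
    * by case/andP: (yn n).
    * by case/andP: (yn n).
    rewrite andbT (le_trans _ (bernoulli_le _ (yn n)))//.
    by rewrite lerD2l lerN2 (le_trans _ (q n))// natrM natrX exprMn mulrA.
  + rewrite -[X in _ --> X]subr0; apply: cvgB; first exact: cvg_cst.
    rewrite -[X in _ --> X](mulr0 (2 / c ^+ 2)); apply: cvgMr.
    by rewrite -cvg_shiftS; exact: cvg_harmonic.
  + exact: cvg_cst.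
Qed.

(** [nu] is only a measure, because the densities it stands for are not yet known to have mass 1.
    The exponent [be] is [al] for the density of M and 1 for the products and the mixture. *)
Context (mu : probability (measurableTypeR R) R)
        (nu : {measure set (measurableTypeR R) -> \bar R}) (be : R).
Hypotheses (be0 : 0 < be) (mu0 : mu `]-oo, 0[%classic = 0%E)
           (nu0 : nu `]-oo, 0[%classic = 0%E).
Let D : set (measurableTypeR R) := `[0, +oo[%classic.
Let T lam x : R := (1 + lam * x `^ be)^-1.
Hypothesis stieltjes_eq : forall lam, 0 < lam ->
  (\int[mu]_(x in D) (T lam x)%:E = \int[nu]_(x in D) (T lam x)%:E)%E.

Let mD : measurable D.
Proof. exact: measurable_itv. Qed.

Let Tden lam x : 0 <= lam -> 0 < 1 + lam * x `^ be.
Proof. by move=> l0; rewrite ltr_pwDl// mulr_ge0// powR_ge0. Qed.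

Let T01 lam x : 0 <= lam -> 0 < T lam x <= 1.
Proof.
move=> l0; rewrite invr_gt0 Tden// invf_le1 ?Tden//.
by rewrite lerDl mulr_ge0// powR_ge0.
Qed.

Let mT (A : set (measurableTypeR R)) lam : measurable_fun A (T lam).
Proof.
apply: measurable_funTS; apply: measurable_funV; apply: measurable_funD => //.
by apply: measurable_funM => //; exact: measurable_powR.
Qed.

Let muD : mu D = 1%E.
Proof.
have := @probability_setT _ _ _ mu.
have -> : setT = `]-oo, 0[%classic `|` D :> set R.
  by apply/seteqP; split => x //= _; case: (ltP x 0) => h; [left|right];
    rewrite /D/= in_itv/= ?h.
rewrite measureU//; last first.
  apply/seteqP; split => x //=; rewrite /D/= !in_itv/= andbT => -[h].
  by rewrite leNgt h.
by rewrite [X in (X + _)%E]mu0 add0e.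
Qed.

Let Tcvg x : x \in D -> T (@harmonic R n) x @[n --> \oo] --> (1 : R).
Proof.
move=> _; rewrite -[X in _ --> X]invr1; apply: cvgV => //.
rewrite -[X in _ --> X]addr0; apply: cvgD; first exact: cvg_cst.
rewrite -[X in _ --> X](mul0r (x `^ be)); apply: cvgMl; exact: cvg_harmonic.
Qed.

(** As lam decreases to 0 the kernel increases to 1, and monotone convergence recovers the total
    mass. This is how [nu] is shown to have mass 1. *)
Let mass (m : {measure set (measurableTypeR R) -> \bar R}) :
  (\int[m]_(x in D) (T (@harmonic R n) x)%:E @[n --> \oo] --> m D)%E.
Proof.
rewrite -[X in _ --> X]mul1e -[X in _ --> X]integral_cst//.
have -> : (\int[m]_(x in D) cst 1 x = \int[m]_(x in D)
    limn (fun n => (T (@harmonic R n) x)%:E))%E.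
  apply: eq_integral => x xD; apply/esym/cvg_lim => //.
  by apply/fine_cvgP; split; [exact: nearW|exact: Tcvg].
apply: cvg_monotone_convergence => //.
- by move=> n; apply/measurable_EFinP; exact: mT.
- by move=> n x _; rewrite lee_fin ltW//; case/andP: (T01 x (harmonic_ge0 n)).
- move=> x _ k n kn; rewrite lee_fin lef_pV2 ?posrE ?Tden ?harmonic_ge0//.
  rewrite lerD2l ler_wpM2r ?powR_ge0// lef_pV2 ?posrE ?ltr0n// ler_nat.
  by rewrite ltnS.
Qed.

Let nuD : nu D = 1%E.
Proof.
rewrite -muD.
have : (\int[mu]_(x in D) (T (@harmonic R n) x)%:E @[n --> \oo] --> nu D)%E.
  under eq_fun do rewrite stieltjes_eq ?harmonic_gt0//.
  exact: (@mass nu).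
move=> /cvg_lim <- //; have := @mass mu; exact: cvg_lim.
Qed.

(** The test functions that do not separate [mu] from [nu]. Boundedness belongs to the class so that
    constants, integrable since both masses are 1, can dominate. *)
Let EQ (f : R -> R) : Prop := [/\ measurable_fun D (f : measurableTypeR R -> R),
  exists C, forall x, D x -> `|f x| <= C &
  (\int[mu]_(x in D) (f x)%:E = \int[nu]_(x in D) (f x)%:E)%E].

Let bounded_integrable (m : {measure set (measurableTypeR R) -> \bar R})
    (f : R -> R) C : m D = 1%E ->
  measurable_fun D (f : measurableTypeR R -> R) ->
  (forall x, D x -> `|f x| <= C) -> m.-integrable D (EFin \o f).
Proof.
move=> m1 mf fC; apply: measurable_bounded_integrable => //.
  by rewrite m1 ltry.
exists C; split; first exact: num_real.
by move=> x Cx y Dy; apply: (le_trans (fC _ Dy)); exact: ltW.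
Qed.

Let EQ_lin (f g : R -> R) a b : EQ f -> EQ g -> EQ (fun x => a * f x + b * g x).
Proof.
move=> [mf [Cf fC] ef] [mg [Cg gC] eg]; split.
- by apply: measurable_funD; apply: measurable_funM.
- exists (`|a| * Cf + `|b| * Cg) => x Dx.
  by rewrite (le_trans (ler_normD _ _))// !normrM lerD// ler_wpM2l ?fC ?gC.
- have E (m : {measure set (measurableTypeR R) -> \bar R}) : m D = 1%E ->
    (\int[m]_(x in D) (a * f x + b * g x)%:E =
     a%:E * \int[m]_(x in D) (f x)%:E + b%:E * \int[m]_(x in D) (g x)%:E)%E.
    move=> m1; have if_ := bounded_integrable m1 mf fC.
    have ig := bounded_integrable m1 mg gC.
    rewrite -integralZl// -integralZl//.
    by rewrite -integralD//; apply: integrableZl.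
  apply: (etrans (E mu muD)); apply/esym; apply: (etrans (E nu nuD)).
  by congr (_ * _ + _ * _)%E; apply/esym.
Qed.

Let EQ_lim (f_ : nat -> R -> R) (f : R -> R) C : (forall n, EQ (f_ n)) ->
  (forall n x, D x -> `|f_ n x| <= C) ->
  (forall x, D x -> f_ n x @[n --> \oo] --> f x) -> EQ f.
Proof.
move=> Ef_ fC ff.
have fCl x : D x -> `|f x| <= C.
  move=> Dx; have h : `|f_ n x| @[n --> \oo] --> `|f x| by apply: cvg_norm; exact: (ff _ Dx).
  rewrite -(cvg_lim _ h)//.
  by apply: limr_le; [apply/cvg_ex; exists `|f x|; exact: h|apply: nearW => n; exact: fC].
have mf : measurable_fun D (f : measurableTypeR R -> R).
  apply: (@measurable_fun_cvg _ _ _ _ (f_ : nat -> measurableTypeR R -> R)) => //.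
  by move=> n; have [] := Ef_ n.
split => //; first by exists C.
have E (m : {measure set (measurableTypeR R) -> \bar R}) : m D = 1%E ->
  (\int[m]_(x in D) (f_ n x)%:E @[n --> \oo] --> \int[m]_(x in D) (f x)%:E)%E.
  move=> m1; have [//|||||_ _] := @dominated_convergence _ _ _ m D mD
    (fun n x => (f_ n x)%:E) (EFin \o f) (cst C%:E).
  - by move=> n; apply/measurable_EFinP; have [] := Ef_ n.
  - exact/measurable_EFinP.
  - by apply: aeW => x Dx; apply: cvg_EFin; [exact: nearW|exact: ff].
  - by apply/(@bounded_integrable _ (cst C) `|C|) => // x _ /=.
  - by apply: aeW => x n Dx; rewrite lee_fin fC.
  by [].
have Em := E mu muD; have En := E nu nuD.
have : (\int[nu]_(x in D) (f_ n x)%:E @[n --> \oo] --> \int[mu]_(x in D) (f x)%:E)%E.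
  have e : (fun n => \int[nu]_(x in D) (f_ n x)%:E)%E =
      (fun n => \int[mu]_(x in D) (f_ n x)%:E)%E.
    by apply/funext => n; have [_ _ ->] := Ef_ n.
  by rewrite e.
by move=> /cvg_lim <- //; exact: cvg_lim.
Qed.

Let EQ_ext (f g : R -> R) : (forall x, D x -> f x = g x) -> EQ f -> EQ g.
Proof.
move=> fg Ef; have [mf [C fC] _] := Ef.
apply: (@EQ_lim (fun=> f) g C) => //.
by move=> x Dx; rewrite fg//; exact: cvg_cst.
Qed.

Let T_le1 lam x n : 0 < lam -> `|T lam x ^+ n| <= 1.
Proof.
move=> l0; have /andP[t0 t1] := T01 x (ltW l0).
by rewrite ger0_norm ?exprn_ge0 ?exprn_ile1 ?(ltW t0).
Qed.

(** Partial fractions give (lam - lam') T T' = lam T - lam' T' for distinct parameters, hence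
    T^(n+1) T' from T^(n+1) and T^n T'. Letting lam' tend to lam turns T^n T' into T^(n+1). The two
    families therefore grow together. *)
Let EQ_pow n : (forall lam, 0 < lam -> EQ (fun x => T lam x ^+ n)) /\
  (forall lam lam', 0 < lam -> 0 < lam' -> lam != lam' ->
     EQ (fun x => T lam x ^+ n * T lam' x)).
Proof.
have EQT lam : 0 < lam -> EQ (T lam).
  move=> l0; split; [exact: mT|exists 1 => x _|exact: stieltjes_eq].
  by have := T_le1 x 1 l0.
elim: n => [|n [ihP ihQ]].
  split=> [lam l0|lam lam' l0 l0' _]; last first.
    by apply: EQ_ext (EQT _ l0') => x _; rewrite mul1r.
  split=> //; first by exists 1 => x _; rewrite normr1.
  have E (m : {measure set (measurableTypeR R) -> \bar R}) : m D = 1%E ->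
      (\int[m]_(x in D) (T lam x ^+ 0)%:E = 1)%E.
    move=> m1; under eq_integral do rewrite expr0.
    by rewrite integral_cst// mul1e.
  by rewrite (etrans (E mu muD) (esym (E nu nuD))).
have P lam : 0 < lam -> EQ (fun x => T lam x ^+ n.+1).
  move=> l0; pose l' k := lam + k.+1%:R^-1.
  have l'0 k : 0 < l' k by rewrite addr_gt0// invr_gt0.
  apply: (@EQ_lim (fun k x => T lam x ^+ n * T (l' k) x) _ 1).
  - by move=> k; apply: ihQ => //; rewrite lt_eqF// ltrDl invr_gt0.
  - move=> k x Dx; rewrite normrM -[leRHS]mulr1 ler_pM//; first exact: T_le1.
    by have := T_le1 x 1 (l'0 k).
  - move=> x Dx; rewrite exprSr; apply: cvgMr.
    apply: cvgV; first by rewrite gt_eqF// Tden// ltW.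
    apply: cvgD; first exact: cvg_cst.
    apply: cvgMl; rewrite -[X in _ --> X]addr0; apply: cvgD; first exact: cvg_cst.
    exact: cvg_harmonic.
split=> // lam lam' l0 l0' ll'.
apply: EQ_ext (EQ_lin (lam / (lam - lam')) (- (lam' / (lam - lam'))) (P _ l0)
  (ihQ _ _ l0 l0' ll')) => x _.
have := gt_eqF (Tden x (ltW l0)); have := gt_eqF (Tden x (ltW l0')).
have : lam - lam' != 0 by rewrite subr_eq0.
rewrite exprS; move: (T lam x ^+ n) => t h1 h2 h3; rewrite /T.
by field; rewrite h1 h2 h3.
Qed.

Let EQ_poly lam (p : {poly R}) : 0 < lam -> EQ (fun x => p.[T lam x]).
Proof.
(* The extra power absorbs the factor X that [poly_ind] puts on the polynomial. *)
move=> l0; suff: forall k, EQ (fun x => p.[T lam x] * T lam x ^+ k).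
  by move=> /(_ 0); apply: EQ_ext => x _; rewrite expr0 mulr1.
elim/poly_ind: p => [|p c ih] k.
  apply: EQ_ext (EQ_lin 0 0 (proj1 (EQ_pow 0) _ l0) (proj1 (EQ_pow 0) _ l0)).
  by move=> x _; rewrite horner0 !mul0r addr0.
apply: EQ_ext (EQ_lin 1 c (ih k.+1) (proj1 (EQ_pow k) _ l0)) => x _.
by rewrite hornerMXaddC exprS; ring.
Qed.

Let EQ_itvoy a : 0 < a -> EQ (\1_`]a, +oo[).
Proof.
(* With this [lam] the kernel T takes the value 1/2 exactly at a, the point where the steps of
   [poly_step_cvg] jump. *)
move=> a0; pose lam := a `^ (- be).
have l0 : 0 < lam by rewrite powR_gt0.
suff E : EQ (fun x => (2^-1 <= T lam x)%R%:R).
  apply: EQ_ext (EQ_lin 1 (-1) (proj1 (EQ_pow 0) _ l0) E) => x.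
  rewrite /D/= in_itv/= andbT => x0; rewrite expr0 indicE.
  have -> : (2^-1 <= T lam x) = (x <= a).
    rewrite /T lef_pV2 ?posrE ?Tden ?(ltW l0)//.
    have -> : (1 + lam * x `^ be <= 2) = (lam * x `^ be <= 1) by apply/idP/idP; lra.
    rewrite /lam powRN -[leRHS](@mulVf _ (a `^ be)) ?gt_eqF ?powR_gt0//.
    rewrite ler_pM2l ?invr_gt0 ?powR_gt0//.
    apply/idP/idP => [|h]; last first.
      by apply: ge0_ler_powR; rewrite ?nnegrE ?(ltW be0) ?(ltW a0).
    apply: contraTT; rewrite -!ltNge => h.
    by apply: gt0_ltr_powR; rewrite ?nnegrE ?(ltW a0).
  rewrite mulr1 mulN1r.
  have -> : (x \in `]a, +oo[%classic) = (a < x).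
    by apply/idP/idP; rewrite inE/= in_itv/= andbT.
  by rewrite ltNge; case: leP => _; rewrite ?subrr ?subr0.
apply: (@EQ_lim (fun n x => 1 - (1 - T lam x ^+ n) ^+ (n * 2 ^ n)) _ 1).
- move=> n; have := EQ_poly (1 - (1 - 'X ^+ n) ^+ (n * 2 ^ n)) l0.
  by apply: EQ_ext => x _; rewrite !hornerE.
- move=> n x _; have /andP[t0 t1] := T01 x (ltW l0).
  have h : 0 <= 1 - T lam x ^+ n <= 1.
    by rewrite subr_ge0 exprn_ile1 ?gerBl ?exprn_ge0 ?(ltW t0).
  have h' : 0 <= (1 - T lam x ^+ n) ^+ (n * 2 ^ n) <= 1.
    by case/andP: h => ? ?; rewrite exprn_ge0 ?exprn_ile1.
  by rewrite ger0_norm ?gerBl ?subr_ge0; case/andP: h'.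
- by move=> x _; apply: poly_step_cvg; exact: T01 (ltW l0).
Qed.

(** No [lam] puts the jump at 0, where T is always 1; the half line is reached as a limit of those
    starting at 1/(n + 1). *)
Let EQ_itv0y : EQ (\1_`]0, +oo[).
Proof.
apply: (@EQ_lim (fun n => \1_`]n.+1%:R^-1, +oo[) _ 1).
- by move=> n; apply: EQ_itvoy; rewrite invr_gt0.
- by move=> n x _; rewrite indicE; case: (_ \in _); rewrite ?normr1 ?normr0.
- move=> x; rewrite /D/= in_itv/= andbT => x0.
  have E b : (x \in `]b, +oo[%classic) = (b < x) :> bool.
    by apply/idP/idP; rewrite inE/= in_itv/= andbT.
  rewrite indicE E; case: ltP => [{}x0|x0'].
    apply: cvg_near_cst.
    have : \forall n \near \oo, @harmonic R n < x.
      exact: (@cvgr_lt _ _ _ _ _ _ (cvg_harmonic) _ x0).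
    by apply: filterS => n h; rewrite indicE E h.
  under eq_fun do rewrite indicE E ltNge (le_trans x0')//=.
  exact: cvg_cst.
Qed.

(** The half lines ]x, oo[ are stable under intersection and generate the Borel sets. For x < 0 they
    carry the whole mass, so agreement there is that of the two masses. *)
Lemma stieltjes_measure_unique (A : set (measurableTypeR R)) :
  measurable A -> mu A = nu A.
Proof.
apply: (@measure_unique _ R (measurableTypeR R) (@RGenOInfty.G R)
  (fun n => `](- n%:R), +oo[%classic)).
- exact: RGenOInfty.measurableE.
- move=> _ _ [x ->] [y ->]; exists (Num.max x y).
  by apply/seteqP; split => z /=; rewrite !in_itv/= !andbT gt_max => /andP.
- by move=> n; exists (- n%:R).
- apply/seteqP; split => x //= _; exists (Num.truncn `|x|).+1 => //=.
  rewrite in_itv/= andbT ltrNl; apply: (le_lt_trans (ler_norm _)).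
  by rewrite normrN; exact: truncnS_gt.
- move=> _ [x ->].
  have split_at0 (m : {measure set (measurableTypeR R) -> \bar R}) :
      m `]-oo, 0[%classic = 0%E ->
      m `]x, +oo[%classic = (\int[m]_(x' in D) (\1_`]x, +oo[ x')%:E)%E.
    move=> m0; rewrite integral_indic//=.
    rewrite (@measureDI _ _ _ m `]x, +oo[%classic D)//.
    rewrite [X in (X + _)%E](_ : _ = 0%E) ?add0e//.
    apply: (@subset_measure0 _ _ _ m _ `]-oo, 0[%classic) => //.
      exact: measurableD.
    by move=> y [_]; rewrite /D/= !in_itv/= andbT => /negP; rewrite -ltNge.
  rewrite !split_at0//; have [x0|x0] := ltP x 0.
    have E (m : {measure set (measurableTypeR R) -> \bar R}) :
        (\int[m]_(x' in D) (\1_`]x, +oo[ x')%:E = m D)%E.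
      rewrite integral_indic//; congr (m _); apply/seteqP; split => y [] // .
      rewrite /D/= !in_itv/= !andbT => y0; split => //=.
      exact: (lt_le_trans x0).
    by apply: (etrans (E mu)); apply: (etrans muD); apply/esym/(etrans (E nu)).
  have [_ _ ->//] : EQ (\1_`]x, +oo[).
  by move: x0; rewrite le_eqVlt => /predU1P[<-|]; [exact: EQ_itv0y|exact: EQ_itvoy].
- by move=> k; rewrite (le_lt_trans (probability_le1 _ _))// ltry.
Qed.

End uniqueness.

(** * Syntax-directed differentiation *)

Section derivation_rules.
Context {R : realType}.
Implicit Types (f g h : R -> R) (x df dg dh : R).

(** The head symbol on which the tactic [der] selects a rule from the shape of [f]. *)
Definition deriv_at f x df := is_derive x (1 : R) f df.

(** Leaves [df'] open for the rules to compute; what remains is an algebraic identity with the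
    expected value. *)
Lemma deriv_atE f x df df' : deriv_at f x df' -> df' = df -> is_derive x 1 f df.
Proof. by move=> h <-. Qed.

Lemma der_cst (c x : R) : deriv_at (fun=> c) x 0.
Proof. exact: is_derive_cst. Qed.

Lemma der_id x : deriv_at (fun y : R => y) x 1.
Proof. exact: is_derive_id. Qed.

Lemma der_add f g x df dg : deriv_at f x df -> deriv_at g x dg ->
  deriv_at (fun y => f y + g y) x (df + dg).
Proof. by move=> ? ?; exact: is_deriveD. Qed.

Lemma der_opp f x df : deriv_at f x df -> deriv_at (fun y => - f y) x (- df).
Proof. by move=> ?; exact: is_deriveN. Qed.

Lemma der_mul f g x df dg : deriv_at f x df -> deriv_at g x dg ->
  deriv_at (fun y => f y * g y) x (f x * dg + g x * df).
Proof. by move=> ? ?; exact: is_deriveM. Qed.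

Lemma der_sqr f x df : deriv_at f x df ->
  deriv_at (fun y => f y ^+ 2) x (f x * df + f x * df).
Proof. by move=> h; exact: (der_mul h h). Qed.

Lemma der_comp h f x dh df : deriv_at h (f x) dh ->
  deriv_at f x df -> deriv_at (fun y => h (f y)) x (dh * df).
Proof.
move=> ? ?; exact: is_derive1_comp.
Qed.

Lemma der_inv f x df : f x != 0 -> deriv_at f x df ->
  deriv_at (fun y => (f y)^-1) x (- df / f x ^+ 2).
Proof.
move=> f0 h; apply: deriv_atE (is_deriveV f0 (h : is_derive x 1 f df)) _.
by rewrite /GRing.scale/= mulNr mulNr mulrC.
Qed.

Lemma der_expR f x df : deriv_at f x df ->
  deriv_at (fun y => expR (f y)) x (expR (f x) * df).
Proof. by move=> ?; apply: der_comp => //; exact: is_derive_expR. Qed.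

Lemma der_ln f x df : 0 < f x -> deriv_at f x df ->
  deriv_at (fun y => ln (f y)) x ((f x)^-1 * df).
Proof. by move=> f0 ?; apply: der_comp => //; exact: is_derive1_ln. Qed.

Lemma der_cos f x df : deriv_at f x df ->
  deriv_at (fun y => cos (f y)) x (- sin (f x) * df).
Proof. by move=> ?; apply: der_comp => //; exact: is_derive_cos. Qed.

Lemma der_sin f x df : deriv_at f x df ->
  deriv_at (fun y => sin (f y)) x (cos (f x) * df).
Proof. by move=> ?; apply: der_comp => //; exact: is_derive_sin. Qed.

Lemma der_tan f x df : cos (f x) != 0 -> deriv_at f x df ->
  deriv_at (fun y => tan (f y)) x ((cos (f x)) ^- 2 * df).
Proof. by move=> ? ?; apply: der_comp => //; exact: is_derive_tan. Qed.

Lemma der_atan f x df : deriv_at f x df ->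
  deriv_at (fun y => atan (f y)) x ((1 + f x ^+ 2)^-1 * df).
Proof. by move=> ?; apply: der_comp => //; exact: is_derive1_atan. Qed.

End derivation_rules.

(** Side conditions such as positivity or nonvanishing are closed by a hypothesis of that very form,
    which is why proofs collect them right before calling the tactic. *)
Ltac by_hyp := cbv beta;
  first [match goal with H : ?A |- ?B => constr_eq A B; exact H end | assumption].
Ltac der1 :=
  lazymatch goal with
  | |- deriv_at (fun=> ?c) _ _ => apply: der_cst
  | |- deriv_at (fun y => y) _ _ => apply: der_id
  | |- deriv_at (fun y => @GRing.add _ (@?f y) (@?g y)) _ _ => apply: (@der_add _ f g)
  | |- deriv_at (fun y => @GRing.opp _ (@?f y)) _ _ => apply: (@der_opp _ f)
  | |- deriv_at (fun y => @GRing.mul _ (@?f y) (@?g y)) _ _ => apply: (@der_mul _ f g)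
  | |- deriv_at (fun y => @GRing.exp _ (@?f y) 2) _ _ => apply: (@der_sqr _ f)
  | |- deriv_at (fun y => @GRing.inv _ (@?f y)) _ _ => apply: (@der_inv _ f)
  | |- deriv_at (fun y => expR (@?f y)) _ _ => apply: (@der_expR _ f)
  | |- deriv_at (fun y => ln (@?f y)) _ _ => apply: (@der_ln _ f)
  | |- deriv_at (fun y => cos (@?f y)) _ _ => apply: (@der_cos _ f)
  | |- deriv_at (fun y => sin (@?f y)) _ _ => apply: (@der_sin _ f)
  | |- deriv_at (fun y => tan (@?f y)) _ _ => apply: (@der_tan _ f)
  | |- deriv_at (fun y => atan (@?f y)) _ _ => apply: (@der_atan _ f)
  | |- _ => by_hyp
  end.
Ltac der := apply: deriv_atE; [repeat der1 | ].

(** * Real and imaginary parts of log (1 + e^w) *)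

Section log1p.
Context {R : realType}.
Implicit Types (x p : R).

(* Real and imaginary parts of [log (1 + e^w)], [w = x + i p], [|p| < pi], and
   of its derivative [e^w / (1 + e^w)]. The expression of the argument comes from
   [1 + e^w = e^(ip/2) ((1 + e^x) cos (p/2) + i (e^x - 1) sin (p/2))]. *)
Definition sqn x p : R := 1 + 2 * (expR x * cos p) + expR x * expR x.
Definition logre x p : R := 2^-1 * ln (sqn x p).
Definition logim x p : R :=
  p / 2 + atan (tan (p / 2) * ((expR x - 1) / (expR x + 1))).
Definition dlogre x p : R := (expR x * cos p + expR x * expR x) / sqn x p.
Definition dlogim x p : R := expR x * sin p / sqn x p.

Lemma cos_half p : cos p = cos (p / 2) ^+ 2 - sin (p / 2) ^+ 2.
Proof. by rewrite {1}(splitr p) cosD -!expr2. Qed.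

Lemma sin_half p : sin p = 2 * (sin (p / 2) * cos (p / 2)).
Proof. by rewrite {1}(splitr p) sinD mulr2n mulrDl !mul1r [X in _ + X]mulrC. Qed.

Lemma half_gt0 p : `|p| < pi -> 0 < cos (p / 2).
Proof. by rewrite ltr_norml => /andP[? ?]; apply: cos_gt0_pihalf; apply/andP; lra. Qed.

Lemma sqn_half x p : sqn x p =
  ((1 + expR x) * cos (p / 2)) ^+ 2 + ((expR x - 1) * sin (p / 2)) ^+ 2.
Proof.
have h := cos2Dsin2 (p / 2).
rewrite /sqn (cos_half p).
transitivity ((cos (p / 2) ^+ 2 + sin (p / 2) ^+ 2) * (1 + expR x * expR x) +
  2 * (expR x * (cos (p / 2) ^+ 2 - sin (p / 2) ^+ 2))).
  by rewrite h; ring.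
by ring.
Qed.

(** Drops the sine part of [sqn_half]. The factor cos (p/2) vanishes at the singular angles pi and -
    pi, and it is the source of the constants in the later bounds. *)
Lemma sqn_ge x p : ((1 + expR x) * cos (p / 2)) ^+ 2 <= sqn x p.
Proof. by rewrite sqn_half lerDl sqr_ge0. Qed.

Lemma sqn_le x p : sqn x p <= (1 + expR x) ^+ 2.
Proof.
rewrite /sqn; have := cos_le1 p; have := expR_gt0 x.
by move: (expR x) (cos p) => E c; nra.
Qed.

Lemma sqn_ge_sub x p : (1 - expR x) ^+ 2 <= sqn x p.
Proof.
rewrite /sqn; have := cos_geN1 p; have := expR_gt0 x.
by move: (expR x) (cos p) => E c; nra.
Qed.

Lemma sqn_gt0 x p : `|p| < pi -> 0 < sqn x p.
Proof.
move=> /half_gt0 c0; apply: lt_le_trans (sqn_ge x p).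
by rewrite exprn_gt0// mulr_gt0// ltr_pwDl// expR_ge0.
Qed.

Lemma sqnN x p : sqn x (- p) = sqn x p.
Proof. by rewrite /sqn cosN. Qed.

Lemma logreN x p : logre x (- p) = logre x p.
Proof. by rewrite /logre sqnN. Qed.

Lemma logimN x p : logim x (- p) = - logim x p.
Proof. by rewrite /logim mulNr tanN mulNr atanN opprD. Qed.

(** From 1 + e^(-x + ip) = e^(-x + ip) (1 + e^(x - ip)); [logre_reflect] reads the moduli of the
    same identity. *)
Lemma logim_reflect x p : logim (- x) p = p - logim x p.
Proof.
rewrite /logim.
have -> : (expR (- x) - 1) / (expR (- x) + 1) = - ((expR x - 1) / (expR x + 1)).
  rewrite expRN; have := expR_gt0 x; move: (expR x) => E E0.
  by field; rewrite !gt_eqF// addr_gt0.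
by rewrite mulrN atanN; set a := atan _; lra.
Qed.

Lemma logre_reflect x p : `|p| < pi -> logre (- x) p = logre x p - x.
Proof.
move=> hp; have h1 := sqn_gt0 x hp.
have E0 := expR_gt0 x.
have -> : logre (- x) p = 2^-1 * ln (sqn x p / (expR x * expR x)).
  congr (_ * ln _); rewrite /sqn expRN; move: (expR x) E0 => E E0.
  by field; rewrite gt_eqF.
rewrite ln_div ?posrE ?mulr_gt0// lnM ?posrE// expRK /logre.
by move: (ln _) => a; lra.
Qed.

Lemma logim0 x : logim x 0 = 0.
Proof. by rewrite /logim mul0r tan0 mul0r atan0 addr0. Qed.

Lemma logre0 x : logre x 0 = ln (1 + expR x).
Proof.
rewrite /logre /sqn cos0 mulr1.
have -> : 1 + 2 * expR x + expR x * expR x = (1 + expR x) ^+ 2 by ring.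
by rewrite lnXn ?ltr_pwDl ?expR_ge0// -[X in _ * X]mulr_natl mulKf.
Qed.

Lemma der_logre x p : `|p| < pi -> is_derive x 1 (logre ^~ p) (dlogre x p).
Proof.
move=> hp; have h := sqn_gt0 x hp; rewrite /logre /sqn/=.
der.
rewrite /dlogre -/(sqn x p); have : sqn x p != 0 by rewrite gt_eqF.
by move: (sqn _ _) => N N0; field.
Qed.

(** Together with [der_logre], [der_logim] and [der_logim_arg], these are the Cauchy-Riemann
    equations for log (1 + e^w). *)
Lemma der_logre_arg x p : `|p| < pi -> is_derive p 1 (logre x) (- dlogim x p).
Proof.
move=> hp; have h := sqn_gt0 x hp; rewrite /logre /sqn/=.
der.
rewrite /dlogim -/(sqn x p); have : sqn x p != 0 by rewrite gt_eqF.
by move: (sqn _ _) => N N0; field.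
Qed.

(** 1 + tan^2 of the argument of e^(-ip/2) (1 + e^w), that is, its squared modulus over its squared
    real part. *)
Let logim_den x p : `|p| < pi ->
  1 + (tan (p / 2) * ((expR x - 1) / (expR x + 1))) ^+ 2 =
  sqn x p / ((1 + expR x) * cos (p / 2)) ^+ 2.
Proof.
move=> /half_gt0 c0; rewrite sqn_half /tan; have := expR_gt0 x.
move: c0; move: (expR x) (cos _) (sin _) => E c s c0 E0.
by field; rewrite !gt_eqF// addr_gt0.
Qed.

Lemma der_logim x p : `|p| < pi -> is_derive x 1 (logim ^~ p) (dlogim x p).
Proof.
move=> hp; have h := sqn_gt0 x hp; have c0 := half_gt0 hp.
have E0 := expR_gt0 x; have E1 : expR x + 1 != 0 by rewrite gt_eqF// addr_gt0.
rewrite /logim/=; der => //.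
rewrite logim_den// /dlogim (sin_half p) /tan.
have : sqn x p != 0 by rewrite gt_eqF.
move: c0 E1; move: (sqn _ _) (expR x) (cos _) (sin _) => N E c s c0 E1 N0.
by field; rewrite ?N0 ?(addrC 1) ?E1 ?gt_eqF.
Qed.

Lemma der_logim_arg x p : `|p| < pi -> is_derive p 1 (logim x) (dlogre x p).
Proof.
move=> hp; have h := sqn_gt0 x hp; have c0 := half_gt0 hp.
have E0 := expR_gt0 x; have E1 : expR x + 1 != 0 by rewrite gt_eqF// addr_gt0.
rewrite /logim/=; der => //; first by rewrite gt_eqF.
rewrite logim_den// /dlogre (cos_half p).
have : sqn x p != 0 by rewrite gt_eqF.
have := sqn_half x p; have := cos2Dsin2 (p / 2).
move: c0 E1; move: (sqn _ _) (expR x) (cos _) (sin _) => N E c s c0 E1 cs NE N0.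
have s2 : s ^+ 2 = 1 - c ^+ 2 by rewrite -cs addrAC subrr add0r.
have NE' : N = (1 + E) ^+ 2 * c ^+ 2 + (E - 1) ^+ 2 * (1 - c ^+ 2).
  by rewrite NE !exprMn s2.
(* The term 1/2 is the derivative of p/2, the other one that of the arctangent. *)
rewrite s2; transitivity (2^-1 + 2^-1 * (E ^+ 2 - 1) / N).
  by field; rewrite ?N0 ?(addrC 1) ?E1 ?gt_eqF.
by rewrite -[X in X + _]mulr1 -[X in _ * X](divff N0) {1}NE'; field.
Qed.

(** Both numerators are at most (1 + e^x)^2, so [sqn_ge] applies. The bound does not depend on x and
    thus dominates derivatives under the integral over H. *)
Lemma dlog_bound x p : `|p| < pi ->
  `|dlogre x p| <= (cos (p / 2))^-2 /\ `|dlogim x p| <= (cos (p / 2))^-2.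
Proof.
move=> hp; have c0 := half_gt0 hp; have N0 := sqn_gt0 x hp.
have := sqn_ge x p; rewrite /dlogre /dlogim.
have := sin_le1 p; have := sin_geN1 p; have := cos_le1 p; have := cos_geN1 p.
have := expR_gt0 x; rewrite !normrM !(@gtr0_norm _ (_^-1)) ?invr_gt0//.
move: c0 N0; move: (sqn x p) (expR x) (cos (p / 2)) (sin p) (cos p).
move=> N E c s k c0 N0 E0 k1 k2 s1 s2 NE.
have key (u : R) : `|u| <= (1 + E) ^+ 2 -> `|u| / N <= c ^- 2.
  move=> hu; rewrite ler_pdivrMr// -[leLHS]mul1r mulrC ler_pdivlMl ?exprn_gt0//.
  rewrite mulr1 (le_trans _ NE)// exprMn mulrC ler_wpM2r// exprn_ge0// ltW//.
by split; rewrite -?normrM; apply: key; rewrite ler_norml; apply/andP; split; nra.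
Qed.

Lemma logre_le x p : `|p| < pi -> logre x p <= ln (1 + expR x).
Proof.
move=> hp; have E1 : 0 < 1 + expR x by rewrite ltr_pwDl// expR_ge0.
rewrite /logre ler_pdivrMl// mulr_natl -lnXn// ler_ln ?posrE ?sqn_gt0 ?exprn_gt0//.
exact: sqn_le.
Qed.

Lemma logre_ge x p : `|p| < pi -> ln (cos (p / 2)) + ln (1 + expR x) <= logre x p.
Proof.
move=> hp; have E1 : 0 < 1 + expR x by rewrite ltr_pwDl// expR_ge0.
have c0 := half_gt0 hp; rewrite -lnM// mulrC.
rewrite /logre ler_pdivlMl// mulr_natl -lnXn ?mulr_gt0//.
rewrite ler_ln ?posrE ?sqn_gt0 ?exprn_gt0 ?mulr_gt0//.
exact: sqn_ge.
Qed.

Lemma expR_logre x p : `|p| < pi -> expR (logre x p) = Num.sqrt (sqn x p).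
Proof.
move=> hp; have N0 := sqn_gt0 x hp.
by rewrite /logre mulrC expRM lnK ?posrE// powR12_sqrt// ltW.
Qed.

(** With y the argument of the arctangent, sqrt ([sqn x p]) e^(i atan y) = e^(-ip/2) (1 + e^w),
    whose real part is positive. *)
Let polar x p : `|p| < pi ->
  Num.sqrt (sqn x p) * cos (atan (tan (p / 2) * ((expR x - 1) / (expR x + 1)))) =
    (1 + expR x) * cos (p / 2) /\
  Num.sqrt (sqn x p) * sin (atan (tan (p / 2) * ((expR x - 1) / (expR x + 1)))) =
    (expR x - 1) * sin (p / 2).
Proof.
move=> hp; have c0 := half_gt0 hp; have N0 := sqn_gt0 x hp.
have E0 := expR_gt0 x; have E1 : 0 < 1 + expR x by rewrite addr_gt0.
set y := tan (p / 2) * _.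
have C : Num.sqrt (sqn x p) * cos (atan y) = (1 + expR x) * cos (p / 2).
  have m0 : 0 < (1 + expR x) * cos (p / 2) by rewrite mulr_gt0.
  rewrite cos_atan /y logim_den// sqrtrM ?(ltW N0)// sqrtrV ?exprn_ge0 ?(ltW m0)//.
  rewrite sqrtr_sqr gtr0_norm// invfM invrK mulrA divff ?mul1r//.
  by rewrite gt_eqF// sqrtr_gt0.
split=> //.
have -> : sin (atan y) = y * cos (atan y).
  by rewrite -{2}(atanK y) /tan divfK// cos_atan invr_neq0// gt_eqF// sqrtr_gt0
    ltr_pwDl// sqr_ge0.
rewrite mulrCA C /y /tan; move: (expR x) (cos (p / 2)) (sin (p / 2)) c0 E0 => E c s c0 E0.
by field; rewrite !gt_eqF// addr_gt0.
Qed.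

(** With [expR_logre_sin] this says exp([logre] + i [logim]) = 1 + e^w: the formula for [logim] does
    give an argument of 1 + e^w. *)
Lemma expR_logre_cos x p : `|p| < pi ->
  expR (logre x p) * cos (logim x p) = 1 + expR x * cos p.
Proof.
move=> hp; have [hc hs] := polar x hp.
rewrite expR_logre// /logim cosD mulrBr !(mulrCA (Num.sqrt _)) hc hs (cos_half p).
have := cos2Dsin2 (p / 2); move: (cos _) (sin _) (expR x) => c s E cs.
have -> : 1 + E * (c ^+ 2 - s ^+ 2) = c ^+ 2 + s ^+ 2 + E * (c ^+ 2 - s ^+ 2) by rewrite cs.
by ring.
Qed.

Lemma expR_logre_sin x p : `|p| < pi ->
  expR (logre x p) * sin (logim x p) = expR x * sin p.
Proof.
move=> hp; have [hc hs] := polar x hp.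
rewrite expR_logre// /logim sinD mulrDr !(mulrCA (Num.sqrt _)) hc hs (sin_half p).
by ring.
Qed.

Lemma atan_norm_le (y : R) : `|atan y| <= `|y|.
Proof.
wlog y0 : y / 0 <= y => [h|].
  have [/h//|/ltW y0] := leP 0 y.
  by rewrite -normrN -atanN -(normrN y) h// oppr_ge0.
have ca : {within `[0, y], continuous (@atan R)}.
  by apply: continuous_in_subspaceT => x _; exact: continuous_atan.
have [c _] := @MVT_segment R _ _ 0 y y0 (fun x _ => is_derive1_atan x) ca.
rewrite atan0 !subr0 => ->; rewrite normrM ler_piMl//.
rewrite ger0_norm ?invr_ge0 ?addr_ge0 ?sqr_ge0// invf_le1 ?lerDl ?sqr_ge0//.
by rewrite ltr_pwDl// sqr_ge0.
Qed.

Lemma logim_bounds x p : 0 <= p < pi -> 0 <= logim x p <= p.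
Proof.
move=> /andP[p0 ppi]; rewrite /logim.
set y := _ / (expR x + 1); have t0 : 0 <= tan (p / 2).
  rewrite /tan divr_ge0//; first by apply: sin_ge0_pi; apply/andP; lra.
  by rewrite ltW// half_gt0// ger0_norm.
have E0 := expR_gt0 x; have E1 : 0 < expR x + 1 by rewrite addr_gt0.
(* y is tanh (x/2), so the arctangent stays between - p/2 and p/2. *)
have y1 : -1 <= y <= 1.
  by rewrite /y ler_pdivlMr// ler_pdivrMr//; apply/andP; lra.
have tK : atan (tan (p / 2)) = p / 2 by rewrite tanK// in_itv/=; apply/andP; lra.
case/andP: y1 => y1 y2.
have h1 : atan (tan (p / 2) * y) <= p / 2.
  by rewrite -[leRHS]tK le_atan//; nra.
have h2 : - (p / 2) <= atan (tan (p / 2) * y).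
  have h : 0 <= tan (p / 2) * (1 + y) by apply: mulr_ge0 => //; lra.
  have -> : - (p / 2) = atan (- tan (p / 2)) by rewrite atanN tK.
  by rewrite le_atan// -subr_ge0 opprK -[X in _ + X]mulr1 -mulrDr addrC.
by apply/andP; lra.
Qed.

Lemma logim_norm_le x p : `|p| < pi -> `|logim x p| <= `|p|.
Proof.
move=> hp; wlog p0 : p hp / 0 <= p => [h|].
  have [/h->//|/ltW p0] := leP 0 p.
  by rewrite -normrN -logimN -(normrN p) h ?normrN// oppr_ge0.
have /andP[h1 h2] : 0 <= logim x p <= p.
  by apply: logim_bounds; rewrite p0; move: hp; rewrite ger0_norm.
by rewrite !ger0_norm.
Qed.

(** For x < 0 the number 1 + e^w has positive real part and its argument is a plain arctangent. The
    factor |sin p| makes the bound vanish when p tends to pi or - pi, where the tangent inside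
    [logim] blows up. *)
Lemma logim_neg_le x p : x < 0 -> `|p| < pi ->
  `|logim x p| <= expR x * `|sin p| / (1 - expR x).
Proof.
move=> x0 hp; have E1 : expR x < 1 by rewrite -expR0 ltr_expR.
have E0 := expR_gt0 x.
have d0 : 0 < 1 + expR x * cos p.
  by have := cos_geN1 p; nra.
have hc := expR_logre_cos x hp; have hs := expR_logre_sin x hp.
have cw : 0 < cos (logim x p).
  by move: d0; rewrite -hc pmulr_rgt0// expR_gt0.
have wpi : `|logim x p| < pi / 2.
  rewrite ltNge; apply/negP => h; move: cw; rewrite ltNge => /negP; apply.
  have -> : cos (logim x p) = cos (`|logim x p|).
    by case: ger0P => // _; rewrite cosN.
  have wle := le_lt_trans (logim_norm_le x hp) hp.
  have -> : `|logim x p| = (`|logim x p| - pi / 2) + pi / 2 by rewrite subrK.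
  rewrite cosDpihalf oppr_le0; apply: sin_ge0_pi.
  by have hpi := pi_gt0 R; apply/andP; split; lra.
have tw : tan (logim x p) = expR x * sin p / (1 + expR x * cos p).
  rewrite -hc -hs /tan; have := expR_gt0 (logre x p).
  move: (expR (logre x p)) => e e0; field.
  by rewrite !gt_eqF.
have -> : logim x p = atan (expR x * sin p / (1 + expR x * cos p)).
  by rewrite -tw tanK// in_itv/= -ltr_norml.
rewrite (le_trans (atan_norm_le _))// !normrM (gtr0_norm E0).
rewrite ler_wpM2l ?mulr_ge0 ?(ltW E0)// gtr0_norm ?invr_gt0// lef_pV2 ?posrE ?subr_gt0//.
by have := cos_geN1 p; nra.
Qed.

End log1p.

(** * Limits of integrals over exhausting segments *)

Section exhaustion.
Context {R : realType}.
Local Notation leb := (@lebesgue_measure R).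

(** Integrand and segment vary together with n. The exceptional point [N] is meant for the
    singularity of ln |1 - t| at t = 1. *)
Lemma dominated_exhaust (f_ : nat -> R -> R) (f g : R -> R) (u w : nat -> R)
    (D : set R) (N : R) :
  {homo u : m n / (m <= n)%N >-> n <= m} ->
  {homo w : m n / (m <= n)%N >-> m <= n} ->
  D = \bigcup_n `[u n, w n]%classic ->
  (forall n, measurable_fun D (f_ n)) -> measurable_fun D f ->
  leb.-integrable D (EFin \o g) ->
  (forall x, D x -> x != N -> f_ n x @[n --> \oo] --> f x) ->
  (forall n x, D x -> x != N -> `|f_ n x| <= g x) ->
  leb.-integrable D (EFin \o f) /\
  (\int[leb]_(x in `[u n, w n]) (f_ n x)%:E @[n --> \oo] -->
   \int[leb]_(x in D) (f x)%:E)%E.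
Proof.
move=> hu hw DE mf_ mf ig ff fg.
have mD : measurable (D : set (measurableTypeR R)).
  by rewrite DE; apply: bigcup_measurable.
have sub n : `[u n, w n] `<=` D by move=> x; rewrite DE; exists n.
have aeN (P : R -> Prop) : (forall x, x != N -> P x) -> {ae leb, forall x, P x}.
  move=> hP; exists [set N]; split; first exact: measurable_set1.
    exact: lebesgue_measure_set1.
  move=> x /= nP; apply: contrapT => xN; apply: nP; apply: hP.
  exact/eqP.
have [|||||h1 _ h2] := @dominated_convergence _ (measurableTypeR R) R leb D mD
  (fun n => (EFin \o f_ n) \_ `[u n, w n]) (EFin \o f) (EFin \o g).
- move=> n; apply/measurable_restrict => //.
  by apply: (@measurable_funS _ _ _ _ D) => //; apply/measurable_EFinP; exact: mf_.
- exact/measurable_EFinP.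
- apply: aeN => x xN Dx; have := Dx; rewrite DE => -[m _ /= xm].
  have H : \forall n \near \oo, (f_ n x)%:E = ((EFin \o f_ n) \_ `[u n, w n]) x.
    exists m => // n /= mn; rewrite patchE mem_set//=.
    move: xm; rewrite !in_itv/= => /andP[h1 h2].
    by rewrite (le_trans (hu _ _ mn))//= (le_trans h2)// hw.
  apply: (cvg_trans (near_eq_cvg H)).
  by apply/fine_cvgP; split; [exact: nearW|exact: ff].
- exact: ig.
- apply: aeN => x xN n Dx; rewrite patchE; case: ifPn => _ /=.
    by rewrite lee_fin fg.
  by rewrite normr0 lee_fin (le_trans _ (fg 0%N x Dx xN)).
split=> //.
suff -> : (fun n => \int[leb]_(x in `[u n, w n]) (f_ n x)%:E)%E =
  (fun n => \int[leb]_(x in D) ((EFin \o f_ n) \_ `[u n, w n]) x)%E by [].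
apply/funext => n; rewrite [RHS]integral_mkcond [LHS]integral_mkcond.
apply: eq_integral => x _; rewrite !patchE.
case: ifPn => [xi|//]; last by case: ifP.
by rewrite mem_set//; move: xi; rewrite inE; exact: sub.
Qed.

Lemma FTC_exhaust (f F : R -> R) (u w : nat -> R) (D : set R) (l l' : R) :
  {homo u : m n / (m <= n)%N >-> n <= m} ->
  {homo w : m n / (m <= n)%N >-> m <= n} ->
  (forall n, u n <= w n) ->
  D = \bigcup_n `[u n, w n]%classic ->
  leb.-integrable D (EFin \o f) ->
  (forall x, D x -> {for x, continuous f}) ->
  (forall x, D x -> is_derive x 1 F (f x)) ->
  F (u n) @[n --> \oo] --> l -> F (w n) @[n --> \oo] --> l' ->
  (\int[leb]_(x in D) (f x)%:E = (l' - l)%:E)%E.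
Proof.
move=> hu hw uw DE if_ cf dF Fl Fl'.
have mf : measurable_fun D f by apply/measurable_EFinP; case/integrableP: if_.
have mD : measurable (D : set (measurableTypeR R)).
  by rewrite DE; apply: bigcup_measurable.
have [|||_ h] := @dominated_exhaust (fun=> f) f (fun x => `|f x|) u w D 0
  hu hw DE (fun=> mf) mf.
- exact: integrable_norm.
- by move=> x _ _; exact: cvg_cst.
- by [].
have sub n : `[u n, w n] `<=` D by move=> x; rewrite DE; exists n.
have E n : (\int[leb]_(x in `[u n, w n]) (f x)%:E = (F (w n) - F (u n))%:E)%E.
  by apply: FTC_segment => // x xn; [apply: cf|apply: dF];
    apply: (sub n); rewrite /= in_itv.
have h' : ((F (w n) - F (u n))%:E @[n --> \oo] --> (l' - l)%:E)%E.
  by apply/fine_cvgP; split; [exact: nearW|exact: cvgB].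
move: h; under eq_fun do rewrite E; move=> /cvg_lim <- //.
exact: cvg_lim.
Qed.

Lemma harmonic_powR_cvg0 (a : R) : 0 < a -> (@harmonic R n) `^ a @[n --> \oo] --> 0.
Proof.
move=> a0; apply/cvgrPdist_lt => e e0.
have h : \forall n \near \oo, @harmonic R n < e `^ a^-1.
  by apply: (@cvgr_lt _ _ _ _ _ _ (@cvg_harmonic R)); rewrite powR_gt0.
apply: filterS h => n h; rewrite sub0r normrN ger0_norm ?powR_ge0//.
have -> : e = (e `^ a^-1) `^ a by rewrite -powRrM mulVf ?gt_eqF// powRr1// ltW.
by apply: gt0_ltr_powR => //; rewrite nnegrE ?powR_ge0 ?harmonic_ge0.
Qed.

Lemma harmonic_homo : {homo (@harmonic R) : m n / (m <= n)%N >-> n <= m}.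
Proof. by move=> m n mn; rewrite lef_pV2 ?posrE ?ltr0n// ler_nat ltnS. Qed.

Lemma succ_homo : {homo (fun n => n.+1%:R : R) : m n / (m <= n)%N >-> m <= n}.
Proof. by move=> m n mn; rewrite ler_nat ltnS. Qed.

Lemma harmonic_le1 n : @harmonic R n <= 1.
Proof. by rewrite invf_le1 ?ltr0n// ler1n. Qed.

(** The factor 1/2 keeps the segment nonempty at n = 0, where [harmonic] is 1. *)
Lemma itv01E :
  `]0, 1[%classic = \bigcup_n `[harmonic n / 2, 1 - harmonic n / 2]%classic :> set R.
Proof.
apply/seteqP; split => x/=; last first.
  move=> [n _ /=]; rewrite !in_itv/= => /andP[].
  have : 0 < (n.+1%:R^-1 : R) by rewrite invr_gt0.
  by move: (n.+1%:R^-1) => y y0 h1 h2; apply/andP; lra.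
rewrite in_itv/= => /andP[x0 x1].
have : \forall n \near \oo, @harmonic R n < Num.min x (1 - x).
  apply: (@cvgr_lt _ _ _ _ _ _ (@cvg_harmonic R)).
  by rewrite lt_min x0 subr_gt0.
move=> [n _ /(_ n (leqnn n))]/=; rewrite lt_min => /andP[h1 h2].
exists n => //=; rewrite in_itv/=; have := @harmonic_gt0 R n.
by move: h1 h2; rewrite /harmonic/=; move: (n.+1%:R^-1) => y h1 h2 y0; apply/andP; lra.
Qed.

Lemma itv1yE :
  `]1, +oo[%classic = \bigcup_n `[1 + harmonic n, n.+2%:R]%classic :> set R.
Proof.
apply/seteqP; split => x/=; last first.
  move=> [n _ /=]; rewrite !in_itv/= andbT => /andP[h1 _].
  by rewrite (lt_le_trans _ h1)// ltrDl harmonic_gt0.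
rewrite in_itv/= andbT => x1.
have : 0 < x - 1 by rewrite subr_gt0.
move=> x0.
have : `]0, +oo[%classic (x - 1) by rewrite /= in_itv/= x0.
rewrite itv0yE => -[n _ /=]; rewrite in_itv/= => /andP[h1 h2].
exists n => //=; rewrite in_itv/=; move: h1 h2.
by rewrite -[n.+2%:R]natr1; move: (n.+1%:R : R) => y h1 h2; apply/andP; lra.
Qed.

Lemma itv0xE (x : R) : 0 < x ->
  `]0, x]%classic = \bigcup_n `[x * harmonic n, x]%classic :> set R.
Proof.
move=> x0; apply/seteqP; split => y/=; last first.
  move=> [n _ /=]; rewrite !in_itv/= => /andP[h1 ->]; rewrite andbT.
  by rewrite (lt_le_trans _ h1)// mulr_gt0// harmonic_gt0.
rewrite in_itv/= => /andP[y0 yx].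
have : \forall n \near \oo, @harmonic R n < y / x.
  by apply: (@cvgr_lt _ _ _ _ _ _ (@cvg_harmonic R)); rewrite divr_gt0.
move=> [n _ /(_ n (leqnn n))]/= h; exists n => //=.
by rewrite in_itv/= yx andbT mulrC -ler_pdivlMr// ltW.
Qed.

Lemma integrable_of_finite (D : set (measurableTypeR R)) (f : R -> R) (l : R) :
  measurable_fun D f -> (forall x, D x -> 0 <= f x) ->
  (\int[leb]_(x in D) (f x)%:E = l%:E)%E -> leb.-integrable D (EFin \o f).
Proof.
move=> mf f0 fl; apply/integrableP; split; first exact/measurable_EFinP.
rewrite (_ : (\int[leb]_(x in D) _)%E = l%:E) ?ltry// -fl.
apply: eq_integral => x /[!inE] Dx; by rewrite /= ger0_norm// f0.
Qed.

Lemma abse_integral_itv_le (f : R -> R) (C a b : R) : a <= b ->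
  measurable_fun setT (f : measurableTypeR R -> R) ->
  (forall x, a <= x <= b -> `|f x| <= C) ->
  (`|\int[leb]_(x in `[a, b]) (f x)%:E| <= (C * (b - a))%:E)%E.
Proof.
move=> ab mf fC; have mab : measurable (`[a, b]%classic : set (measurableTypeR R)).
  exact: measurable_itv.
apply: (le_trans (le_abse_integral _ mab _)).
  by apply/measurable_EFinP; exact: measurable_funTS.
apply: (@le_trans _ _ (\int[leb]_(x in `[a, b]) cst C%:E x)%E).
  apply: ge0_le_integral => //.
  by apply: measurableT_comp => //; apply/measurable_EFinP; exact: measurable_funTS.
rewrite integral_cst// EFinM lee_wpmul2l//.
  by rewrite lee_fin (le_trans (normr_ge0 (f a)))// fC// lexx.
change (leb `[a, b] <= (b - a)%:E)%E.
rewrite lebesgue_measure_itv/= lte_fin; case: ltP => [_|ba]; first by rewrite EFinB.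
by rewrite lee_fin subr_ge0.
Qed.


(** On each segment the integral is a difference of two values of [F], hence at most 2 M. The limits
    of [F] at the ends of [D] need not be found, which is convenient for majorants. *)
Lemma integrable_of_bounded_primitive (f F : R -> R) (u w : nat -> R)
    (D : set R) (M : R) :
  {homo u : m n / (m <= n)%N >-> n <= m} ->
  {homo w : m n / (m <= n)%N >-> m <= n} ->
  (forall n, u n <= w n) ->
  D = \bigcup_n `[u n, w n]%classic ->
  (forall x, D x -> 0 <= f x) -> measurable_fun D f ->
  (forall x, D x -> {for x, continuous f}) ->
  (forall x, D x -> is_derive x 1 F (f x)) ->
  (forall x, D x -> `|F x| <= M) ->
  leb.-integrable D (EFin \o f).
Proof.
move=> hu hw uw DE f0 mf cf dF FM; apply/integrableP; split; first exact/measurable_EFinP.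
have -> : (\int[leb]_(x in D) `|(EFin \o f) x| = \int[leb]_(x in D) (f x)%:E)%E.
  by apply: eq_integral => x /[!inE] Dx; rewrite /= ger0_norm// f0.
have sub n : `[u n, w n] `<=` D by move=> x; rewrite DE; exists n.
have Du n : D (u n) by apply: (sub n); rewrite /= in_itv/= lexx uw.
have Dw n : D (w n) by apply: (sub n); rewrite /= in_itv/= lexx uw.
have E n : (\int[leb]_(x in `[u n, w n]) (f x)%:E = (F (w n) - F (u n))%:E)%E.
  by apply: FTC_segment => // x xn; [apply: cf|apply: dF];
    apply: (sub n); rewrite /= in_itv.
have := @ge0_nondecreasing_set_cvg_integral _ (measurableTypeR R) R
  (fun n => `[u n, w n]%classic) (EFin \o f) leb.
rewrite -DE => /(_ _ _ _ _) h; apply: (@le_lt_trans _ _ (M + M)%:E); last exact: ltry.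
have {}h : (\int[leb]_(x in `[u n, w n]) (f x)%:E @[n --> \oo] -->
    \int[leb]_(x in D) (f x)%:E)%E.
  apply: h.
  - move=> m n mn; apply/subsetPset => x/=; rewrite !in_itv/= => /andP[h1 h2].
    by rewrite (le_trans (hu _ _ mn))//= (le_trans h2)// hw.
  - by [].
  - by move=> n; apply/measurable_EFinP; apply: measurable_funS mf => //;
      rewrite DE; apply: bigcup_measurable.
  - by move=> n x /= xn; rewrite lee_fin f0//; exact: (sub n).
rewrite -(cvg_lim _ h)//; apply: lime_le; first by apply/cvg_ex; eexists; exact: h.
apply: nearW => n; rewrite E lee_fin (le_trans (ler_norm _))//.
by rewrite (le_trans (ler_normB _ _))// lerD// FM.
Qed.

Lemma continuous_seq (h : R -> R) (u : nat -> R) (a : R) :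
  {for a, continuous h} -> u n @[n --> \oo] --> a -> h (u n) @[n --> \oo] --> h a.
Proof. by move=> ch cu; exact: (cvg_comp _ _ cu ch). Qed.

End exhaustion.

(** * Syntax-directed measurability *)

Section measurability.
Context d (T : measurableType d) {R : realType}.
Implicit Types (D : set T) (f g : T -> R).

Lemma measurable_fun_cos D f : measurable_fun D f -> measurable_fun D (fun x => cos (f x)).
Proof.
move=> mf; apply: (measurableT_comp _ mf).
by apply: continuous_measurable_fun; exact: continuous_cos.
Qed.

Lemma measurable_fun_sin D f : measurable_fun D f -> measurable_fun D (fun x => sin (f x)).
Proof.
move=> mf; apply: (measurableT_comp _ mf).
by apply: continuous_measurable_fun; exact: continuous_sin.
Qed.

Lemma measurable_fun_atan D f : measurable_fun D f -> measurable_fun D (fun x => atan (f x)).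
Proof.
move=> mf; apply: (measurableT_comp _ mf).
by apply: continuous_measurable_fun; exact: continuous_atan.
Qed.

Lemma measurable_fun_expR D f : measurable_fun D f -> measurable_fun D (fun x => expR (f x)).
Proof. by move=> mf; exact: (measurableT_comp (@measurable_expR R) mf). Qed.

Lemma measurable_fun_ln D f : measurable_fun D f -> measurable_fun D (fun x => ln (f x)).
Proof. by move=> mf; exact: (measurableT_comp (@measurable_ln R) mf). Qed.

Lemma measurable_fun_powR D f (a : R) :
  measurable_fun D f -> measurable_fun D (fun x => f x `^ a).
Proof. by move=> mf; exact: (measurableT_comp (@measurable_powR R a) mf). Qed.

Lemma measurable_fun_add D f g : measurable_fun D f -> measurable_fun D g ->
  measurable_fun D (fun x => f x + g x).
Proof. exact: measurable_funD. Qed.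

Lemma measurable_fun_mul D f g : measurable_fun D f -> measurable_fun D g ->
  measurable_fun D (fun x => f x * g x).
Proof. exact: measurable_funM. Qed.

Lemma measurable_fun_opp D f : measurable_fun D f -> measurable_fun D (fun x => - f x).
Proof. exact: measurable_funN. Qed.

Lemma measurable_fun_exprn D f n : measurable_fun D f -> measurable_fun D (fun x => f x ^+ n).
Proof. exact: measurable_funX. Qed.

Lemma measurable_fun_norm D f : measurable_fun D f -> measurable_fun D (fun x => `|f x|).
Proof. by move=> mf; apply: (measurableT_comp _ mf); exact: normr_measurable. Qed.

Lemma measurable_fun_sqn D f g : measurable_fun D f -> measurable_fun D g ->
  measurable_fun D (fun x => sqn (f x) (g x)).
Proof.
move=> mf mg; have mE := measurable_fun_expR mf.
apply: measurable_fun_add; last exact: measurable_fun_mul.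
apply: measurable_fun_add => //; apply: measurable_fun_mul => //.
by apply: measurable_fun_mul => //; exact: measurable_fun_cos.
Qed.

Lemma measurable_fun_logre D f g : measurable_fun D f -> measurable_fun D g ->
  measurable_fun D (fun x => logre (f x) (g x)).
Proof.
move=> mf mg; apply: measurable_fun_mul => //.
by apply: measurable_fun_ln; exact: measurable_fun_sqn.
Qed.

Lemma measurable_fun_logim D f g : measurable_fun D f -> measurable_fun D g ->
  measurable_fun D (fun x => logim (f x) (g x)).
Proof.
move=> mf mg; have mE := measurable_fun_expR mf.
have mg2 : measurable_fun D (fun x => g x / 2) by exact: measurable_fun_mul.
apply: measurable_fun_add => //; apply: measurable_fun_atan.
apply: measurable_fun_mul.
  apply: measurable_fun_mul; first exact: measurable_fun_sin.
  by apply: measurable_funV; exact: measurable_fun_cos.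
apply: measurable_fun_mul; first exact: measurable_fun_add.
by apply: measurable_funV; exact: measurable_fun_add.
Qed.

Lemma measurable_fun_dlogre D f g : measurable_fun D f -> measurable_fun D g ->
  measurable_fun D (fun x => dlogre (f x) (g x)).
Proof.
move=> mf mg; have mE := measurable_fun_expR mf.
apply: measurable_fun_mul; last first.
  by apply: measurable_funV; exact: measurable_fun_sqn.
apply: measurable_fun_add; last exact: measurable_fun_mul.
by apply: measurable_fun_mul => //; exact: measurable_fun_cos.
Qed.

Lemma measurable_fun_dlogim D f g : measurable_fun D f -> measurable_fun D g ->
  measurable_fun D (fun x => dlogim (f x) (g x)).
Proof.
move=> mf mg; have mE := measurable_fun_expR mf.
apply: measurable_fun_mul; last first.
  by apply: measurable_funV; exact: measurable_fun_sqn.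
by apply: measurable_fun_mul => //; exact: measurable_fun_sin.
Qed.

End measurability.

Ltac meas1 :=
  lazymatch goal with
  | |- measurable_fun _ (fun=> ?c) => apply: measurable_cst
  | |- measurable_fun _ (fun x => x) => apply: measurable_id
  | |- measurable_fun _ (fun x => @fst _ _ x) => apply: measurable_fst
  | |- measurable_fun _ (fun x => @snd _ _ x) => apply: measurable_snd
  | |- measurable_fun _ (fun x => @GRing.add _ (@?f x) (@?g x)) =>
      apply: (@measurable_fun_add _ _ _ _ f g)
  | |- measurable_fun _ (fun x => @GRing.opp _ (@?f x)) =>
      apply: (@measurable_fun_opp _ _ _ _ f)
  | |- measurable_fun _ (fun x => @GRing.mul _ (@?f x) (@?g x)) =>
      apply: (@measurable_fun_mul _ _ _ _ f g)
  | |- measurable_fun _ (fun x => @GRing.inv _ (@?f x)) =>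
      apply: (@measurable_funV _ _ _ _ f)
  | |- measurable_fun _ (fun x => @GRing.exp _ (@?f x) _) =>
      apply: (@measurable_fun_exprn _ _ _ _ f)
  | |- measurable_fun _ (fun x => @Num.norm _ _ (@?f x)) =>
      apply: (@measurable_fun_norm _ _ _ _ f)
  | |- measurable_fun _ (fun x => expR (@?f x)) =>
      apply: (@measurable_fun_expR _ _ _ _ f)
  | |- measurable_fun _ (fun x => ln (@?f x)) =>
      apply: (@measurable_fun_ln _ _ _ _ f)
  | |- measurable_fun _ (fun x => cos (@?f x)) =>
      apply: (@measurable_fun_cos _ _ _ _ f)
  | |- measurable_fun _ (fun x => sin (@?f x)) =>
      apply: (@measurable_fun_sin _ _ _ _ f)
  | |- measurable_fun _ (fun x => powR (@?f x) _) =>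
      apply: (@measurable_fun_powR _ _ _ _ f)
  | |- measurable_fun _ (fun x => logre (@?f x) (@?g x)) =>
      apply: (@measurable_fun_logre _ _ _ _ f g)
  | |- measurable_fun _ (fun x => logim (@?f x) (@?g x)) =>
      apply: (@measurable_fun_logim _ _ _ _ f g)
  | |- measurable_fun _ (fun x => dlogre (@?f x) (@?g x)) =>
      apply: (@measurable_fun_dlogre _ _ _ _ f g)
  | |- measurable_fun _ (fun x => dlogim (@?f x) (@?g x)) =>
      apply: (@measurable_fun_dlogim _ _ _ _ f g)
  | |- _ => by_hyp
  end.
Ltac meas := repeat meas1.

(** * Second derivatives, decay and growth of the logarithm *)

Section log1p_second.
Context {R : realType}.
Implicit Types (x p q t : R).

(** With G = e^w / (1 + e^w), [d2logre] and [d2logim] are the two parts of G' = G (1 - G). *)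
Definition d2logre x p : R := dlogre x p * (1 - dlogre x p) + dlogim x p ^+ 2.
Definition d2logim x p : R := dlogim x p * (1 - 2 * dlogre x p).

Let s2E p : sin p ^+ 2 = 1 - cos p ^+ 2. Proof. exact: sin2cos2. Qed.

Lemma der_dlogre x p : `|p| < pi -> is_derive x 1 (dlogre ^~ p) (d2logre x p).
Proof.
move=> hp; have N0 : sqn x p != 0 by rewrite gt_eqF// sqn_gt0.
rewrite /dlogre /sqn/=; der => //.
rewrite /d2logre /dlogre /dlogim expr_div_n exprMn s2E.
move: N0; rewrite /sqn; move: (expR x) (cos p) => E c N0.
by field.
Qed.

Lemma der_dlogre_arg x p : `|p| < pi -> is_derive p 1 (dlogre x) (- d2logim x p).
Proof.
move=> hp; have N0 : sqn x p != 0 by rewrite gt_eqF// sqn_gt0.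
rewrite /dlogre /sqn/=; der => //.
rewrite /d2logim /dlogre /dlogim.
move: N0; rewrite /sqn; move: (expR x) (cos p) (sin p) => E c s N0.
by field.
Qed.

Lemma der_dlogim x p : `|p| < pi -> is_derive x 1 (dlogim ^~ p) (d2logim x p).
Proof.
move=> hp; have N0 : sqn x p != 0 by rewrite gt_eqF// sqn_gt0.
rewrite /dlogim /sqn/=; der => //.
rewrite /d2logim /dlogre /dlogim.
move: N0; rewrite /sqn; move: (expR x) (cos p) (sin p) => E c s N0.
by field.
Qed.

Lemma der_dlogim_arg x p : `|p| < pi -> is_derive p 1 (dlogim x) (d2logre x p).
Proof.
move=> hp; have N0 : sqn x p != 0 by rewrite gt_eqF// sqn_gt0.
rewrite /dlogim /sqn/=; der => //.
rewrite /d2logre /dlogre /dlogim expr_div_n exprMn s2E.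
transitivity ((expR x * cos p * sqn x p + 2 * expR x ^+ 2 * sin p ^+ 2) / sqn x p ^+ 2).
  by move: N0; rewrite /sqn; move: (expR x) (cos p) (sin p) => E c s N0; field.
rewrite s2E; move: N0; rewrite /sqn; move: (expR x) (cos p) => E c N0.
by field.
Qed.

Lemma recip_modulus x p : `|p| < pi ->
  (1 - dlogre x p) ^+ 2 + dlogim x p ^+ 2 = (sqn x p)^-1.
Proof.
move=> hp; have N0 : sqn x p != 0 by rewrite gt_eqF// sqn_gt0.
rewrite /dlogre /dlogim expr_div_n exprMn s2E.
move: N0; rewrite /sqn; move: (expR x) (cos p) => E c N0.
by field.
Qed.

(** 1 - [dlogre] and - [dlogim] are the two parts of 1 / (1 + e^w), of squared modulus 1 / [sqn] by
    [recip_modulus]. Unlike [dlog_bound] the estimate decays as x grows, which makes integrals in t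
    converge at infinity. *)
Lemma recip_bound x p : `|p| < pi ->
  `|1 - dlogre x p| <= (cos (p / 2))^-1 / (1 + expR x) /\
  `|dlogim x p| <= (cos (p / 2))^-1 / (1 + expR x).
Proof.
move=> hp; have c0 := half_gt0 hp; have N0 := sqn_gt0 x hp.
have E1 : 0 < 1 + expR x by rewrite addr_gt0// expR_gt0.
have := recip_modulus x hp; have := sqn_ge x p.
pose m := (1 + expR x) * cos (p / 2).
have -> : (cos (p / 2))^-1 / (1 + expR x) = m^-1 by rewrite /m invfM mulrC.
rewrite -/m => mN h.
have m0 : 0 < m by rewrite mulr_gt0.
have Nm : (sqn x p)^-1 <= m^-1 ^+ 2.
  by rewrite exprVn lef_pV2 ?posrE ?exprn_gt0.
have key u v : u ^+ 2 + v ^+ 2 = (sqn x p)^-1 -> `|u| <= m^-1.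
  move=> e; rewrite -ler_sqr ?nnegrE ?invr_ge0 ?(ltW m0)// real_normK ?num_real//.
  by rewrite (le_trans _ Nm)// -e lerDl sqr_ge0.
by split; [exact: key h|apply: key; rewrite addrC; exact: h].
Qed.

(** From ln u <= u - 1 at u = (1 - t)^(-1/2). One formula serves both ends: it is linear in t near 0
    and has an integrable singularity at 1. *)
Lemma ln_onem_bound t : 0 < t < 1 -> - ln (1 - t) <= 2 * t / Num.sqrt (1 - t).
Proof.
move=> /andP[t0 t1]; have s0 : 0 < Num.sqrt (1 - t) by rewrite sqrtr_gt0 subr_gt0.
have sE : Num.sqrt (1 - t) ^+ 2 = 1 - t by rewrite sqr_sqrtr// subr_ge0 ltW.
set s := Num.sqrt _ in s0 sE *.
have s1 : s <= 1 by rewrite -(@ler_pXn2r _ 2) ?nnegrE ?(ltW s0)// expr1n sE gerBl ltW.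
rewrite -sE lnXn// -[ln s *+ 2]mulr_natl -mulrN -lnV ?posrE// -mulrA ler_pM2l//.
have h : ln s^-1 <= s^-1 - 1.
  have : -1 < s^-1 - 1 by rewrite ltrBrDr addNr invr_gt0.
  by move=> /le_ln1Dx; rewrite addrC subrK.
apply: (le_trans h); have -> : t = 1 - s ^+ 2 by rewrite sE opprB addrC subrK.
rewrite -[X in _ - X](divff (lt0r_neq0 s0)) -[X in X - _]mul1r -mulrBl.
by rewrite ler_wpM2r ?invr_ge0 ?(ltW s0)//; nra.
Qed.

Lemma logre_near0 t p : 0 < t < 1 -> `|p| < pi ->
  `|logre (ln t) p| <= 2 * t / Num.sqrt (1 - t).
Proof.
move=> t01 hp; have := ln_onem_bound t01; case/andP: t01 => t0 t1.
have b1 := logre_le (ln t) hp; rewrite lnK ?posrE// in b1.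
have b2 : ln (1 - t) <= logre (ln t) p.
  rewrite /logre ler_pdivlMl// mulr_natl -lnXn ?subr_gt0//.
  rewrite ler_ln ?posrE ?sqn_gt0 ?exprn_gt0 ?subr_gt0//.
  by have := sqn_ge_sub (ln t) p; rewrite lnK ?posrE.
have b3 : ln (1 + t) <= - ln (1 - t).
  rewrite -lnV ?posrE ?subr_gt0// ler_ln ?posrE ?invr_gt0 ?subr_gt0 ?addr_gt0//.
  rewrite -[leRHS]mul1r ler_pdivlMr ?subr_gt0//; nra.
by move=> h; rewrite ler_norml; apply/andP; split; lra.
Qed.

(** For t <= 1/2 this is [logim_neg_le]; beyond, |[logim]| < pi < 2 pi t. *)
Lemma logim_near0 t p : 0 < t < 1 -> `|p| < pi -> `|logim (ln t) p| <= 2 * pi * t.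
Proof.
move=> /andP[t0 t1] hp; have pi0 := pi_gt0 R; have pi2 := pi_ge2 R.
have [t2|t2] := leP t 2^-1; last first.
  by have := logim_norm_le (ln t) hp; nra.
have lt0 : ln t < 0 by rewrite ln_lt0// t0.
have := logim_neg_le lt0 hp; rewrite lnK ?posrE// => /le_trans; apply.
rewrite ler_pdivrMr ?subr_gt0//.
have : `|sin p| <= 1 by rewrite ler_norml sin_geN1 sin_le1.
have := normr_ge0 (sin p); move: (`|sin p|) => s s0 s1.
have h1 : t * s <= t * 1 by rewrite ler_pM2l.
have h2 : 1 <= 2 * pi * (1 - t) :> R by nra.
have h3 : t * 1 <= t * (2 * pi * (1 - t)) by rewrite ler_pM2l.
have -> : 2 * pi * t * (1 - t) = t * (2 * pi * (1 - t)) by ring.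
by rewrite (le_trans h1).
Qed.

(** The reflection t -> 1/t leads back to [logre_near0], at the cost of a term ln t. *)
Lemma logre_nearoo t p : 1 < t -> `|p| < pi ->
  `|logre (ln t) p| <= 2 * t^-1 / Num.sqrt (1 - t^-1) + ln t.
Proof.
move=> t1 hp; have t0 : 0 < t by lra.
have -> : logre (ln t) p = logre (ln t^-1) p + ln t.
  by rewrite lnV ?posrE// logre_reflect// subrK.
rewrite (le_trans (ler_normD _ _))// lerD ?logre_near0//.
  by rewrite invr_gt0 t0 invf_lt1.
by rewrite ger0_norm// ln_ge0// ltW.
Qed.

Lemma cos_half_ge p q : `|p| <= q -> q < pi -> cos (q / 2) <= cos (p / 2).
Proof.
move=> pq qpi; have -> : cos (p / 2) = cos (`|p| / 2).
  by case: ger0P => // _; rewrite mulNr cosN.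
have p0 := normr_ge0 p; move: pq; rewrite le_eqVlt => /predU1P[->//|pq].
by apply/ltW; rewrite ltr_cos ?in_itv/=; [lra|apply/andP; split; lra..].
Qed.

End log1p_second.

(** * Chain rules for the logarithm and its derivatives *)

Section log1p_rules.
Context {R : realType}.
Implicit Types (f : R -> R) (x p z df : R).

Lemma der_logre1 f x p df : `|p| < pi -> deriv_at f x df ->
  deriv_at (fun y => logre (f y) p) x (dlogre (f x) p * df).
Proof. move=> hp h; exact: (@der_comp _ (logre ^~ p) f _ _ _ (der_logre _ hp) h). Qed.

Lemma der_logre2 f x z df : `|f x| < pi -> deriv_at f x df ->
  deriv_at (fun y => logre z (f y)) x (- dlogim z (f x) * df).
Proof. move=> hp h; exact: (@der_comp _ (logre z) f _ _ _ (der_logre_arg _ hp) h). Qed.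

Lemma der_logim1 f x p df : `|p| < pi -> deriv_at f x df ->
  deriv_at (fun y => logim (f y) p) x (dlogim (f x) p * df).
Proof. move=> hp h; exact: (@der_comp _ (logim ^~ p) f _ _ _ (der_logim _ hp) h). Qed.

Lemma der_logim2 f x z df : `|f x| < pi -> deriv_at f x df ->
  deriv_at (fun y => logim z (f y)) x (dlogre z (f x) * df).
Proof. move=> hp h; exact: (@der_comp _ (logim z) f _ _ _ (der_logim_arg _ hp) h). Qed.

Lemma der_dlogre1 f x p df : `|p| < pi -> deriv_at f x df ->
  deriv_at (fun y => dlogre (f y) p) x (d2logre (f x) p * df).
Proof. move=> hp h; exact: (@der_comp _ (dlogre ^~ p) f _ _ _ (der_dlogre _ hp) h). Qed.

Lemma der_dlogre2 f x z df : `|f x| < pi -> deriv_at f x df ->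
  deriv_at (fun y => dlogre z (f y)) x (- d2logim z (f x) * df).
Proof. move=> hp h; exact: (@der_comp _ (dlogre z) f _ _ _ (der_dlogre_arg _ hp) h). Qed.

Lemma der_dlogim1 f x p df : `|p| < pi -> deriv_at f x df ->
  deriv_at (fun y => dlogim (f y) p) x (d2logim (f x) p * df).
Proof. move=> hp h; exact: (@der_comp _ (dlogim ^~ p) f _ _ _ (der_dlogim _ hp) h). Qed.

Lemma der_dlogim2 f x z df : `|f x| < pi -> deriv_at f x df ->
  deriv_at (fun y => dlogim z (f y)) x (d2logre z (f x) * df).
Proof. move=> hp h; exact: (@der_comp _ (dlogim z) f _ _ _ (der_dlogim_arg _ hp) h). Qed.

End log1p_rules.

Ltac der2 :=
  lazymatch goal with
  | |- deriv_at (fun=> ?c) _ _ => apply: der_cst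
  | |- deriv_at (fun y => logre (@?f y) (@?g y)) _ _ =>
      lazymatch f with
      | (fun=> ?z) => eapply (@der_logre2 _ g _ z)
      | _ => lazymatch g with (fun=> ?p) => eapply (@der_logre1 _ f _ p) end
      end
  | |- deriv_at (fun y => logim (@?f y) (@?g y)) _ _ =>
      lazymatch f with
      | (fun=> ?z) => eapply (@der_logim2 _ g _ z)
      | _ => lazymatch g with (fun=> ?p) => eapply (@der_logim1 _ f _ p) end
      end
  | |- deriv_at (fun y => dlogre (@?f y) (@?g y)) _ _ =>
      lazymatch f with
      | (fun=> ?z) => eapply (@der_dlogre2 _ g _ z)
      | _ => lazymatch g with (fun=> ?p) => eapply (@der_dlogre1 _ f _ p) end
      end
  | |- deriv_at (fun y => dlogim (@?f y) (@?g y)) _ _ =>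
      lazymatch f with
      | (fun=> ?z) => eapply (@der_dlogim2 _ g _ z)
      | _ => lazymatch g with (fun=> ?p) => eapply (@der_dlogim1 _ f _ p) end
      end
  | |- _ => der1
  end.
Ltac derl := apply: deriv_atE; [repeat der2 | ].

Lemma deriv_at_continuous (R : realType) (f : R -> R) (x df : R) :
  deriv_at f x df -> {for x, continuous f}.
Proof. exact: is_derive_continuous. Qed.

(** Continuity is taken from differentiability, so that the same rules serve; the derivative found
    on the way is discarded. *)
Ltac contl := eapply deriv_at_continuous; repeat der2.

(** * First rotation: a logarithm over 1 + c w^al *)

Section log_kernel.
Context {R : realType}.
Local Notation leb := (@lebesgue_measure R).
Variables (al be sigma : R).
Hypotheses (al0 : 0 < al) (al1 : al < 1) (hs : sigma = 0 \/ sigma = - pi).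
Implicit Types t p : R.

Let X t := al * ln t + be.
Let P p := al * (p + sigma).
(* [aa + i bb] is [log (1 - w) / (1 + e^be w^al e^(i al sigma))] at
   [w = t e^(ip)]; [sigma = 0] and [sigma = - pi] put the real values of the
   second factor on the positive and on the negative half line. *)
Let A t p := 1 - dlogre (X t) (P p).
Let B t p := - dlogim (X t) (P p).
Let lr t p := logre (ln t) (p - pi).
Let li t p := logim (ln t) (p - pi).
Let aa t p := A t p * lr t p - B t p * li t p.
Let bb t p := A t p * li t p + B t p * lr t p.
Let dd t p := t^-1 * (A t p * dlogre (ln t) (p - pi)
  - al * d2logre (X t) (P p) * lr t p + al * d2logim (X t) (P p) * li t p
  - B t p * dlogim (ln t) (p - pi)).

Let alpi : al * pi < pi.
Proof. by rewrite gtr_pMl// pi_gt0. Qed.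

Let P_le p : 0 <= p <= pi -> `|P p| <= al * pi.
Proof.
move=> /andP[p0 ppi]; rewrite /P normrM (gtr0_norm al0) ler_pM2l//.
by have pi0 := pi_gt0 R; case: hs => ->; rewrite ler_norml; apply/andP; lra.
Qed.

Let P_lt p : 0 <= p <= pi -> `|P p| < pi.
Proof. by move=> /P_le h; exact: le_lt_trans alpi. Qed.

Let Q_lt p : 0 < p <= pi -> `|p - pi| < pi.
Proof. by move=> /andP[? ?]; rewrite ltr_norml; apply/andP; lra. Qed.

(** The angles [P p] stay within al pi < pi, so cos ([P p] / 2) is at least 1/K. *)
Let K := (cos (al * pi / 2))^-1.

Let K0 : 0 < K.
Proof. by rewrite invr_gt0 half_gt0// ger0_norm// mulr_ge0 ?pi_ge0// ltW. Qed.

Let AB_bound t p : 0 <= p <= pi ->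
  `|A t p| <= K / (1 + expR (X t)) /\ `|B t p| <= K / (1 + expR (X t)).
Proof.
move=> hp; have [h1 h2] := recip_bound (X t) (P_lt hp).
have c0 : 0 < cos (al * pi / 2) by rewrite -invr_gt0.
have h : (cos (P p / 2))^-1 / (1 + expR (X t)) <= K / (1 + expR (X t)).
  rewrite ler_wpM2r ?invr_ge0 ?addr_ge0 ?expR_ge0//.
  have hc := cos_half_ge (P_le hp) alpi.
  by rewrite lef_pV2 ?posrE// (lt_le_trans c0 hc).
by split; [exact: le_trans h1 h|rewrite /B normrN; exact: le_trans h2 h].
Qed.

(** Ingredients of [maj], a majorant of |[aa]| / t and |[bb]| / t. On ]0, 1[ the constants 2 and 2
    pi come from [logre_near0] and [logim_near0], whose factor t cancels t^-1. On ]1, oo[ the decay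
    t^(- al) of the kernel beats the logarithm through ln t <= (2/al) t^(al/2). Every term is shaped
    so as to have an elementary bounded primitive. *)
Let C1 := K * (2 + 2 * pi).
Let C2 := 2 * K * expR (- be).
Let C3 := K * expR (- be) * (2 / al + pi).
Let m1 t := C1 * expR (- (2^-1 * ln (1 - t))).
Let m2 t := C2 * (t^-1 * t^-1 * expR (- (2^-1 * ln (1 - t^-1)))) +
            C3 * expR (- ((1 + al / 2) * ln t)).
Let maj t := (m1 \_ `]0, 1[) t + (m2 \_ `]1, +oo[) t.

Let C10 : 0 < C1. Proof. by rewrite mulr_gt0// addr_gt0// mulr_gt0// pi_gt0. Qed.
Let C20 : 0 < C2. Proof. by rewrite !mulr_gt0// expR_gt0. Qed.
Let C30 : 0 < C3.
Proof. by rewrite !mulr_gt0 ?expR_gt0// addr_gt0 ?divr_gt0 ?pi_gt0. Qed.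

Let inv_sqrtE t : 0 < t -> (Num.sqrt t)^-1 = expR (- (2^-1 * ln t)).
Proof.
by move=> t0; rewrite -powR12_sqrt ?(ltW t0)// /powR gt_eqF// expRN.
Qed.

Let maj_lt1 t : 0 < t < 1 -> maj t = m1 t.
Proof.
move=> t01; rewrite /maj !patchE mem_set ?memNset ?addr0//= in_itv//= andbT.
by case/andP: t01 => _ t1; apply/negP; rewrite -leNgt ltW.
Qed.

Let maj_gt1 t : 1 < t -> maj t = m2 t.
Proof.
move=> t1; rewrite /maj !patchE memNset ?mem_set ?add0r//= in_itv/= ?andbT//.
by apply/negP; rewrite negb_and -!leNgt (ltW t1) orbT.
Qed.

Let core_bound t p : 0 < t -> t != 1 -> 0 < p <= pi ->
  t^-1 * (K / (1 + expR (X t)) * (`|lr t p| + `|li t p|)) <= maj t.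
Proof.
move=> t0 t1 hp; have hq := Q_lt hp; have pi0 := pi_gt0 R.
have E0 := expR_gt0 (X t); have ti0 : 0 < t^-1 by rewrite invr_gt0.
have S0 : 0 <= `|lr t p| + `|li t p| by rewrite addr_ge0.
case: (ltgtP t 1) t1 => // [t1|t1] _.
- have t01 : 0 < t < 1 by rewrite t0.
  rewrite maj_lt1// /m1 -inv_sqrtE ?subr_gt0//.
  have s0 : 0 < Num.sqrt (1 - t) by rewrite sqrtr_gt0 subr_gt0.
  have s1 : Num.sqrt (1 - t) <= 1.
    by rewrite -[leRHS]sqrtr1 ler_wsqrtr// gerBl ltW.
  have S : `|lr t p| + `|li t p| <= (2 + 2 * pi) * t / Num.sqrt (1 - t).
    rewrite mulrDl mulrDl lerD ?logre_near0//.
    rewrite (le_trans (logim_near0 t01 hq))// -[leLHS]mulr1 ler_wpM2l//.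
      by rewrite !mulr_ge0// ltW.
    by rewrite invf_ge1.
  have KE : K / (1 + expR (X t)) <= K.
    by rewrite ler_piMr ?(ltW K0)// invf_le1 ?addr_gt0// lerDl ltW.
  rewrite ler_pdivrMl//; apply: (le_trans (ler_pM _ S0 KE S)).
    by rewrite divr_ge0 ?(ltW K0)// addr_ge0// ltW.
  by rewrite le_eqVlt; apply/orP; left; apply/eqP; rewrite /C1; ring.
- rewrite maj_gt1// /m2 -inv_sqrtE; last by rewrite subr_gt0 invf_lt1.
  have l0 : 0 < ln t by rewrite ln_gt0.
  set s := (Num.sqrt _)^-1.
  have s0 : 0 <= s by rewrite invr_ge0 sqrtr_ge0.
  have tE : t^-1 = expR (- ln t) by rewrite expRN lnK.
  have KE : K / (1 + expR (X t)) <= K * expR (- be) * expR (- (al * ln t)).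
    have -> : K * expR (- be) * expR (- (al * ln t)) = K * (expR (X t))^-1.
      by rewrite -mulrA -expRD -opprD [be + _]addrC expRN.
    rewrite ler_wpM2l ?(ltW K0)//.
    by rewrite lef_pV2 ?posrE ?addr_gt0// lerDr.
  have e1 : 1 <= expR (al / 2 * ln t).
    by rewrite -expR0 ler_expR mulr_ge0 ?divr_ge0 ?(ltW al0)// ltW.
  have lnt : ln t <= 2 / al * expR (al / 2 * ln t).
    rewrite -[X in _ <= X * _]invf_div -ler_pdivrMl ?invr_gt0 ?divr_gt0// invrK.
    have : 0 < al / 2 * ln t by rewrite mulr_gt0// divr_gt0.
    by move=> h; have := expR_ge1Dx (al / 2 * ln t); lra.
  have S : `|lr t p| + `|li t p| <= 2 * t^-1 * s + (2 / al + pi) * expR (al / 2 * ln t).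
    rewrite [(2 / al + pi) * _]mulrDl addrA lerD//.
      by rewrite (le_trans (logre_nearoo t1 hq))// lerD2l.
    rewrite (le_trans (logim_norm_le _ hq))// (le_trans (ltW hq))//.
    by rewrite ler_peMr// ltW.
  have K'0 : 0 <= K / (1 + expR (X t)) by rewrite divr_ge0 ?(ltW K0)// addr_ge0// ltW.
  apply: (@le_trans _ _ (t^-1 * (K * expR (- be) * expR (- (al * ln t)) *
      (2 * t^-1 * s + (2 / al + pi) * expR (al / 2 * ln t))))).
    by rewrite ler_pM2l// ler_pM.
  have -> : expR (- ((1 + al / 2) * ln t)) =
      t^-1 * (expR (- (al * ln t)) * expR (al / 2 * ln t)).
    by rewrite tE -!expRD; congr expR; field.
  have e2 : expR (- (al * ln t)) <= 1.
    by rewrite -expR0 ler_expR oppr_le0 mulr_ge0 // ltW.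
  rewrite /C2 /C3 mulrDr mulrDr lerD//; last first.
    by rewrite le_eqVlt; apply/orP; left; apply/eqP; ring.
  have -> : t^-1 * (K * expR (- be) * expR (- (al * ln t)) * (2 * t^-1 * s)) =
    2 * K * expR (- be) * (t^-1 * t^-1 * s) * expR (- (al * ln t)) by ring.
  by rewrite ler_piMr// !mulr_ge0 ?expR_ge0 ?(ltW K0) ?(ltW ti0).
Qed.

Let ab_bound t p : 0 < t -> t != 1 -> 0 < p <= pi ->
  `|t^-1 * aa t p| <= maj t /\ `|t^-1 * bb t p| <= maj t.
Proof.
move=> t0 t1 hp; have hp' : 0 <= p <= pi by case/andP: hp => /ltW ->.
have [hA hB] := AB_bound t hp'; have h := core_bound t0 t1 hp.
have key (u v x y c : R) : `|u| <= c -> `|v| <= c -> `|u * x| + `|v * y| <= c * (`|x| + `|y|).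
  by move=> hu hv; rewrite !normrM mulrDr lerD// ler_wpM2r.
have ti0 : 0 < t^-1 by rewrite invr_gt0.
split; rewrite normrM (gtr0_norm ti0) (le_trans _ h)// ler_pM2l//.
- by rewrite (le_trans (ler_normB _ _))// key.
- by rewrite (le_trans (ler_normD _ _))// [`|lr t p| + _]addrC key.
Qed.

Let integrable_maj : leb.-integrable `]0, +oo[ (EFin \o maj).
Proof.
have mI (i : interval R) : measurable ([set` i] : set (measurableTypeR R)) by [].
have sub1 : `]0, +oo[%classic `&` `]0, 1[%classic = `]0, 1[%classic :> set R.
  by apply/setIidr => x /=; rewrite !in_itv/= => /andP[->].
have sub2 : `]0, +oo[%classic `&` `]1, +oo[%classic = `]1, +oo[%classic :> set R.
  by apply/setIidr => x /=; rewrite !in_itv/= !andbT; exact: lt_trans.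
have E : EFin \o maj = (EFin \o m1) \_ `]0, 1[ \+ (EFin \o m2) \_ `]1, +oo[.
  apply/funext => x; rewrite /= /maj EFinD !patchE.
  by congr (_ + _)%E; case: ifP.
rewrite E; apply: integrableD => //.
- apply/integrable_restrict => //; rewrite sub1.
  (* [m1] is C1 (1 - t)^(-1/2), with primitive - 2 C1 sqrt (1 - t). *)
  apply: (@integrable_of_bounded_primitive _ m1
    (fun t => - (2 * C1) * expR (2^-1 * ln (1 - t))) (fun n => harmonic n / 2)
    (fun n => 1 - harmonic n / 2) _ (2 * C1) _ _ _ itv01E).
  + by move=> m n mn; rewrite ler_pM2r// harmonic_homo.
  + by move=> m n mn; rewrite lerD2l lerN2 ler_pM2r// harmonic_homo.
  + by move=> n; have := @harmonic_le1 R n; lra.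
  + by move=> x _; rewrite mulr_ge0 ?expR_ge0// ltW.
  + by rewrite /m1; apply: measurable_funTS; meas.
  + move=> x; rewrite /= in_itv/= => /andP[x0 x1]; have h : 0 < 1 - x by lra.
    by rewrite /m1; contl.
  + move=> x; rewrite /= in_itv/= => /andP[x0 x1]; have h : 0 < 1 - x by lra.
    derl; rewrite /m1 expRN mulrC.
    have e : expR (2^-1 * ln (1 - x)) * expR (2^-1 * ln (1 - x)) = 1 - x.
      rewrite -expRD -[RHS]lnK ?posrE//; congr expR.
      by move: (ln _) => L; lra.
    have := expR_gt0 (2^-1 * ln (1 - x)).
    set y := expR _ in e *; move=> y0; rewrite -e; move: (ln _) => L.
    by field; rewrite gt_eqF.
  + move=> x; rewrite /= in_itv/= => /andP[x0 x1]; have h : 0 < 1 - x by lra.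
    have C1' : 0 <= 2 * C1 by apply: mulr_ge0 => //; exact: ltW.
    rewrite normrM normrN !ger0_norm ?expR_ge0//.
    have e1 : expR (2^-1 * ln (1 - x)) <= 1.
      by rewrite -[leRHS]expR0 ler_expR pmulr_rle0// ln_le0// gerBl ltW.
    exact: ler_piMr.
- apply/integrable_restrict => //; rewrite sub2.
  (* The primitive is 2 C2 sqrt (1 - 1/t) - (2/al) C3 t^(- al/2). *)
  apply: (@integrable_of_bounded_primitive _ m2
    (fun t => 2 * C2 * expR (2^-1 * ln (1 - t^-1)) -
       (2 / al * C3) * expR (- (al / 2 * ln t))) (fun n => 1 + harmonic n)
    (fun n => n.+2%:R) _ (2 * C2 + 2 / al * C3) _ _ _ itv1yE).
  + by move=> m n mn; rewrite lerD2l harmonic_homo.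
  + by move=> m n mn; rewrite ler_nat.
  + by move=> n; rewrite -natr1 addrC lerD// (le_trans (harmonic_le1 _))// ler1n.
  + move=> x _; have C2' := ltW C20; have C3' := ltW C30.
    rewrite /m2; apply: addr_ge0.
      apply: mulr_ge0 => //; apply: mulr_ge0; last exact: expR_ge0.
      by rewrite -expr2 sqr_ge0.
    by apply: mulr_ge0 => //; exact: expR_ge0.
  + by rewrite /m2; apply: measurable_funTS; meas.
  + move=> x; rewrite /= in_itv/= andbT => x1; have x0 : 0 < x by lra.
    have xN0 : x != 0 by rewrite gt_eqF.
    have h : 0 < 1 - x^-1 by rewrite subr_gt0 invf_lt1.
    by rewrite /m2; contl.
  + move=> x; rewrite /= in_itv/= andbT => x1; have x0 : 0 < x by lra.
    have xN0 : x != 0 by rewrite gt_eqF.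
    have h : 0 < 1 - x^-1 by rewrite subr_gt0 invf_lt1.
    derl; rewrite /m2.
    have -> : expR (- ((1 + al / 2) * ln x)) = x^-1 * expR (- (al / 2 * ln x)).
      by rewrite mulrDl mul1r opprD expRD (expRN (ln x)) lnK ?posrE.
    rewrite [expR (- (2^-1 * _))]expRN.
    have e : expR (2^-1 * ln (1 - x^-1)) * expR (2^-1 * ln (1 - x^-1)) = 1 - x^-1.
      rewrite -expRD -[RHS]lnK ?posrE//; congr expR.
      by move: (ln _) => L; lra.
    have := expR_gt0 (2^-1 * ln (1 - x^-1)).
    set y := expR (2^-1 * _) in e *; set z := expR (- _).
    move=> y0; rewrite -e; move: (ln _) (ln _) => L L'.
    by field; rewrite xN0 !gt_eqF.
  + move=> x; rewrite /= in_itv/= andbT => x1; have x0 : 0 < x by lra.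
    have h : 0 < 1 - x^-1 by rewrite subr_gt0 invf_lt1.
    have l0 : 0 <= ln x by rewrite ln_ge0// ltW.
    have C3' : 0 <= 2 / al * C3.
      by apply: mulr_ge0; [rewrite divr_ge0// ltW|exact: ltW].
    rewrite (le_trans (ler_normB _ _))// lerD//.
      have C2' : 0 <= 2 * C2 by apply: mulr_ge0 => //; exact: ltW.
      rewrite normrM !ger0_norm ?expR_ge0//.
      have e1 : expR (2^-1 * ln (1 - x^-1)) <= 1.
        by rewrite -[leRHS]expR0 ler_expR pmulr_rle0// ln_le0// gerBl invr_ge0 ltW.
      exact: ler_piMr.
    have e2 : expR (- (al / 2 * ln x)) <= 1.
      by rewrite -[leRHS]expR0 ler_expR oppr_le0 !mulr_ge0// ltW.
    by rewrite normrM !ger0_norm ?expR_ge0// ler_piMr.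
Qed.

Let d2_bound x p (M : R) : `|dlogre x p| <= M -> `|dlogim x p| <= M ->
  `|d2logre x p| <= M * (1 + 2 * M) + M ^+ 2 /\
  `|d2logim x p| <= M * (1 + 2 * M) + M ^+ 2.
Proof.
move=> h1 h2; have M0 : 0 <= M := le_trans (normr_ge0 _) h1.
rewrite /d2logre /d2logim; split.
  rewrite (le_trans (ler_normD _ _))// lerD//; last first.
    by rewrite normrX ler_pXn2r// nnegrE.
  rewrite normrM ler_pM// (le_trans (ler_normB _ _))// normr1 lerD2l.
  by rewrite (le_trans h1)// ler_peMl// ler1n.
rewrite -[leLHS]addr0 lerD ?sqr_ge0// normrM ler_pM//.
rewrite (le_trans (ler_normB _ _))// normr1 lerD2l normrM ger0_norm//.
by rewrite ler_pM2l.
Qed.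

Let cq p1 := (cos ((pi - p1) / 2))^-2.
Let D := K ^+ 2 * (1 + 2 * K ^+ 2) + (K ^+ 2) ^+ 2.

(** Only its finiteness matters, for Fubini on one rectangle. It blows up as [p1] tends to 0, where
    log (1 - w) is singular at w = 1. *)
Let dd_bound t1 t2 p1 t p : 0 < t1 -> 0 < p1 -> t1 <= t <= t2 -> p1 <= p <= pi ->
  `|dd t p| <= t1^-1 * (K * cq p1
     + al * D * (ln (1 + t2) + `|ln (cos ((pi - p1) / 2))|) + al * D * pi + K * cq p1).
Proof.
move=> t10 p10 ht hp'; case/andP: ht => tt1 tt2; case/andP: hp' => pp1 ppi.
have t0 : 0 < t by exact: lt_le_trans tt1.
have pi0 := pi_gt0 R.
have hp : 0 <= p <= pi by rewrite ppi andbT; lra.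
have hq : `|p - pi| < pi by apply: Q_lt; rewrite ppi andbT; lra.
have hP := P_lt hp; have [hA hB] := AB_bound t hp.
have KE : K / (1 + expR (X t)) <= K.
  by rewrite ler_piMr ?(ltW K0)// invf_le1 ?addr_gt0 ?expR_gt0// lerDl expR_ge0.
have {}hA := le_trans hA KE; have {}hB := le_trans hB KE.
have qq : `|p - pi| <= pi - p1 by rewrite ler_norml; apply/andP; lra.
have hqq : pi - p1 < pi :> R by lra.
have cq0 : 0 < cos ((pi - p1) / 2).
  by apply: half_gt0; rewrite ger0_norm; lra.
have hcq := cos_half_ge qq hqq.
have cP := cos_half_ge (P_le hp) alpi.
have [e1 e2] := dlog_bound (ln t) hq; have [e3 e4] := dlog_bound (X t) hP.
have le2 (x y : R) : 0 < x -> x <= y -> y ^- 2 <= x ^- 2.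
  move=> x0 xy; rewrite lef_pV2 ?posrE ?exprn_gt0 ?(lt_le_trans x0)//.
  by rewrite ler_pXn2r// nnegrE ltW// (lt_le_trans x0).
have {}e1 := le_trans e1 (le2 _ _ cq0 hcq).
have {}e2 := le_trans e2 (le2 _ _ cq0 hcq).
have cK0 : 0 < cos (al * pi / 2) by rewrite -invr_gt0.
have K2 : (cos (al * pi / 2)) ^- 2 = K ^+ 2 by rewrite /K exprVn.
have {}e3 := le_trans e3 (le2 _ _ cK0 cP).
have {}e4 := le_trans e4 (le2 _ _ cK0 cP).
rewrite K2 in e3 e4; have [d1 d2] := d2_bound e3 e4.
have D0 : 0 <= D := le_trans (normr_ge0 _) d1.
have L : `|lr t p| <= ln (1 + t2) + `|ln (cos ((pi - p1) / 2))|.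
  have b1 := logre_le (ln t) hq; have b2 := logre_ge (ln t) hq.
  rewrite lnK ?posrE// in b1 b2.
  have l1 : 0 <= ln (1 + t) by rewrite ln_ge0// lerDl ltW.
  have l2 : ln (1 + t) <= ln (1 + t2).
    by rewrite ler_ln ?posrE ?addr_gt0 ?lerD2l// (lt_le_trans t0).
  have l3 : ln (cos ((pi - p1) / 2)) <= ln (cos ((p - pi) / 2)).
    by rewrite ler_ln ?posrE// (lt_le_trans cq0).
  have l4 : - ln (cos ((pi - p1) / 2)) <= `|ln (cos ((pi - p1) / 2))|.
    by rewrite -normrN ler_norm.
  by rewrite /lr ler_norml; apply/andP; split; lra.
have I : `|li t p| <= pi := le_trans (logim_norm_le _ hq) (ltW hq).
rewrite /dd normrM ler_pM//.
  by rewrite gtr0_norm ?invr_gt0// lef_pV2 ?posrE.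
rewrite (le_trans (ler_normB _ _))// lerD//; last by rewrite normrM ler_pM.
rewrite (le_trans (ler_normD _ _))// lerD//; last first.
  by rewrite normrM ler_pM// normrM (gtr0_norm al0) ler_pM2l.
rewrite (le_trans (ler_normB _ _))// lerD//; first by rewrite normrM ler_pM.
by rewrite normrM ler_pM// normrM (gtr0_norm al0) ler_pM2l.
Qed.

(** The lower angle is 1/(n + 1) instead of 0, because w = 1 is a singular point of the kernel. *)
Let rotation_n n :
  (\int[leb]_(t in `[harmonic n, n.+1%:R]) (t^-1 * (bb t pi - bb t (harmonic n)))%:E =
   \int[leb]_(p in `[harmonic n, pi]) (aa n.+1%:R p - aa (harmonic n) p)%:E)%E.
Proof.
have u0 := @harmonic_gt0 R n.
have uw : harmonic n <= n.+1%:R :> R by rewrite (le_trans (harmonic_le1 _))// ler1n.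
have upi : harmonic n <= pi :> R.
  by rewrite (le_trans (harmonic_le1 _))// (le_trans _ (pi_ge2 R))// ler1n.
apply: (@rotation _ aa bb dd _ _ _ _ _ u0 uw upi).
  by rewrite /dd /A /B /X /P /lr /li /d2logre /d2logim; meas.
move=> t p ht hp; have b := dd_bound u0 u0 ht hp.
have t0 : 0 < t by case/andP: ht => + _; exact: lt_le_trans.
have tN0 : t != 0 by rewrite gt_eqF.
have hp' : 0 < p <= pi by case/andP: hp => h ->; rewrite andbT (lt_le_trans u0).
have hP : `|al * (p + sigma)| < pi by apply: P_lt; case/andP: hp' => /ltW ->.
have hq := Q_lt hp'.
split.
- rewrite /aa /A /B /lr /li /X /P; derl.
  rewrite /dd /A /B /lr /li /X /P.
  move: (dlogre _ _) (dlogim _ _) (d2logre _ _) (d2logim _ _) (logre _ _) (logim _ _).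
  by move=> y1 y2 y3 y4 y5 y6; field.
- rewrite /bb /A /B /lr /li /X /P; derl.
  rewrite /dd /A /B /lr /li /X /P.
  move: (dlogre _ _) (dlogim _ _) (d2logre _ _) (d2logim _ _) (logre _ _) (logim _ _).
  by move=> y1 y2 y3 y4 y5 y6; field.
- by rewrite /dd /A /B /lr /li /X /P /d2logre /d2logim; contl.
- by rewrite /dd /A /B /lr /li /X /P /d2logre /d2logim; contl.
- exact: b.
Qed.

(** On the arc |w| = t the kernel is at most t [maj t], which tends to 0 at both ends of ]0, oo[.
    The factor pi in [eps] bounds the range of p. *)
Let vertical_cvg0 :
  (\int[leb]_(p in `[harmonic n, pi]) (aa n.+1%:R p - aa (harmonic n) p)%:E
    @[n --> \oo] --> 0)%E.
Proof.
have pi0 := pi_gt0 R.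
pose eps n : R := (2 * C1 * harmonic n + (2 * C2 * harmonic n +
  C3 * harmonic n `^ (al / 2))) * pi.
have eps0 : eps n @[n --> \oo] --> 0.
  rewrite -(mul0r pi); apply: cvgMl.
  have h : 2 * C1 * 0 + (2 * C2 * 0 + C3 * 0) = 0 by rewrite !mulr0 !addr0.
  rewrite -h; apply: cvgD; last apply: cvgD.
  - by apply: cvgMr; exact: cvg_harmonic.
  - by apply: cvgMr; exact: cvg_harmonic.
  - by apply: cvgMr; apply: harmonic_powR_cvg0; rewrite divr_gt0.
suff H : \forall n \near \oo,
  (`|\int[leb]_(p in `[harmonic n, pi]) (aa n.+1%:R p - aa (harmonic n) p)%:E|
    <= (eps n)%:E)%E.
  apply/fine_cvgP; split.
    apply: filterS H => n h.
    by rewrite -abse_fin_num ge0_fin_numE// (le_lt_trans h)// ltry.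
  apply: (@squeeze_cvgr _ _ _ _ (fun n => - eps n) eps) => //; last first.
    by rewrite -oppr0; exact: cvgN.
  apply: filterS H => n h.
  have f : (\int[leb]_(p in `[harmonic n, pi]) (aa n.+1%:R p - aa (harmonic n) p)%:E)%E
    \is a fin_num.
    by rewrite -abse_fin_num ge0_fin_numE// (le_lt_trans h)// ltry.
  by rewrite -ler_norml /= -lee_fin -abse_EFin fineK.
(* From n = 1 on, u <= 1/2 and so (1 - u)^(-1/2) <= 2: this is the factor 2 in [eps]. At n = 0 both
   arcs would pass through the exceptional value t = 1. *)
exists 1%N => // n n1.
set u := @harmonic R n; have u0 : 0 < u := harmonic_gt0 n.
have u2 : u <= 2^-1 by rewrite lef_pV2 ?posrE// ler_nat ltnS.
have w1 : 1 < n.+1%:R :> R by rewrite ltr1n ltnS.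
have wu : n.+1%:R^-1 = u by [].
have upi : u <= pi by rewrite (le_trans u2)//; have := pi_ge2 R; lra.
have e2 : expR (- (2^-1 * ln (1 - u))) <= 2.
  apply: (@le_trans _ _ (expR (- ln (1 - u)))).
    have : ln (1 - u) <= 0 by rewrite ln_le0// gerBl ltW.
    by rewrite ler_expR; move: (ln _) => L; lra.
  rewrite expRN lnK ?posrE; last by lra.
  by rewrite -[leRHS]invrK lef_pV2 ?posrE; lra.
have bu p : u <= p <= pi -> `|aa u p| <= 2 * C1 * u.
  move=> /andP[hp hp']; have [||] := @ab_bound u p u0.
  - by rewrite lt_eqF; lra.
  - by rewrite hp' andbT (lt_le_trans u0).
  rewrite normrM gtr0_norm ?invr_gt0// ler_pdivrMl// maj_lt1; last by apply/andP; lra.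
  move=> h _; apply: (le_trans h); rewrite /m1 mulrC ler_pM2r//.
  by rewrite mulrC ler_pM2r.
have bw p : u <= p <= pi -> `|aa n.+1%:R p| <= 2 * C2 * u + C3 * u `^ (al / 2).
  move=> /andP[hp hp']; have [|||] := @ab_bound n.+1%:R p.
  - by rewrite ltr0n.
  - by rewrite gt_eqF.
  - by rewrite hp' andbT (lt_le_trans u0).
  rewrite normrM gtr0_norm ?invr_gt0 ?ltr0n// ler_pdivrMl ?ltr0n// maj_gt1//.
  move=> h _; apply: (le_trans h); rewrite /m2 wu mulrDr lerD//.
    have -> : n.+1%:R * (C2 * (u * u * expR (- (2^-1 * ln (1 - u))))) =
      (n.+1%:R * u) * (C2 * u * expR (- (2^-1 * ln (1 - u)))) by ring.
    rewrite -wu divff ?pnatr_eq0// mul1r wu mulrC -mulrA ler_pM// ?expR_ge0//.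
    by rewrite mulr_ge0// ltW.
  rewrite mulrCA ler_pM2l// /powR gt_eqF// -wu lnV ?posrE ?ltr0n//.
  rewrite -{1}[n.+1%:R]lnK ?posrE ?ltr0n// -expRD ler_expR.
  by rewrite le_eqVlt; apply/orP; left; apply/eqP; ring.
have mf : measurable_fun setT
    (fun p => aa n.+1%:R p - aa u p : measurableTypeR R).
  by rewrite /aa /A /B /lr /li /X /P; meas.
apply: (le_trans (abse_integral_itv_le upi mf (C := 2 * C1 * u +
    (2 * C2 * u + C3 * u `^ (al / 2))) _)).
  move=> p hp; rewrite (le_trans (ler_normB _ _))// addrC.
  by apply: lerD; [exact: bu|exact: bw].
rewrite lee_fin /eps -/u ler_wpM2l// ?gerBl ?(ltW u0)//.
have C1' := ltW C10; have C2' := ltW C20; have C3' := ltW C30; have u0' := ltW u0.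
apply: addr_ge0; last apply: addr_ge0.
- by apply: mulr_ge0 => //; apply: mulr_ge0.
- by apply: mulr_ge0 => //; apply: mulr_ge0.
- by apply: mulr_ge0 => //; exact: powR_ge0.
Qed.

(** The limit of [bb] as p decreases to 0, where log (1 - w) tends to ln |1 - t| - i pi 1_(t >
    1). *)
Let b0 t : R := B t 0 * ln `|1 - t| - \1_(`]1, +oo[%classic : set R) t * (pi * A t 0).

(** The modulus part is continuous up to p = 0, since t is not 1. The argument part has angle - pi
    there, out of reach of the derivative rules: for t < 1 it tends to 0 by [logim_neg_le], and for
    t > 1 the reflection adds - pi. *)
Let bb_cvg t : 0 < t -> t != 1 -> bb t (harmonic n) @[n --> \oo] --> b0 t.
Proof.
move=> t0 t1; have pi0 := pi_gt0 R.
have h0 : @harmonic R n @[n --> \oo] --> 0 by exact: cvg_harmonic.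
have hP0 : `|al * (0 + sigma)| < pi by apply: P_lt; rewrite lexx ltW.
have cA : A t (harmonic n) @[n --> \oo] --> A t 0.
  apply: (@continuous_seq _ (A t)) => //.
  by rewrite /A /X /P; contl.
have cB : B t (harmonic n) @[n --> \oo] --> B t 0.
  apply: (@continuous_seq _ (B t)) => //.
  by rewrite /B /X /P; contl.
have hn n : 0 < @harmonic R n <= pi.
  by rewrite harmonic_gt0/= (le_trans (harmonic_le1 _))// (le_trans _ (pi_ge2 R))// ler1n.
have sq : sqn (ln t) (0 - pi) = (1 - t) ^+ 2.
  by rewrite /sqn sub0r cosN cospi lnK ?posrE//; ring.
have clr : lr t (harmonic n) @[n --> \oo] --> ln `|1 - t|.
  have -> : ln `|1 - t| = lr t 0.
    rewrite /lr /logre sq -[(1 - t) ^+ 2]real_normK ?num_real// lnXn; last first.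
      by rewrite normr_gt0 subr_eq0 eq_sym.
    by move: (ln _) => L; rewrite -mulr_natl; field.
  apply: (@continuous_seq _ (lr t)) => //.
  have N0 : 0 < sqn (ln t) (0 - pi).
    by rewrite sq exprn_even_gt0//= subr_eq0 eq_sym.
  by rewrite /sqn in N0; rewrite /lr /logre /sqn; contl.
have csin : `|sin (harmonic n - pi)| @[n --> \oo] --> (0 : R).
  have -> : 0 = `|sin (0 - pi)| :> R by rewrite sub0r sinN sinpi oppr0 normr0.
  apply: (@continuous_seq _ (fun p : R => `|sin (p - pi)|)) => //.
  apply: continuous_comp; last exact: norm_continuous.
  by contl.
have cneg (x : R) : x < 0 -> logim x (harmonic n - pi) @[n --> \oo] --> 0.
  move=> x0; apply/cvgr0Pnorm_lt => e e0.
  have E1 : 0 < 1 - expR x by rewrite subr_gt0 -expR0 ltr_expR.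
  have E0 := expR_gt0 x.
  have : \forall n \near \oo, `|sin (harmonic n - pi)| < e / (expR x / (1 - expR x)).
    by apply: (@cvgr_lt _ _ _ _ _ _ csin); rewrite !divr_gt0.
  apply: filterS => n h; apply: (le_lt_trans (logim_neg_le x0 (Q_lt (hn n)))).
  by rewrite mulrAC mulrC -ltr_pdivlMr// divr_gt0.
rewrite /bb /b0 addrC.
have -> : - (\1_`]1, +oo[ t * (pi * A t 0)) = A t 0 * (- (\1_`]1, +oo[ t * pi)).
  by rewrite mulrN; congr (- _); ring.
apply: cvgD; apply: cvgM => //.
rewrite indicE; have -> : (t \in `]1, +oo[%classic) = (1 < t).
  by apply/idP/idP; rewrite inE/= in_itv/= andbT.
case: (ltgtP t 1) t1 => // [t1|t1] _.
- by rewrite mul0r oppr0; apply: cneg; rewrite ln_lt0// t0.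
- rewrite mul1r -sub0r -[X in _ --> X]subr0.
  under eq_fun do rewrite /li -[ln t]opprK logim_reflect.
  apply: cvgB; first by apply: cvgB => //; exact: cvg_cst.
  by apply: cneg; rewrite oppr_lt0 ln_gt0.
Qed.

Let h t : R := t^-1 * (bb t pi - b0 t).

Let log_kernel_integral0 :
  leb.-integrable (`]0, +oo[%classic : set (measurableTypeR R)) (EFin \o h) /\
  (\int[leb]_(t in `]0%R, +oo[) (h t)%:E = 0)%E.
Proof.
have pi0 := pi_gt0 R.
have hn n : 0 < @harmonic R n <= pi.
  by rewrite harmonic_gt0/= (le_trans (harmonic_le1 _))// (le_trans _ (pi_ge2 R))// ler1n.
have mA p : measurable_fun setT (fun t => A t p : measurableTypeR R).
  by rewrite /A /X /P; meas.
have mB p : measurable_fun setT (fun t => B t p : measurableTypeR R).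
  by rewrite /B /X /P; meas.
have mbb p : measurable_fun setT (fun t => bb t p : measurableTypeR R).
  by rewrite /bb /A /B /lr /li /X /P; meas.
have mI : measurable_fun setT (\1_(`]1, +oo[%classic : set R) : measurableTypeR R -> R).
  exact: measurable_indic.
have mb0 : measurable_fun setT (b0 : measurableTypeR R -> R).
  have := mA 0; have := mB 0; rewrite /b0 => mB0 mA0.
  by apply: measurable_fun_add; meas.
have [|||||h1 h2] := @dominated_exhaust R
  (fun n t => t^-1 * (bb t pi - bb t (harmonic n))) h
  (fun t => maj t + maj t) (@harmonic R) (fun n => n.+1%:R) _ 1
  harmonic_homo succ_homo itv0yE.
- move=> n; apply: measurable_funTS.
  by have := mbb pi; have := mbb (harmonic n) => ? ?; meas.
- by apply: measurable_funTS; have := mbb pi => ?; rewrite /h; meas.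
- exact: integrableD integrable_maj integrable_maj.
- move=> t; rewrite /= in_itv/= andbT => t0 t1; apply: cvgMr; apply: cvgB.
    exact: cvg_cst.
  exact: bb_cvg.
- move=> n t; rewrite /= in_itv/= andbT => t0 t1.
  rewrite mulrBr (le_trans (ler_normB _ _))// lerD//.
    by have [|_] := @ab_bound t pi t0 t1; rewrite ?pi0 ?lexx.
  by have [] := @ab_bound t (harmonic n) t0 t1 (hn n).
split=> //; move: h2; under eq_fun do rewrite rotation_n.
by move=> h2; rewrite -(cvg_lim _ h2)//; apply: cvg_lim => //; exact: vertical_cvg0.
Qed.

(** At p = pi the logarithm is ln (1 + t), at p = 0 the limit [b0] takes over. For sigma = 0 the
    coefficient of ln |1 - t| is [dlogim] at angle 0, which is 0; for sigma = - pi the same happens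
    to the coefficient of ln (1 + t). *)
Lemma log_kernel_integral :
  let g (t : R) : R := t^-1 * (- dlogim (al * ln t + be) (al * (pi + sigma)) * ln (1 + t)
    + dlogim (al * ln t + be) (al * (0 + sigma)) * ln `|1 - t|
    + \1_(`]1, +oo[%classic : set R) t *
      (pi * (1 - dlogre (al * ln t + be) (al * (0 + sigma))))) in
  leb.-integrable (`]0, +oo[%classic : set (measurableTypeR R)) (EFin \o g) /\
  (\int[leb]_(t in `]0%R, +oo[) (g t)%:E = 0)%E.
Proof.
move=> g; have [h1 h2] := log_kernel_integral0.
have gh t : t \in (`]0, +oo[%classic : set R) -> (h t)%:E = (g t)%:E.
  rewrite inE/= in_itv/= andbT => t0; congr (_%:E); rewrite /h /bb /b0 /li /lr.
  rewrite subrr logim0 logre0 mulr0 add0r lnK ?posrE//; congr (_ * _).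
  by rewrite opprB -[RHS]addrA; congr (_ + _); rewrite addrC /B mulNr opprK.
split; last by rewrite -h2; apply: eq_integral => t tD; rewrite gh.
by apply: eq_integrable h1.
Qed.

End log_kernel.

(** * The two logarithmic integrals *)

Section log_integrals.
Context {R : realType}.
Local Notation leb := (@lebesgue_measure R).
Variables (al be : R).
Hypotheses (al0 : 0 < al) (al1 : al < 1).
Implicit Types t q x : R.

Lemma dlogre_reflect x q : `|q| < pi -> dlogre (- x) q = 1 - dlogre x q.
Proof.
move=> hq; have N0 := sqn_gt0 x hq; have N1 := sqn_gt0 (- x) hq.
rewrite /dlogre /sqn expRN in N0 N1 *; have := expR_gt0 x.
move: N0 N1; move: (expR x) (cos q) => E c N0 N1 E0.
have N2 : E * E * (1 + 2 * (E^-1 * c) + E^-1 * E^-1) != 0.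
  by rewrite gt_eqF// !mulr_gt0.
rewrite -[LHS](mulKf (lt0r_neq0 (mulr_gt0 E0 E0))).
have -> : 1 + 2 * (E^-1 * c) + E^-1 * E^-1 = (1 + 2 * (E * c) + E * E) / (E * E).
  by field; rewrite gt_eqF.
by field; rewrite !gt_eqF.
Qed.

Lemma dlogimN x q : dlogim x (- q) = - dlogim x q.
Proof. by rewrite /dlogim sinN sqnN mulrN mulNr. Qed.

Lemma dlogreN x q : dlogre x (- q) = dlogre x q.
Proof. by rewrite /dlogre cosN sqnN. Qed.

Lemma dlogim0 x : dlogim x 0 = 0.
Proof. by rewrite /dlogim sin0 mulr0 mul0r. Qed.

(** t^-1 Re (1 / (1 + e^(al ln t + be + iq))), the term that the argument of log (1 - w) leaves on t
    > 1. Its primitive [Fq] vanishes at infinity. *)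
Let T q t := t^-1 * (1 - dlogre (al * ln t + be) q).
Let Fq q t := - (al^-1 * logre (- (al * ln t + be)) q).

Let dF q t : `|q| < pi -> 0 < t -> is_derive t 1 (Fq q) (T q t).
Proof.
move=> hq t0; have tN0 : t != 0 by rewrite gt_eqF.
rewrite /Fq; derl; rewrite /T dlogre_reflect//.
by move: (dlogre _ _) (logre _ _) => y z; field; rewrite tN0 gt_eqF.
Qed.

Let cT q t : `|q| < pi -> 0 < t -> {for t, continuous (T q)}.
Proof.
by move=> hq t0; have tN0 : t != 0; [rewrite gt_eqF|rewrite /T; contl].
Qed.

Let F1 q : `|q| < pi -> Fq q (1 + harmonic n) @[n --> \oo] --> Fq q 1.
Proof.
move=> hq; apply: (@continuous_seq _ (Fq q)).
  exact: is_derive_continuous (dF hq ltr01).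
rewrite -[X in _ --> X]addr0; apply: cvgD; first exact: cvg_cst.
exact: cvg_harmonic.
Qed.

Let Foo q : Fq q n.+2%:R @[n --> \oo] --> 0.
Proof.
pose G (E : R) : R := - (al^-1 * (2^-1 * ln (1 + 2 * (E * cos q) + E * E))).
have G0 : G 0 = 0 by rewrite /G !mul0r mulr0 !addr0 ln1 !mulr0 oppr0.
rewrite -G0 /Fq.
have -> : (fun n => - (al^-1 * logre (- (al * ln n.+2%:R + be)) q)) =
    (fun n => G (expR (- be) * (@harmonic R n.+1) `^ al)).
  apply/funext => n; rewrite /G /logre /sqn.
  suff -> : expR (- (al * ln n.+2%:R + be)) =
    expR (- be) * (@harmonic R n.+1) `^ al by [].
  rewrite opprD addrC expRD; congr (_ * _).
  by rewrite /powR gt_eqF ?harmonic_gt0// /harmonic/= lnV ?posrE ?ltr0n// mulrN.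
apply: (@continuous_seq _ G).
  have h : 0 < 1 + 2 * (0 * cos q) + 0 * 0 by rewrite !mul0r mulr0 !addr0.
  by rewrite /G; contl.
rewrite -(mulr0 (expR (- be))); apply: cvgMr.
have := harmonic_powR_cvg0 al0.
by rewrite -(cvg_shiftS (fun n => (@harmonic R n) `^ al)).
Qed.

Let u_homo : {homo (fun n => 1 + @harmonic R n) : m n / (m <= n)%N >-> n <= m}.
Proof. by move=> m n mn; rewrite lerD2l harmonic_homo. Qed.
Let w_homo : {homo (fun n => n.+2%:R : R) : m n / (m <= n)%N >-> m <= n}.
Proof. by move=> m n mn; rewrite ler_nat. Qed.
Let uw n : 1 + @harmonic R n <= n.+2%:R.
Proof. by rewrite -natr1 addrC lerD// (le_trans (harmonic_le1 _))// ler1n. Qed.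

Let mT q : measurable_fun setT (T q : measurableTypeR R -> R).
Proof. by rewrite /T; meas. Qed.

(** At q = 0 the integrand is positive and its primitive gives integrability; every other angle is
    dominated by that case, by [recip_bound]. *)
Let tail_integrable q : `|q| < pi ->
  leb.-integrable (`]1, +oo[%classic : set (measurableTypeR R)) (EFin \o T q).
Proof.
move=> hq; have h0 : `|0 : R| < pi by rewrite normr0 pi_gt0.
have E t : T 0 t = t^-1 / (1 + expR (al * ln t + be)).
  rewrite /T /dlogre /sqn cos0 !mulr1; set e := expR _; have e0 : 0 < e := expR_gt0 _.
  have -> : 1 + 2 * e + e * e = (1 + e) ^+ 2 by ring.
  by congr (_ * _); field; rewrite gt_eqF// addr_gt0.
have T0_ge0 x : 1 < x -> 0 <= T 0 x.
  move=> x1; rewrite E; apply: divr_ge0; first by rewrite invr_ge0; lra.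
  by apply: addr_ge0 => //; exact: expR_ge0.
have i0 : leb.-integrable (`]1, +oo[%classic : set (measurableTypeR R)) (EFin \o T 0).
  apply: (@integrable_of_finite _ _ _ (0 - Fq 0 1)).
  - by apply: measurable_funTS; exact: mT.
  - by move=> x /=; rewrite in_itv/= andbT; exact: T0_ge0.
  - apply: (@ge0_FTC_exhaust _ (T 0) (Fq 0) _ _ _ _ _ u_homo w_homo uw itv1yE).
    + by move=> x /=; rewrite in_itv/= andbT; exact: T0_ge0.
    + by apply: measurable_funTS; exact: mT.
    + by move=> x /=; rewrite in_itv/= andbT => x1; apply: cT => //; exact: lt_trans x1.
    + by move=> x /=; rewrite in_itv/= andbT => x1; apply: dF => //; exact: lt_trans x1.
    + exact: F1.
    + exact: Foo.
have c0 := half_gt0 hq.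
apply: (@le_integrable _ _ _ leb _ _ (EFin \o T q)
  (fun t => ((cos (q / 2))^-1%:E * (EFin \o T 0) t)%E)).
- exact: measurable_itv.
- by apply/measurable_EFinP; apply: measurable_funTS; exact: mT.
- move=> t /=; rewrite in_itv/= andbT => t1; have t0 : 0 < t by lra.
  rewrite lee_fin E /T normrM gtr0_norm ?invr_gt0// [leRHS]ger0_norm; last first.
    by rewrite mulr_ge0 ?invr_ge0 ?(ltW c0)// divr_ge0 ?invr_ge0 ?(ltW t0)// addr_ge0 ?expR_ge0.
  rewrite mulrCA ler_pM2l ?invr_gt0//.
  by have [h _] := recip_bound (al * ln t + be) hq.
- exact: integrableZl.
Qed.

Let tail_integral q : `|q| < pi ->
  (\int[leb]_(t in `]1%R, +oo[) (T q t)%:E = (al^-1 * logre (- be) q)%:E)%E.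
Proof.
move=> hq; have -> : al^-1 * logre (- be) q = 0 - Fq q 1.
  by rewrite /Fq ln1 mulr0 add0r opprK add0r.
apply: (@FTC_exhaust _ (T q) (Fq q) _ _ _ _ _ u_homo w_homo uw itv1yE).
- exact: tail_integrable.
- by move=> x /=; rewrite in_itv/= andbT => x1; apply: cT => //; exact: lt_trans x1.
- by move=> x /=; rewrite in_itv/= andbT => x1; apply: dF => //; exact: lt_trans x1.
- exact: F1.
- exact: Foo.
Qed.

Let D : set (measurableTypeR R) := `]0, +oo[%classic.
Let T1 q (t : R) : R := \1_(`]1, +oo[%classic : set R) t * (pi * T q t).

Let T1_spec q : `|q| < pi -> leb.-integrable D (EFin \o T1 q) /\
  (\int[leb]_(t in D) (T1 q t)%:E = (pi / al * logre (- be) q)%:E)%E.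
Proof.
move=> hq; have mD : measurable D by exact: measurable_itv.
have m1 : measurable (`]1, +oo[%classic : set (measurableTypeR R)) by exact: measurable_itv.
have sub : D `&` `]1, +oo[%classic = `]1, +oo[%classic :> set R.
  by apply/setIidr => x; rewrite /D/= !in_itv/= !andbT; exact: lt_trans.
have E : EFin \o T1 q = (fun t => (pi%:E * (EFin \o T q) t)%E) \_ `]1, +oo[.
  apply/funext => t; rewrite /= patchE /T1 indicE.
  by case: ifPn => _; rewrite ?mul1r ?mul0r// EFinM.
have i1 : leb.-integrable (`]1, +oo[%classic : set (measurableTypeR R))
    (fun t => (pi%:E * (EFin \o T q) t)%E).
  by apply: integrableZl => //; exact: tail_integrable.
split; first by rewrite E; apply/integrable_restrict => //; rewrite sub.
transitivity (\int[leb]_(t in D) (EFin \o T1 q) t)%E; first by [].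
rewrite E -integral_mkcondr sub integralZl//; last exact: tail_integrable.
by rewrite tail_integral// -EFinM mulrA.
Qed.

Let alpi : `|al * pi| < pi.
Proof. by rewrite ger0_norm ?mulr_ge0 ?pi_ge0 ?(ltW al0)// gtr_pMl// pi_gt0. Qed.

(** [log_kernel_integral] presents a logarithmic term and the tail term as a difference with
    integral 0; this reads off one from the other. *)
Let from_zero (f g : R -> R) (l : R) : leb.-integrable D (EFin \o g) ->
  (\int[leb]_(t in D) (g t)%:E = l%:E)%E ->
  leb.-integrable D (EFin \o (fun t => g t - f t)) ->
  (\int[leb]_(t in D) (g t - f t)%:E = 0)%E ->
  leb.-integrable D (EFin \o f) /\ (\int[leb]_(t in D) (f t)%:E = l%:E)%E.
Proof.
have mD : measurable D by exact: measurable_itv.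
move=> ig Ig ih Ih.
have fE t : (f t)%:E = ((g t)%:E - (g t - f t)%:E)%E.
  by rewrite -EFinB opprB addrC subrK.
have if_ : leb.-integrable D (EFin \o f).
  apply: eq_integrable (integrableB mD ig ih) => // t _.
  by rewrite /= fE.
split=> //; under eq_integral do rewrite fE.
by rewrite (integralB mD ig ih) Ig Ih sube0.
Qed.

(** The case sigma = 0. Up to the factor 1/pi, t^-1 [dlogim] (al ln t + be) (al pi) is the density
    of Z = e^(- be/al) X_al, so this is pi E log (1 + Z). *)
Lemma log_integral_plus :
  leb.-integrable D (EFin \o (fun t => t^-1 * dlogim (al * ln t + be) (al * pi) * ln (1 + t))) /\
  (\int[leb]_(t in D) (t^-1 * dlogim (al * ln t + be) (al * pi) * ln (1 + t))%:E =
   (pi / al * ln (1 + expR (- be)))%:E)%E.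
Proof.
have h0 : `|0 : R| < pi by rewrite normr0 pi_gt0.
have [i1 I1] := T1_spec h0; rewrite logre0 in I1.
have [i2 I2] := log_kernel_integral be al0 al1 (or_introl (erefl : (0 : R) = 0)).
apply: (from_zero i1 I1); [apply: eq_integrable i2 => //|rewrite -[RHS]I2; apply: eq_integral].
all: move=> t _ /=; congr (_%:E); rewrite /T1 /T !addr0 mulr0 dlogim0 mul0r addr0.
all: by move: (dlogim _ _) (dlogre _ _) (\1_ _) (ln (1 + t)) => x1 x2 x3 x4; ring.
Qed.

(** The case sigma = - pi. The angle at p = 0 is - al pi, and the oddness of [dlogim] restores the
    same density. *)
Lemma log_integral_minus :
  leb.-integrable D (EFin \o (fun t => t^-1 * dlogim (al * ln t + be) (al * pi) * ln `|1 - t|)) /\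
  (\int[leb]_(t in D) (t^-1 * dlogim (al * ln t + be) (al * pi) * ln `|1 - t|)%:E =
   (pi / al * logre (- be) (al * pi))%:E)%E.
Proof.
have [i1 I1] := T1_spec alpi.
have [i2 I2] := log_kernel_integral be al0 al1 (or_intror (erefl : - pi = - pi :> R)).
apply: (from_zero i1 I1); [apply: eq_integrable i2 => //|rewrite -[RHS]I2; apply: eq_integral].
all: move=> t _ /=; congr (_%:E); rewrite /T1 /T subrr sub0r mulr0 dlogim0 oppr0 mul0r add0r.
all: rewrite mulrN dlogimN dlogreN.
all: by move: (dlogim _ _) (dlogre _ _) (\1_ _) (ln `|1 - t|) => x1 x2 x3 x4; ring.
Qed.

End log_integrals.

(** * Change of scale on (0, oo) *)

Section scaling.
Context {R : realType}.
Local Notation leb := (@lebesgue_measure R).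
Variable c : R.
Hypothesis c0 : 0 < c.

Let s (t : measurableTypeR R) : measurableTypeR R := c * t.
Let ms : measurable_fun setT s. Proof. exact: mulrl_measurable. Qed.
Let sleb : {measure set (measurableTypeR R) -> \bar R} :=
  measure_function_pushforward__canonical__measure_function_Measure leb ms.
Let cn : {nonneg R} := NngNum (ltW c0).

(** Lebesgue measure is determined by its values on half-open intervals, where the pushforward
    multiplied by c agrees with it. *)
Let lebesgue_scale (A : set (measurableTypeR R)) : measurable A ->
  (leb A = c%:E * leb (s @^-1` A))%E.
Proof.
move=> mA.
rewrite (@lebesgue_measure_unique R (mscale cn sleb))//.
move=> _ [[a b] /= ab <-]; rewrite /mscale/= /pushforward/=.
have -> : s @^-1` `]a, b]%classic = `](a / c), (b / c)]%classic.
  by apply/seteqP; split => x /=; rewrite !in_itv/= ltr_pdivrMr// ler_pdivlMr// mulrC.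
rewrite !lebesgue_measure_itv/= !lte_fin ltr_pM2r ?invr_gt0//.
case: ifP => _; last by rewrite mule0.
by rewrite -!EFinB -EFinM -mulrBl mulrC divfK// gt_eqF.
Qed.

Let D : set (measurableTypeR R) := `]0, +oo[%classic.

Lemma ge0_integral_scale (f : measurableTypeR R -> \bar R) :
  measurable_fun D f -> (forall x, D x -> (0 <= f x)%E) ->
  (\int[leb]_(x in D) f x = \int[leb]_(t in D) (c%:E * f (c * t)%R))%E.
Proof.
move=> mf f0; have mD : measurable D by exact: measurable_itv.
have sD : s @^-1` D = D.
  by apply/seteqP; split => x; rewrite /D/= !in_itv/= !andbT pmulr_rgt0.
have msD : measurable_fun D (f \o s).
  apply: (measurable_comp mD _ mf); last exact: measurable_funTS.
  by move=> _ [x Dx <-]; move: Dx; rewrite -{1}sD.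
transitivity (\int[mscale cn sleb]_(x in D) f x)%E.
  by apply: eq_measure_integral => A mA _; first [exact: (lebesgue_scale mA)|exact: (esym (lebesgue_scale mA))].
rewrite ge0_integral_mscale//.
have := @ge0_integral_pushforward _ _ _ _ R s ms leb D f mD mf.
rewrite -/(sleb : set (measurableTypeR R) -> \bar R) => -> //; last first.
  by move=> x /[!inE]; exact: f0.
rewrite sD ge0_integralZl//.
  by move=> x; rewrite -{1}sD; exact: f0.
by rewrite lee_fin ltW.
Qed.

(** The positive and negative parts of f are scaled separately, so divergent integrals are
    included. *)
Lemma integral_scale (f : measurableTypeR R -> R) : measurable_fun D f ->
  (\int[leb]_(x in D) (f x)%:E = \int[leb]_(t in D) (c * f (c * t))%:E)%E.
Proof.
move=> mf; have mf' : measurable_fun D (EFin \o f) by exact/measurable_EFinP.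
rewrite integralE [RHS]integralE.
rewrite ge0_integral_scale; [|exact: measurable_funepos|by []].
rewrite [X in (_ - X)%E]ge0_integral_scale; [|exact: measurable_funeneg|by []].
congr (_ - _)%E; apply: eq_integral => x _; rewrite ?funeposE ?funenegE.
- by rewrite maxeMr ?lee_fin ?(ltW c0)// mule0 EFinM.
- by rewrite maxeMr ?lee_fin ?(ltW c0)// mule0 muleN EFinM.
Qed.

Lemma integrable_scale (f : measurableTypeR R -> R) : measurable_fun D f ->
  leb.-integrable D (EFin \o (fun t => c * f (c * t))) -> leb.-integrable D (EFin \o f).
Proof.
move=> mf /integrableP[_ h]; apply/integrableP; split; first exact/measurable_EFinP.
have mn : measurable_fun D (fun x => `|(f x)%:E|)%E.
  by apply/measurable_EFinP; apply: (measurableT_comp _ mf); exact: normr_measurable.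
rewrite (ge0_integral_scale mn)//; apply: le_lt_trans h.
rewrite le_eqVlt; apply/orP; left; apply/eqP; apply: eq_integral => x _ /=.
by rewrite normrM EFinM gtr0_norm.
Qed.

End scaling.

(** * The law of X_al r^(1/al) *)

Section ratio_density.
Context {R : realType}.
Local Notation leb := (@lebesgue_measure R).
Variable al : R.
Hypotheses (al0 : 0 < al) (al1 : al < 1).
Implicit Types r x y lam : R.

Let D : set (measurableTypeR R) := `]0, +oo[%classic.
Let mD : measurable D. Proof. exact: measurable_itv. Qed.
Let alpi : `|al * pi| < pi.
Proof. by rewrite ger0_norm ?mulr_ge0 ?pi_ge0 ?(ltW al0)// gtr_pMl// pi_gt0. Qed.
Let alpi0 : 0 < al * pi. Proof. by rewrite mulr_gt0// pi_gt0. Qed.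
Let pi0 : 0 < pi :> R. Proof. exact: pi_gt0. Qed.

(** The density of X_al r^(1/al) as (pi y)^-1 Im (E / (1 + E)) with E = y^al e^(i al pi) / r. In
    this form it is visibly the derivative of an argument, [logim] / (al pi). *)
Definition ratio_density r y := pi^-1 * (y^-1 * dlogim (al * ln y - ln r) (al * pi)).

Lemma ratio_densityE r y : 0 < r -> 0 < y ->
  sin (pi * al) / pi * rho_kernel al y r = ratio_density r y.
Proof.
move=> r0 y0; rewrite /ratio_density /rho_kernel /dlogim /sqn.
rewrite [pi * al]mulrC; set p := al * pi.
have Ea : expR (al * ln y - ln r) = y `^ al / r.
  by rewrite expRD expRN lnK ?posrE// /powR gt_eqF.
have E1 : y `^ (al - 1) = y `^ al / y by rewrite /powR gt_eqF// mulrBl mul1r expRD expRN lnK.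
have E2 : y `^ (2 * al) = y `^ al * y `^ al.
  by rewrite /powR gt_eqF// -expRD; congr expR; ring.
rewrite Ea E1 E2; have Y0 : 0 < y `^ al by rewrite powR_gt0.
have N0 : 1 + 2 * (y `^ al / r * cos p) + y `^ al / r * (y `^ al / r) != 0.
  by rewrite -Ea gt_eqF// (sqn_gt0 _ alpi).
have p0 := pi0; move: N0; move: (y `^ al) Y0 (cos p) (sin p) => Y Y0 c s.
have -> : 1 + 2 * (Y / r * c) + Y / r * (Y / r) = (Y * Y + 2 * Y * r * c + r ^+ 2) / (r * r).
  by field; rewrite gt_eqF.
rewrite mulf_eq0 negb_or => /andP[N0 _]; move: (@pi R) p0 => P P0; field.
by rewrite N0 !gt_eqF.
Qed.

Lemma rho_ratio_density y : 0 < y -> rho al y = ratio_density 1 y.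
Proof.
move=> y0; rewrite -ratio_densityE// /rho /rho_kernel [pi * al]mulrC.
by rewrite !mulr1 expr1n.
Qed.

Lemma ratio_density_ge0 r y : 0 < y -> 0 <= ratio_density r y.
Proof.
move=> y0; rewrite /ratio_density; have N := sqn_gt0 (al * ln y - ln r) alpi.
apply: mulr_ge0; [by rewrite invr_ge0 ltW|apply: mulr_ge0; first by rewrite invr_ge0 ltW].
apply: divr_ge0; last exact: ltW.
apply: mulr_ge0; first exact: expR_ge0.
apply: sin_ge0_pi; rewrite ltW//=; apply: ltW.
by move: alpi; rewrite gtr0_norm.
Qed.

Lemma measurable_ratio_density d (T : measurableType d) (A : set T)
    (f g : T -> measurableTypeR R) : measurable_fun A f -> measurable_fun A g ->
  measurable_fun A (fun t => ratio_density (f t) (g t) : measurableTypeR R).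
Proof. by move=> mf mg; rewrite /ratio_density; meas. Qed.

Let mrd (A : set (measurableTypeR R)) r :
  measurable_fun A (ratio_density r : measurableTypeR R -> measurableTypeR R).
Proof. by apply: measurable_ratio_density; meas. Qed.

Lemma logim_ln_cvg0 (c a p : R) : 0 < c -> 0 < a -> `|p| < pi ->
  logim (ln (c * (@harmonic R n) `^ a)) p @[n --> \oo] --> 0.
Proof.
move=> c0 a0 hp.
(* [logim] as a function of E = e^x, which extends continuously to E = 0 with value p/2 - p/2 =
   0. *)
pose G (E : R) : R := p / 2 + atan (tan (p / 2) * ((E - 1) / (E + 1))).
have hp2 : `|p / 2| < pi / 2 by rewrite normrM (@gtr0_norm _ 2^-1)// ltr_pM2r.
have G0 : G 0 = 0.
  rewrite /G !add0r divr1 mulrN1 -tanN tanK; first by rewrite subrr.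
  by rewrite in_itv/= -ltr_norml normrN.
rewrite -G0.
have -> : (fun n => logim (ln (c * (@harmonic R n) `^ a)) p) =
    (fun n => G (c * (@harmonic R n) `^ a)).
  apply/funext => n; rewrite /logim /G lnK// posrE mulr_gt0// powR_gt0//.
  exact: harmonic_gt0.
apply: (@continuous_seq _ G).
  have h : (0 : R) + 1 != 0 by rewrite add0r oner_eq0.
  by rewrite /G; contl.
by rewrite -(mulr0 c); apply: cvgMr; exact: harmonic_powR_cvg0.
Qed.

Let Fp r y := (al * pi)^-1 * logim (al * ln y - ln r) (al * pi).

Let dFp r y : 0 < y -> is_derive y 1 (Fp r) (ratio_density r y).
Proof.
move=> y0; have yN0 : y != 0 by rewrite gt_eqF.
rewrite /Fp /ratio_density; derl; rewrite /=.
have p0 := pi0; move: (dlogim _ _) (logim _ _) => z w.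
by move: (@pi R) p0 => P P0; field; rewrite yN0 !gt_eqF.
Qed.

Let crd r y : 0 < y -> {for y, continuous (ratio_density r)}.
Proof. by move=> y0; have yN0 : y != 0; [rewrite gt_eqF|rewrite /ratio_density; contl]. Qed.

Let Fp0 r x : 0 < r -> 0 < x -> Fp r (x * harmonic n) @[n --> \oo] --> 0.
Proof.
move=> r0 x0; rewrite -(mulr0 (al * pi)^-1); apply: cvgMr.
have -> : (fun n => logim (al * ln (x * harmonic n) - ln r) (al * pi)) =
   (fun n => logim (ln (x `^ al / r * (@harmonic R n) `^ al)) (al * pi)).
  apply/funext => n; have h0 := @harmonic_gt0 R n; congr logim.
  rewrite !lnM ?posrE ?mulr_gt0 ?powR_gt0 ?invr_gt0// lnV ?posrE// !ln_powR.
  by ring.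
by apply: logim_ln_cvg0 => //; rewrite divr_gt0// powR_gt0.
Qed.

(** The reflection turns the limit at infinity into the one at 0, which leaves the total mass al pi
    / (al pi). *)
Let Fpoo r : 0 < r -> Fp r n.+1%:R @[n --> \oo] --> (1 : R).
Proof.
move=> r0; rewrite -[X in _ --> X](_ : (al * pi)^-1 * (al * pi - 0) = 1); last by rewrite subr0 mulVf// gt_eqF.
apply: cvgMr.
have -> : (fun n => logim (al * ln n.+1%:R - ln r) (al * pi)) =
   (fun n => al * pi - logim (ln (r * (@harmonic R n) `^ al)) (al * pi)).
  apply/funext => n; rewrite -logim_reflect; congr logim.
  by rewrite lnM ?posrE ?powR_gt0 ?harmonic_gt0// ln_powR lnV ?posrE ?ltr0n//; ring.
by apply: cvgB; [exact: cvg_cst|exact: logim_ln_cvg0].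
Qed.

(** The distribution function of X_al r^(1/al), written with the argument [logim] in place of an
    inverse cotangent. *)
Lemma integral_ratio_density_le r x : 0 < r -> 0 < x ->
  (\int[leb]_(y in `]0%R, x]) (ratio_density r y)%:E =
   ((al * pi)^-1 * logim (al * ln x - ln r) (al * pi))%:E)%E.
Proof.
move=> r0 x0; rewrite -[in RHS](subr0 (_ * logim _ _)).
apply: (@ge0_FTC_exhaust _ (ratio_density r) (Fp r) (fun n => x * harmonic n)
  (fun=> x) _ _ _ _ _ _ (itv0xE x0)).
- by move=> m n mn; rewrite ler_pM2l// harmonic_homo.
- by [].
- by move=> n; rewrite ler_piMr ?(ltW x0)// harmonic_le1.
- by move=> y /=; rewrite in_itv/= => /andP[y0 _]; exact: ratio_density_ge0.
- exact: mrd.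
- by move=> y /=; rewrite in_itv/= => /andP[y0 _]; exact: crd.
- by move=> y /=; rewrite in_itv/= => /andP[y0 _]; exact: dFp.
- exact: Fp0.
- exact: cvg_cst.
Qed.

Lemma integral_ratio_density r : 0 < r ->
  (\int[leb]_(y in D) (ratio_density r y)%:E = 1)%E.
Proof.
move=> r0; rewrite -[in RHS](subr0 1).
apply: (@ge0_FTC_exhaust _ (ratio_density r) (Fp r) (@harmonic R)
  (fun n => n.+1%:R) _ _ _ harmonic_homo succ_homo _ itv0yE).
- by move=> n; rewrite (le_trans (harmonic_le1 _))// ler1n.
- by move=> y /=; rewrite in_itv/= andbT => y0; exact: ratio_density_ge0.
- exact: mrd.
- by move=> y /=; rewrite in_itv/= andbT => y0; exact: crd.
- by move=> y /=; rewrite in_itv/= andbT => y0; exact: dFp.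
- by have := Fp0 r0 ltr01; under eq_fun do rewrite mul1r.
- exact: Fpoo.
Qed.

Lemma integrable_ratio_density r : 0 < r ->
  leb.-integrable D (EFin \o ratio_density r).
Proof.
move=> r0; apply: (@integrable_of_finite _ _ _ 1).
- exact: mrd.
- by move=> y; rewrite /D /=; rewrite in_itv/= andbT => y0; exact: ratio_density_ge0.
- exact: integral_ratio_density.
Qed.

Let scaleE (c r t : R) : 0 < c -> 0 < t ->
  c * ratio_density r (c * t) =
  pi^-1 * (t^-1 * dlogim (al * ln t + (al * ln c - ln r)) (al * pi)).
Proof.
move=> c0 t0; rewrite /ratio_density lnM ?posrE//.
have -> : al * (ln c + ln t) - ln r = al * ln t + (al * ln c - ln r) by ring.
have p0 := pi0; move: (dlogim _ _) => z; move: (@pi R) p0 => P P0.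
by field; rewrite !gt_eqF.
Qed.

(** Scaling y = t / lam turns it into [log_integral_plus] with be = - al ln lam - ln r. *)
Lemma log1p_ratio_density r lam : 0 < r -> 0 < lam ->
  leb.-integrable D (EFin \o (fun y => ratio_density r y * ln (1 + lam * y))) /\
  (\int[leb]_(y in D) (ratio_density r y * ln (1 + lam * y))%:E =
   (al^-1 * ln (1 + lam `^ al * r))%:E)%E.
Proof.
move=> r0 l0; have li0 : 0 < lam^-1 by rewrite invr_gt0.
have [i1 I1] := log_integral_plus (al * ln lam^-1 - ln r) al0 al1.
have mf (A : set (measurableTypeR R)) : measurable_fun A
  (fun y => ratio_density r y * ln (1 + lam * y) : measurableTypeR R).
  by have := @mrd A r => ?; meas.
have E t : t \in D -> (lam^-1 * (ratio_density r (lam^-1 * t) * ln (1 + lam * (lam^-1 * t))))%:E =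
  (pi^-1%:E * (t^-1 * dlogim (al * ln t + (al * ln lam^-1 - ln r)) (al * pi) * ln (1 + t))%:E)%E.
  rewrite inE/D/= in_itv/= andbT => t0; rewrite mulrA scaleE// mulVKf ?gt_eqF//.
  by rewrite -EFinM; congr EFin; ring.
have i2 := integrableZl mD pi^-1 i1.
split.
- apply: (integrable_scale li0 (mf D)); apply: eq_integrable i2 => // t tD /=.
  by rewrite E.
- rewrite (integral_scale li0 (mf D)) (eq_integral _ _ E) (integralZl mD i1) I1 -EFinM.
  congr EFin; have -> : expR (- (al * ln lam^-1 - ln r)) = lam `^ al * r.
    rewrite opprB addrC expRD lnK ?posrE// lnV ?posrE// mulrN opprK.
    by rewrite /powR gt_eqF.
  have p0 := pi0; move: (ln _) => L; move: (@pi R) p0 => P P0.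
  by field; rewrite !gt_eqF.
Qed.

(** Scaling y = x t and ln |x - y| = ln x + ln |1 - t| reduce it to [log_integral_minus] and the
    total mass. *)
Lemma lnabs_ratio_density r x : 0 < r -> 0 < x ->
  leb.-integrable D (EFin \o (fun y => ratio_density r y * ln `|x - y|)) /\
  (\int[leb]_(y in D) (ratio_density r y * ln `|x - y|)%:E =
   (ln x + al^-1 * logre (ln r - al * ln x) (al * pi))%:E)%E.
Proof.
move=> r0 x0.
have [i1 I1] := log_integral_minus (al * ln x - ln r) al0 al1.
have mf (A : set (measurableTypeR R)) : measurable_fun A
  (fun y => ratio_density r y * ln `|x - y| : measurableTypeR R).
  by have := @mrd A r => ?; meas.
have i0 := integrable_ratio_density r0.
have ms : measurable_fun D (fun t : measurableTypeR R => x * ratio_density r (x * t) : measurableTypeR R).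
  by apply: measurable_fun_mul; [meas|apply: measurable_ratio_density; meas].
have E0 : (\int[leb]_(t in D) (x * ratio_density r (x * t))%:E = 1)%E.
  by rewrite -(integral_scale x0 (@mrd D r)) integral_ratio_density.
have j0 : leb.-integrable D (EFin \o (fun t => x * ratio_density r (x * t))).
  apply: (integrable_of_finite ms _ E0) => t; rewrite /D/= in_itv/= andbT => t0.
  by rewrite mulr_ge0 ?(ltW x0)// ratio_density_ge0// mulr_gt0.
pose g t := x * ratio_density r (x * t) * ln x +
  pi^-1 * (t^-1 * dlogim (al * ln t + (al * ln x - ln r)) (al * pi) * ln `|1 - t|).
have jx := integrableZl mD (ln x) j0.
have i2 := integrableZl mD pi^-1 i1.
have gE t : (g t)%:E = ((ln x)%:E * (x * ratio_density r (x * t))%:E +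
   pi^-1%:E * (t^-1 * dlogim (al * ln t + (al * ln x - ln r)) (al * pi) * ln `|1 - t|)%:E)%E.
  by rewrite -!EFinM -EFinD; congr EFin; rewrite /g; congr (_ + _); rewrite mulrC.
have ig : leb.-integrable D (EFin \o g).
  by apply: eq_integrable (integrableD mD jx i2) => // t _ /=; rewrite gE.
have Ig : (\int[leb]_(t in D) (g t)%:E = (ln x + al^-1 * logre (ln r - al * ln x) (al * pi))%:E)%E.
  under eq_integral do rewrite gE.
  rewrite (integralD mD jx i2) (integralZl mD j0) (integralZl mD i1) E0 I1.
  rewrite mule1 -EFinM -EFinD opprB; congr (_ + _)%:E.
  have p0 := pi0; move: (logre _ _) => L; move: (@pi R) p0 => P P0.
  by field; rewrite !gt_eqF.
have mg : measurable_fun D (EFin \o g) by case/integrableP: ig.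
have ms2 : measurable_fun D (fun t : measurableTypeR R => x * (ratio_density r (x * t) * ln `|x - x * t|) : measurableTypeR R).
  apply: measurable_fun_mul; first by meas.
  by apply: measurable_fun_mul; [apply: measurable_ratio_density; meas|meas].
(* At t = 1 the two sides differ: by the convention ln 0 = 0 one is 0 while the other keeps a term
   in ln x. A single point is negligible. *)
have ae : ae_eq leb D (EFin \o g) (EFin \o (fun t => x * (ratio_density r (x * t) * ln `|x - x * t|))).
  exists [set 1]; split; [exact: measurable_set1|exact: lebesgue_measure_set1|].
  move=> t /= nP; apply: contrapT => t1; apply: nP; rewrite /D/= in_itv/= andbT => t0.
  have tN1 : 1 - t != 0 by rewrite subr_eq0 eq_sym; apply/eqP.
  have -> : x - x * t = x * (1 - t) by ring.
  rewrite normrM (gtr0_norm x0) lnM ?posrE ?normr_gt0//; congr EFin.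
  have sE := scaleE r x0 t0; rewrite /g.
  transitivity (x * ratio_density r (x * t) * ln x + x * ratio_density r (x * t) * ln `|1 - t|); last by ring.
  by congr (_ + _); rewrite sE !mulrA.
split.
- apply: (integrable_scale x0 (mf D)); apply/integrableP; split; first exact/measurable_EFinP.
  case/integrableP: ig => _; apply: le_lt_trans.
  rewrite le_eqVlt; apply/orP; left; apply/eqP.
  apply: ae_eq_integral => //.
  + by apply: measurableT_comp => //; exact/measurable_EFinP.
  + by apply: measurableT_comp.
  + by apply: ae_eq_abse; exact: ae_eq_sym.
- rewrite (integral_scale x0 (mf D)) -Ig; apply: ae_eq_integral => //.
  + exact/measurable_EFinP.
  + exact: ae_eq_sym.
Qed.


(** For Z = X_al r^(1/al), differentiating [log1p_ratio_density] in lam yields E[Z / (1 + lam Z)],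
    and 1 / (1 + lam Z) = 1 - lam Z / (1 + lam Z). *)
Lemma recip_ratio_density r lam : 0 < r -> 0 < lam ->
  (\int[leb]_(y in D) (ratio_density r y * (1 + lam * y)^-1)%:E =
   ((1 + lam `^ al * r)^-1)%:E)%E.
Proof.
move=> r0 l0.
pose f x y := ratio_density r y * ln (1 + x * y).
pose df x y := ratio_density r y * ((1 + x * y)^-1 * y).
have l2 : 0 < lam / 2 by rewrite divr_gt0.
pose I : set R := `](lam / 2), (2 * lam)[%classic.
have I0 x : I x -> 0 < x by rewrite /I/= in_itv/= => /andP[+ _]; exact: lt_trans.
have Ilam : I lam by rewrite /I/= in_itv/=; apply/andP; split; lra.
have dfE x y : I x -> D y -> is_derive x 1 (f ^~ y) (df x y).
  move=> /I0 x0; rewrite /D/= in_itv/= andbT => y0.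
  have h : 0 < 1 + x * y by rewrite addr_gt0// mulr_gt0.
  by rewrite /f /df; derl; rewrite /=; move: (ratio_density r y) => z; ring.
have d1E x y : I x -> D y -> partial1of2 f x y = df x y.
  by move=> Ix Dy; rewrite partial1of2E; have [_ ->] := dfE x y Ix Dy.
(* On the window [I], y / (1 + x y) <= 1/x <= 2/lam. *)
pose G y := 2 / lam * `|ratio_density r y|.
have i0 := integrable_ratio_density r0.
have iG : leb.-integrable D (EFin \o G).
  by apply: eq_integrable (integrableZl mD (2 / lam) (integrable_abse i0)).
have Gb x y : I x -> D y -> `|partial1of2 f x y| <= G y.
  move=> Ix Dy; rewrite d1E//; have x0 := I0 _ Ix; move: Ix Dy.
  rewrite /I/D/= !in_itv/= andbT => /andP[xl _] y0.
  rewrite /df /G normrM mulrC ler_wpM2r//.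
  have h : 0 < 1 + x * y by rewrite addr_gt0// mulr_gt0.
  rewrite ger0_norm; last by rewrite mulr_ge0 ?invr_ge0 ?ltW.
  rewrite ler_pdivrMl// mulrA ler_pdivlMr//.
  by have : 0 < y * (x - lam / 2) by [rewrite mulr_gt0// subr_gt0]; lra.
pose F x : R := \int[leb]_(y in D) f x y.
have FE x : 0 < x -> F x = al^-1 * ln (1 + x `^ al * r).
  by move=> x0; rewrite /F /Rintegral /f; have [_ ->] := log1p_ratio_density r0 x0.
have dF : is_derive lam 1 F (al^-1 * ((1 + lam `^ al * r)^-1 * (lam^-1 * (al * lam `^ al * r)))).
  apply: (@near_eq_is_derive _ _ _ (fun x => al^-1 * ln (1 + expR (al * ln x) * r))).
    have : \forall x \near lam, x \in `](lam / 2), (2 * lam)[.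
      by apply: near_in_itvoo; rewrite in_itv.
    apply: filterS => x Ix; have x0 : 0 < x by apply: I0; exact: Ix.
    by rewrite FE// /powR gt_eqF.
  have h : 0 < 1 + expR (al * ln lam) * r by rewrite addr_gt0// mulr_gt0// expR_gt0.
  derl; rewrite /= /powR gt_eqF//; move: (ln lam) (expR _) h => L E h.
  by field; rewrite !gt_eqF.
have key := @differentiation_under_integral _ _ _ leb f D mD lam _ _ Ilam
  (fun x Ix => (log1p_ratio_density r0 (I0 x Ix)).1)
  (fun x y Ix Dy => @ex_derive _ _ _ _ _ _ _ (dfE x y Ix Dy)) G
  (fun y => mulr_ge0 (ltW (divr_gt0 (ltr0Sn R 1) l0)) (normr_ge0 _)) iG Gb.
move: key; rewrite derive1E; have [_ ->] := dF.
have dI : {in D, partial1of2 f lam =1 df lam} by move=> y /set_mem Dy; exact: d1E.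
rewrite (eq_Rintegral _ dI) => key.
have idf : leb.-integrable D (EFin \o df lam).
  apply: (le_integrable mD _ _ iG).
    apply/measurable_EFinP; apply: measurable_fun_mul; first exact: mrd.
    by meas.
  by move=> y Dy; rewrite /= lee_fin -d1E// (le_trans (Gb _ _ Ilam Dy))// ler_norm.
have E (y : measurableTypeR R) : y \in D -> (ratio_density r y * (1 + lam * y)^-1)%:E =
    ((ratio_density r y)%:E - lam%:E * (df lam y)%:E)%E.
  rewrite inE/D/= in_itv/= andbT => y0.
  have h : 1 + lam * y != 0 by rewrite gt_eqF// addr_gt0// mulr_gt0.
  rewrite -EFinB /df; congr EFin; move: (ratio_density r y) => z.
  by field.
rewrite (eq_integral _ _ E) (integralB mD i0 (integrableZl mD lam idf)).
rewrite (integralZl mD idf) integral_ratio_density//.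
have -> : (\int[leb]_(y in D) (df lam y)%:E)%E =
  (al^-1 * ((1 + lam `^ al * r)^-1 * (lam^-1 * (al * lam `^ al * r))))%:E.
  by rewrite key fineK//; exact: (integrable_fin_num mD idf).
have h : 0 < 1 + lam `^ al * r by rewrite addr_gt0// mulr_gt0// powR_gt0.
rewrite -EFinB; congr EFin.
move: (lam `^ al) h => L h.
by field; rewrite !gt_eqF.
Qed.

End ratio_density.

(** * Integrals over H depending on a parameter *)

Section parametric_integral.
Context {R : realType} (H : probability (measurableTypeR R) R).
Variable B : set (measurableTypeR R).
Hypothesis mB : measurable B.
Implicit Types (k dk : R -> measurableTypeR R -> R) (C u v x : R).

Lemma integrable_of_bounded (f : measurableTypeR R -> R) C : measurable_fun B f ->
  (forall y, B y -> `|f y| <= C) -> H.-integrable B (EFin \o f).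
Proof.
move=> mf fC; apply: (@le_integrable _ _ _ H B mB _ (cst C%:E)).
- exact/measurable_EFinP.
- move=> y By; rewrite /= lee_fin (le_trans (fC y By))//; exact: ler_norm.
- exact: finite_measure_integrable_cst.
Qed.

Lemma Rintegral_le_bound (f : measurableTypeR R -> R) C : 0 <= C -> measurable_fun B f ->
  (forall y, B y -> `|f y| <= C) -> `|\int[H]_(y in B) f y| <= C.
Proof.
move=> C0 mf fC; have jf := integrable_of_bounded mf fC.
rewrite (le_trans (le_normr_Rintegral mB jf))//.
rewrite (@le_trans _ _ (\int[H]_(y in B) C))//.
  apply: le_Rintegral => //; first exact: integrable_norm.
  apply: (@integrable_of_bounded _ C); first exact: measurable_cst.
  by move=> y _; rewrite ger0_norm.
rewrite Rintegral_cst// ler_piMr// -lee_fin fineK ?fin_num_measure//.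
exact: probability_le1.
Qed.

(** [H] being a probability, a constant can dominate the derivative. *)
Lemma is_derive_integral_bounded k dk C u v x : u < x < v ->
  (forall x, u < x < v -> H.-integrable B (EFin \o k x)) ->
  (forall x y, u < x < v -> B y -> is_derive x 1 (k ^~ y) (dk x y)) ->
  (forall x y, u < x < v -> B y -> `|dk x y| <= C) ->
  is_derive x 1 (fun x => \int[H]_(y in B) k x y) (\int[H]_(y in B) dk x y).
Proof.
move=> ux ik dkE dkC.
have I0 z : (`]u, v[%classic : set R) z -> u < z < v by rewrite /= in_itv.
have Ix : (`]u, v[%classic : set R) x by rewrite /= in_itv.
have d1E z y : u < z < v -> B y -> partial1of2 k z y = dk z y.
  by move=> hz By; rewrite partial1of2E; have [_ ->] := dkE z y hz By.
have iG : H.-integrable B (EFin \o cst `|C|).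
  apply: (@integrable_of_bounded _ `|C|); first exact: measurable_cst.
  by move=> y _ /=; rewrite normr_id.
have Gb z y : (`]u, v[%classic : set R) z -> B y -> `|partial1of2 k z y| <= cst `|C| y.
  by move=> /I0 hz By; rewrite d1E// (le_trans (dkC _ _ hz By))// ler_norm.
have dI : {in B, dk x =1 partial1of2 k x} by move=> y /set_mem By; rewrite d1E.
rewrite (eq_Rintegral _ dI).
apply: DeriveDef.
- exact: (@derivable_under_integral _ _ _ H k B mB x u v Ix (fun z Iz => ik z (I0 z Iz))
    (fun z y Iz By => @ex_derive _ _ _ _ _ _ _ (dkE z y (I0 z Iz) By)) _
    (fun y => normr_ge0 C) iG Gb).
- have := (@differentiation_under_integral _ _ _ H k B mB x u v Ix (fun z Iz => ik z (I0 z Iz))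
    (fun z y Iz By => @ex_derive _ _ _ _ _ _ _ (dkE z y (I0 z Iz) By)) _
    (fun y => normr_ge0 C) iG Gb).
  by rewrite derive1E.
Qed.

Lemma continuous_integral_bounded k C u v x : u < x < v ->
  (forall x, measurable_fun B (k x)) ->
  (forall x y, u < x < v -> B y -> {for x, continuous (k ^~ y)}) ->
  (forall x y, u < x < v -> B y -> `|k x y| <= C) ->
  {for x, continuous (fun x => \int[H]_(y in B) k x y)}.
Proof.
move=> ux mk ck kC.
have I0 z : (`]u, v[%classic : set R) z -> u < z < v by rewrite /= in_itv.
have ik z : (`]u, v[%classic : set R) z -> H.-integrable B (EFin \o k z).
  by move=> /I0 hz; apply: (@integrable_of_bounded _ C) => // y By; exact: kC.
have iG : H.-integrable B (EFin \o cst `|C|).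
  apply: (@integrable_of_bounded _ `|C|); first exact: measurable_cst.
  by move=> y _ /=; rewrite normr_id.
apply: (@continuity_under_integral _ _ _ H k B mB u v ik _ (cst `|C|) iG).
- by apply: aeW => y By z /set_mem/I0 hz; exact: ck.
- move=> z /I0 hz; apply: aeW => y By.
  by rewrite (le_trans (kC _ _ hz By))// ler_norm.
- by rewrite inE/= in_itv.
Qed.

End parametric_integral.

(** By Tonelli the integrals of the positive and negative parts are measurable in z, and [fine] of
    their difference is measurable whether or not they are finite. *)
Lemma measurable_fun_Rintegral (R : realType)
  (m : {sigma_finite_measure set (measurableTypeR R) -> \bar R}) (B : set (measurableTypeR R))
  (mB : measurable B) d (T : measurableType d) (k : T -> measurableTypeR R -> R) :
  measurable_fun setT (fun w : T * measurableTypeR R => k w.1 w.2 : measurableTypeR R) ->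
  measurable_fun setT (fun z => \int[m]_(y in B) k z y : measurableTypeR R).
Proof.
move=> mk; pose K (w : T * measurableTypeR R) := ((k w.1 w.2)%:E * (\1_B w.2)%:E)%E.
have mK : measurable_fun setT K.
  apply: emeasurable_funM; first exact/measurable_EFinP.
  apply/measurable_EFinP; apply: measurableT_comp; last exact: measurable_snd.
  exact: measurable_indic.
have E z : (\int[m]_(y in B) (k z y)%:E =
    \int[m]_y (K^\+ (z, y)) - \int[m]_y (K^\- (z, y)))%E.
  rewrite integral_mkcond integralE.
  have E1 : ((fun y : measurableTypeR R => (k z y)%:E) \_ B)%E = (fun y => K (z, y)).
    apply/funext => y; rewrite patchE /K/= indicE.
    by case: ifP => _; rewrite ?mule1 ?mule0.
  have -> : ((fun y : measurableTypeR R => (k z y)%:E) \_ B)^\+%E = (fun y => K^\+ (z, y))%E.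
    by apply/funext => y; rewrite !funeposE E1.
  have -> : ((fun y : measurableTypeR R => (k z y)%:E) \_ B)^\-%E = (fun y => K^\- (z, y))%E.
    by apply/funext => y; rewrite !funenegE E1.
  by [].
rewrite /Rintegral; under eq_fun do rewrite E.
apply: measurableT_comp; first exact: fine_measurable.
apply: emeasurable_funB.
- exact: (@measurable_fun_fubini_tonelli_F _ _ _ _ _ m (K^\+)%E (measurable_funepos mK) (funepos_ge0 K)).
- exact: (@measurable_fun_fubini_tonelli_F _ _ _ _ _ m (K^\-)%E (measurable_funeneg mK) (funeneg_ge0 K)).
Qed.

(** * Measures given by a density *)

Section density.
Context {R : realType}.
Local Notation leb := (@lebesgue_measure R).
Let D : set (measurableTypeR R) := `]0, +oo[%classic.
Let mD : measurable D. Proof. exact: measurable_itv. Qed.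
Variable f : R -> R.
Hypotheses (f0 : forall x, 0 < x -> 0 <= f x)
  (mf : @measurable_fun _ _ (measurableTypeR R) (measurableTypeR R) D f).

Let fD0 x : D x -> (0 <= (f x)%:E)%E.
Proof. by rewrite /D/= in_itv/= andbT lee_fin; exact: f0. Qed.

Let fD := ((EFin \o f) \_ D)%E.

Let fD_ge0 x : (0 <= fD x)%E.
Proof. by rewrite /fD patchE; case: ifPn => // /set_mem; exact: fD0. Qed.

Let mfD : measurable_fun setT fD.
Proof. by apply/(measurable_restrictT _ mD)/measurable_EFinP. Qed.

Let lawE A : measurable A -> density_law f A = (\int[leb]_(x in A) fD x)%E.
Proof. by move=> mA; rewrite /density_law integral_mkcondr. Qed.

(** [density_law] is a bare set function. The existential packs it as a measure, so that proofs
    rewrite with the equality and apply measure theory to [nu]. *)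
Lemma density_law_measure :
  exists nu : {measure set (measurableTypeR R) -> \bar R},
    density_law f = nu :> (set (measurableTypeR R) -> \bar R).
Proof.
have l0 : density_law f set0 = 0%E by rewrite /density_law set0I integral_set0.
have lge A : (0 <= density_law f A)%E.
  by apply: integral_ge0 => x [_ Dx]; exact: fD0.
have ladd : semi_sigma_additive (density_law f).
  move=> F mF tF mUF.
  have := @semi_sigma_additive_nng_induced _ _ R leb fD mfD fD_ge0 F mF tF mUF.
  rewrite -lawE//; under eq_fun do under eq_bigr do rewrite -lawE//.
  by [].
pose mix := isMeasure.Build _ _ _ (density_law f) l0 lge ladd.
pose nu : {measure set (measurableTypeR R) -> \bar R} := HB.pack (density_law f) mix.
by exists nu.
Qed.

Lemma density_law_probability : (\int[leb]_(x in D) (f x)%:E = 1)%E ->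
  exists P : probability (measurableTypeR R) R,
    density_law f = P :> (set (measurableTypeR R) -> \bar R).
Proof.
move=> f1; have [nu nuE] := density_law_measure.
have nu1 : nu setT = 1%E by rewrite -nuE /density_law setTI.
(* Normalising a measure of mass 1 does not change it and brings the structure of a probability; the
   Dirac mass is only the fallback of [mnormalize]. *)
pose P : probability (measurableTypeR R) R := mnormalize nu (dirac (0 : measurableTypeR R)).
exists P; apply/funext => A; rewrite nuE /P/= /mnormalize nu1/= onee_eq0/=.
by rewrite invr1 mule1.
Qed.

Import HBNNSimple.

(** Checked on indicators, extended by linearity to simple functions and by monotone convergence to
    h. *)
Lemma integral_density_law (B : set (measurableTypeR R)) (h : measurableTypeR R -> \bar R) :
  measurable B -> measurable_fun setT h -> (forall x, 0 <= h x)%E ->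
  (\int[density_law f]_(x in B) h x = \int[leb]_(x in B `&` D) (h x * (f x)%:E))%E.
Proof.
move=> mB mh h0; have [nu nuE] := density_law_measure; rewrite nuE.
have mhB : measurable_fun B h by exact: measurable_funTS.
pose h_ := nnsfun_approx measurableT mh.
have mh_ n A : measurable_fun A (EFin \o h_ n).
  by apply/measurable_EFinP; apply: measurable_funTS; exact/measurable_funP.
transitivity (limn (fun n => \int[nu]_(x in B) (h_ n x)%:E)%E).
  rewrite -monotone_convergence//=.
  - apply: eq_integral => x _; apply/esym/cvg_lim => //=.
    exact: cvg_nnsfun_approx.
  - by move=> n; exact: mh_.
  - by move=> n x _; rewrite lee_fin.
  - by move=> x _ a b ab; rewrite lee_fin//; exact/lefP/nd_nnsfun_approx.
have mBD : measurable (B `&` D) by exact: measurableI.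
have mfBD : measurable_fun (B `&` D) (EFin \o f).
  apply/measurable_EFinP; apply: measurable_funS mf => //.
have fBD x : (B `&` D) x -> (0 <= (f x)%:E)%E by move=> [_ /fD0].
transitivity (limn (fun n => \int[leb]_(x in B `&` D) ((h_ n x)%:E * (f x)%:E))%E); last first.
  rewrite -monotone_convergence//=.
  - apply: eq_integral => x _; apply/cvg_lim => //=.
    by apply: cvgeZr => //; exact: cvg_nnsfun_approx.
  - by move=> n; apply: emeasurable_funM => //; exact: mh_.
  - by move=> n x xBD; rewrite mule_ge0// ?lee_fin// -lee_fin; exact: fBD.
  - move=> x xBD a b ab; rewrite lee_wpmul2r//; first exact: fBD.
    by rewrite lee_fin; exact/lefP/nd_nnsfun_approx.
congr (limn _); apply/funext => n.
under eq_integral do rewrite fimfunE -fsumEFin//.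
rewrite ge0_integral_fsum//; last 2 first.
  - by move=> r; exact/measurable_EFinP/measurableT_comp.
  - by move=> r x _; rewrite EFinM nnfun_muleindic_ge0.
under [RHS]eq_integral => x xBD.
  rewrite fimfunE -fsumEFin// ge0_mule_fsuml; last by move=> r; rewrite EFinM nnfun_muleindic_ge0.
  over.
rewrite [RHS]ge0_integral_fsum//; last 2 first.
  - move=> r; apply: emeasurable_funM => //.
    exact/measurable_EFinP/measurableT_comp.
  - move=> r x xBD; rewrite mule_ge0//; last exact: fBD.
    by rewrite EFinM nnfun_muleindic_ge0.
apply: eq_fsbigr => r; rewrite inE => -[t _ <-{r}].
set A := h_ n @^-1` [set h_ n t].
have mA : measurable A by exact: measurable_sfunP.
have a0 : 0 <= h_ n t by [].
under eq_integral do rewrite EFinM.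
rewrite ge0_integralZl//.
under [RHS]eq_integral do rewrite EFinM -muleA.
rewrite [RHS]ge0_integralZl//; last 2 first.
  - by apply: emeasurable_funM => //; exact/measurable_EFinP.
  - by move=> x xBD; rewrite mule_ge0 ?lee_fin// -lee_fin; exact: fBD.
congr (_ * _)%E; rewrite integral_indic// -nuE /density_law.
rewrite (_ : A `&` B `&` D = (B `&` D) `&` A); last by rewrite -setIA setIC.
rewrite integral_mkcondr; apply: eq_integral => x _; rewrite patchE indicE.
  by case: ifP => _; rewrite ?mul1e ?mul0e.
by apply/measurable_EFinP; exact: measurable_indic.
Qed.

End density.

(** * Derivatives in polar form *)

Section polar.
Context {R : realType}.
Implicit Types (f g : R -> R) (x df dg : R).

Lemma is_derive_expR_cos f g x df dg : is_derive x 1 f df -> is_derive x 1 g dg ->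
  is_derive x 1 (fun y => expR (f y) * cos (g y))
    (df * (expR (f x) * cos (g x)) - dg * (expR (f x) * sin (g x))).
Proof.
move=> hf hg; have hf' : deriv_at f x df := hf; have hg' : deriv_at g x dg := hg.
apply: deriv_atE.
  apply: (@der_mul _ (fun y => expR (f y)) (fun y => cos (g y))).
    by apply: der_expR; exact: hf'.
  by apply: der_cos; exact: hg'.
by rewrite /=; ring.
Qed.

Lemma is_derive_expR_sin f g x df dg : is_derive x 1 f df -> is_derive x 1 g dg ->
  is_derive x 1 (fun y => expR (f y) * sin (g y))
    (df * (expR (f x) * sin (g x)) + dg * (expR (f x) * cos (g x))).
Proof.
move=> hf hg; have hf' : deriv_at f x df := hf; have hg' : deriv_at g x dg := hg.
apply: deriv_atE.
  apply: (@der_mul _ (fun y => expR (f y)) (fun y => sin (g y))).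
    by apply: der_expR; exact: hf'.
  by apply: der_sin; exact: hg'.
by rewrite /=; ring.
Qed.

Lemma is_derive_scale_sub f g x df dg (k : R) : is_derive x 1 f df -> is_derive x 1 g dg ->
  is_derive x 1 (fun y => k * f y - g y) (k * df - dg).
Proof.
move=> hf hg; have hf' : deriv_at f x df := hf; have hg' : deriv_at g x dg := hg.
apply: deriv_atE; last first.
  reflexivity.
apply: der_add; last by apply: der_opp; exact: hg'.
apply: deriv_atE; first by apply: (@der_mul _ (fun=> k) f); [exact: der_cst|exact: hf'].
by rewrite mulr0 addr0.
Qed.

End polar.

(** * Second rotation: the transform of the candidate density *)

Section log_potential.
Context {R : realType}.
Local Notation leb := (@lebesgue_measure R).
Variables (al theta lam : R) (H : probability (measurableTypeR R) R).
Hypotheses (al0 : 0 < al) (al1 : al < 1) (theta0 : 0 < theta)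
  (altheta1 : al * theta < 1) (lam0 : 0 < lam)
  (HD : H `]0, +oo[%classic = 1%E)
  (Hlog : (\int[H]_(x in `]0%R, +oo[) (ln (1 + x))%:E < +oo)%E).
Implicit Types t p r x : R.

Let D : set (measurableTypeR R) := `]0, +oo[%classic.
Let mD : measurable D. Proof. exact: measurable_itv. Qed.
Let pi0 : 0 < pi :> R. Proof. exact: pi_gt0. Qed.

(** The midpoint of al pi and pi. Letting angles go beyond al pi up to [q] makes [ok] an open
    interval around [0, pi], so that derivatives at 0 and pi are two-sided; [q] < pi keeps the
    bounds uniform, with constants [c] and [K]. *)
Let q : R := (al * pi + pi) / 2.
Let alpi : al * pi < pi. Proof. by rewrite gtr_pMl. Qed.
Let alq : al * pi < q. Proof. by have := alpi; rewrite /q; lra. Qed.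
Let qpi : q < pi. Proof. by have := alpi; rewrite /q; lra. Qed.
Let alpi0 : 0 < al * pi. Proof. exact: mulr_gt0. Qed.
Let c : R := cos (q / 2).
Let c0 : 0 < c.
Proof.
have q0 : 0 < q := lt_trans alpi0 alq.
by apply: half_gt0; rewrite gtr0_norm//; exact: qpi.
Qed.
Let K : R := c ^- 2.
Let del : R := (q - al * pi) / al.
Let ok p := - del < p < pi + del.

Let aldel : al * del = q - al * pi.
Proof. by rewrite /del mulrC divfK// gt_eqF. Qed.
Let del0 : 0 < del.
Proof. by rewrite -(pmulr_rgt0 _ al0) aldel subr_gt0; exact: alq. Qed.

Let ok_itv p : 0 <= p <= pi -> ok p.
Proof.
have d0 := del0; by move=> /andP[p0 p1]; apply/andP; split; lra.
Qed.

Let ok_bounds p : ok p -> `|- (al * p)| <= q /\ `|al * p - al * pi| <= q.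
Proof.
have -> : q = al * pi + al * del by rewrite aldel addrC subrK.
rewrite normrN !ler_norml => /andP[p1 p2].
have h1 : 0 < al * (p + del) by rewrite mulr_gt0//; lra.
have h2 : 0 < al * (pi + del - p) by rewrite mulr_gt0//; lra.
have h0 := alpi0; have d0 : 0 < al * del by rewrite mulr_gt0// del0.
by split; apply/andP; split; lra.
Qed.

Let bound_lt p : `|p| <= q -> `|p| < pi. Proof. by move=> h; apply: le_lt_trans qpi. Qed.

Let dlog_le x p : `|p| <= q -> `|dlogre x p| <= K /\ `|dlogim x p| <= K.
Proof.
move=> hp; have [h1 h2] := dlog_bound x (bound_lt hp).
have hc := cos_half_ge hp qpi.
have h : (cos (p / 2)) ^- 2 <= K.
  by rewrite /K lef_pV2 ?posrE ?exprn_gt0 ?(lt_le_trans c0)// ler_pXn2r ?nnegrE ?(ltW c0)// (le_trans (ltW c0)).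
by split; [exact: le_trans h1 h|exact: le_trans h2 h].
Qed.

Let logre_lb x p : `|p| <= q -> ln c + ln (1 + expR x) <= logre x p.
Proof.
move=> hp; apply: le_trans (logre_ge x (bound_lt hp)); rewrite lerD2r.
have hc := cos_half_ge hp qpi.
by rewrite ler_ln ?posrE; [exact: hc|exact: c0|exact: lt_le_trans c0 hc].
Qed.

Let arg t r := ln r - al * ln t.

(** [potre] + i [potim] is E log (1 + R w^(- al)) at w = t e^(ip). *)
Definition potre t p := \int[H]_(r in D) logre (arg t r) (- (al * p)).
Definition potim t p := \int[H]_(r in D) logim (arg t r) (- (al * p)).
Let Ere t p := \int[H]_(r in D) dlogre (arg t r) (- (al * p)).
Let Eim t p := \int[H]_(r in D) dlogim (arg t r) (- (al * p)).

Lemma integrable_log1p : H.-integrable D (EFin \o (fun r => ln (1 + r))).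
Proof.
apply/integrableP; split; first by apply/measurable_EFinP; meas.
apply: le_lt_trans Hlog; rewrite le_eqVlt; apply/orP; left; apply/eqP.
apply: eq_integral => x; rewrite inE/D/= in_itv/= andbT => x0.
by rewrite ger0_norm// ln_ge0// lerDl ltW.
Qed.

Let expR_arg t r : 0 < r -> expR (arg t r) = r * expR (- (al * ln t)).
Proof. by move=> r0; rewrite /arg expRD lnK. Qed.

Let ln1p_arg t r : 0 < r ->
  0 <= ln (1 + expR (arg t r)) <= ln (1 + r) + ln (1 + expR (- (al * ln t))).
Proof.
move=> r0; have w0 := expR_gt0 (- (al * ln t)); have e0 := expR_gt0 (arg t r).
rewrite ln_ge0 ?lerDl ?(ltW e0)//= expR_arg// -lnM ?posrE ?addr_gt0//.
rewrite ler_ln ?posrE ?mulr_gt0 ?addr_gt0 ?mulr_gt0//.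
by move: (expR _) w0 => w w0; nra.
Qed.

(** By 1 + r t^(- al) <= (1 + r) (1 + t^(- al)) the logarithmic moment of [H] bounds the integrand
    from above; [logre_lb] bounds it from below by ln c. *)
Lemma integrable_logre t p : `|p| <= q ->
  H.-integrable D (EFin \o (fun r => logre (arg t r) p)).
Proof.
move=> hp.
have ig : H.-integrable D (EFin \o (fun r => ln (1 + r) + (ln (1 + expR (- (al * ln t))) + `|ln c|))).
  have i2 := finite_measure_integrable_cst H (ln (1 + expR (- (al * ln t))) + `|ln c|) mD.
  by apply: eq_integrable (integrableD mD integrable_log1p i2).
apply: (le_integrable mD _ _ ig).
  by apply/measurable_EFinP; rewrite /arg; meas.
move=> r; rewrite /D/= in_itv/= andbT => r0; rewrite lee_fin.
have /andP[h1 h2] := ln1p_arg t r0.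
have b1 := logre_le (arg t r) (bound_lt hp); have b2 := logre_lb (arg t r) hp.
have n1 := ler_norm (- ln c); rewrite normrN in n1; have n2 := normr_ge0 (ln c).
rewrite [leRHS]ger0_norm; last by lra.
by rewrite ler_norml; apply/andP; split; lra.
Qed.

Let mker (k : R -> R -> R) : (forall d (T : measurableType d) (f g : T -> measurableTypeR R),
    measurable_fun setT f -> measurable_fun setT g ->
    measurable_fun setT (fun w => k (f w) (g w) : measurableTypeR R)) ->
  measurable_fun setT (fun z : measurableTypeR R * measurableTypeR R =>
    \int[H]_(r in D) k (arg z.1 r) (- (al * z.2)) : measurableTypeR R).
Proof.
move=> mk; apply: (@measurable_fun_Rintegral _ H D mD _ _ (fun z r => k (arg z.1 r) (- (al * z.2)))).
apply: mk; rewrite /arg.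
  apply: measurable_fun_add; first by meas.
  apply: measurable_fun_opp; apply: measurable_fun_mul; first by meas.
  by apply: measurable_fun_ln; apply: (measurableT_comp measurable_fst); exact: measurable_fst.
apply: measurable_fun_opp; apply: measurable_fun_mul; first by meas.
by apply: (measurableT_comp measurable_snd); exact: measurable_fst.
Qed.

Let mpotre : measurable_fun setT (fun z : measurableTypeR R * measurableTypeR R =>
  potre z.1 z.2 : measurableTypeR R).
Proof. by apply: (@mker logre) => d T f g; exact: measurable_fun_logre. Qed.
Let mpotim : measurable_fun setT (fun z : measurableTypeR R * measurableTypeR R =>
  potim z.1 z.2 : measurableTypeR R).
Proof. by apply: (@mker logim) => d T f g; exact: measurable_fun_logim. Qed.
Let mpotre_arg s : measurable_fun setT (potre s : measurableTypeR R -> measurableTypeR R).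
Proof.
apply: (@measurable_fun_Rintegral _ H D mD _ _ (fun p r => logre (arg s r) (- (al * p)))).
by rewrite /arg; meas.
Qed.
Let mpotre_mod p : measurable_fun setT (potre ^~ p : measurableTypeR R -> measurableTypeR R).
Proof.
apply: (@measurable_fun_Rintegral _ H D mD _ _ (fun s r => logre (arg s r) (- (al * p)))).
by rewrite /arg; meas.
Qed.
Let mpotim_arg s : measurable_fun setT (potim s : measurableTypeR R -> measurableTypeR R).
Proof.
apply: (@measurable_fun_Rintegral _ H D mD _ _ (fun p r => logim (arg s r) (- (al * p)))).
by rewrite /arg; meas.
Qed.
Let mpotim_mod p : measurable_fun setT (potim ^~ p : measurableTypeR R -> measurableTypeR R).
Proof.
apply: (@measurable_fun_Rintegral _ H D mD _ _ (fun s r => logim (arg s r) (- (al * p)))).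
by rewrite /arg; meas.
Qed.
Let mEre : measurable_fun setT (fun z : measurableTypeR R * measurableTypeR R =>
  Ere z.1 z.2 : measurableTypeR R).
Proof. by apply: (@mker dlogre) => d T f g; exact: measurable_fun_dlogre. Qed.
Let mEim : measurable_fun setT (fun z : measurableTypeR R * measurableTypeR R =>
  Eim z.1 z.2 : measurableTypeR R).
Proof. by apply: (@mker dlogim) => d T f g; exact: measurable_fun_dlogim. Qed.

Let mre (k : R) t p : measurable_fun D (fun r => k * dlogre (arg t r) (- (al * p)) : measurableTypeR R).
Proof. by rewrite /arg; meas. Qed.
Let mim (k : R) t p : measurable_fun D (fun r => k * dlogim (arg t r) (- (al * p)) : measurableTypeR R).
Proof. by rewrite /arg; meas. Qed.
Let mre1 t p : measurable_fun D (fun r => dlogre (arg t r) (- (al * p)) : measurableTypeR R).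
Proof. by rewrite /arg; meas. Qed.
Let mim1 t p : measurable_fun D (fun r => dlogim (arg t r) (- (al * p)) : measurableTypeR R).
Proof. by rewrite /arg; meas. Qed.

Let ire t p : ok p -> H.-integrable D (EFin \o (fun r => dlogre (arg t r) (- (al * p)))).
Proof.
move=> /ok_bounds[hp _]; apply: (@integrable_of_bounded _ _ _ mD _ K); first exact: mre1.
by move=> r _; have [] := dlog_le (arg t r) hp.
Qed.
Let iim t p : ok p -> H.-integrable D (EFin \o (fun r => dlogim (arg t r) (- (al * p)))).
Proof.
move=> /ok_bounds[hp _]; apply: (@integrable_of_bounded _ _ _ mD _ K); first exact: mim1.
by move=> r _; have [] := dlog_le (arg t r) hp.
Qed.

Let ipotim t p : ok p -> H.-integrable D (EFin \o (fun r => logim (arg t r) (- (al * p)))).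
Proof.
move=> /ok_bounds[hp _]; apply: (@integrable_of_bounded _ _ _ mD _ pi).
  by rewrite /arg; meas.
move=> r _; have hp' := bound_lt hp.
exact: le_trans (logim_norm_le _ hp') (ltW hp').
Qed.

Let thalf t s : 0 < t -> t / 2 < s < 2 * t -> 0 < s.
Proof. by move=> t0 /andP[h _]; apply: lt_trans h; rewrite divr_gt0. Qed.

Let coef_le t s (z : R) : 0 < t -> t / 2 < s < 2 * t -> `|z| <= K ->
  `|- (al / s) * z| <= 2 * al / t * K.
Proof.
move=> t0 hs zK; have s0 := thalf t0 hs; rewrite normrM normrN ler_pM//.
rewrite gtr0_norm ?divr_gt0// ler_pdivrMr// mulrAC ler_pdivlMr//.
by rewrite [2 * al]mulrC -mulrA ler_pM2l//; case/andP: hs => h _; lra.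
Qed.

Let dt_pot (F G : R -> R -> R) t p : 0 < t -> ok p ->
  (forall x p, `|p| < pi -> is_derive x 1 (F ^~ p) (G x p)) ->
  (forall s, H.-integrable D (EFin \o (fun r => F (arg s r) (- (al * p))))) ->
  (forall s, H.-integrable D (EFin \o (fun r => G (arg s r) (- (al * p))))) ->
  (forall x, `|G x (- (al * p))| <= K) ->
  is_derive t 1 (fun s => \int[H]_(r in D) F (arg s r) (- (al * p)))
    (- (al / t) * \int[H]_(r in D) G (arg t r) (- (al * p))).
Proof.
move=> t0 hp dF iF iG GK; have [hq _] := ok_bounds hp.
rewrite -RintegralZl//.
apply: (@is_derive_integral_bounded _ H D mD (fun s r => F (arg s r) (- (al * p)))
  (fun s r => - (al / s) * G (arg s r) (- (al * p))) (2 * al / t * K) (t / 2) (2 * t)).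
- by apply/andP; split; lra.
- by move=> s _; exact: iF.
- move=> s r hs _; have s0 := thalf t0 hs.
  have h1 : deriv_at (fun s => arg s r) s (- (al / s)).
    by rewrite /arg; apply: deriv_atE; [repeat der1|rewrite /=; ring].
  have h2 : deriv_at (F ^~ (- (al * p))) (arg s r) (G (arg s r) (- (al * p))).
    exact: dF (bound_lt hq).
  apply: deriv_atE; first exact: (@der_comp _ (F ^~ (- (al * p))) (fun s => arg s r) _ _ _ h2 h1).
  by rewrite mulrC.
- by move=> s r hs _; exact: coef_le.
Qed.

(** The sign [sg] is - 1 for [logre] and 1 for [logim], as in the Cauchy-Riemann equations. *)
Let dp_pot (F G : R -> R -> R) (sg : R) t p : `|sg| = 1 -> ok p ->
  (forall x p, `|p| < pi -> is_derive p 1 (F x) (sg * G x p)) ->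
  (forall p, ok p -> H.-integrable D (EFin \o (fun r => F (arg t r) (- (al * p))))) ->
  (forall p, ok p -> H.-integrable D (EFin \o (fun r => G (arg t r) (- (al * p))))) ->
  (forall x p, ok p -> `|G x (- (al * p))| <= K) ->
  is_derive p 1 (fun p => \int[H]_(r in D) F (arg t r) (- (al * p)))
    (- (sg * al) * \int[H]_(r in D) G (arg t r) (- (al * p))).
Proof.
move=> sg1 hp dF iF iG GK.
rewrite -RintegralZl//; last exact: iG.
apply: (@is_derive_integral_bounded _ H D mD (fun p r => F (arg t r) (- (al * p)))
  (fun p r => - (sg * al) * G (arg t r) (- (al * p))) (al * K) (- del) (pi + del)).
- exact: hp.
- by move=> s hs; exact: iF.
- move=> s r hs _; have [hq _] := ok_bounds hs.
  have h1 : deriv_at (fun s => - (al * s)) s (- al).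
    by apply: deriv_atE; [repeat der1|rewrite /=; ring].
  have h2 : deriv_at (F (arg t r)) (- (al * s)) (sg * G (arg t r) (- (al * s))).
    exact: dF (bound_lt hq).
  apply: deriv_atE; first exact: (@der_comp _ (F (arg t r)) (fun s => - (al * s)) _ _ _ h2 h1).
  by ring.
- move=> s r hs _; rewrite normrM normrN normrM sg1 mul1r (gtr0_norm al0) ler_pM2l//.
  exact: GK.
Qed.

Let ct_pot (G G' : R -> R -> R) t p : 0 < t -> ok p ->
  (forall x p, `|p| < pi -> is_derive x 1 (G ^~ p) (G' x p)) ->
  (forall s, measurable_fun D (fun r => G (arg s r) (- (al * p)) : measurableTypeR R)) ->
  (forall x, `|G x (- (al * p))| <= K) ->
  {for t, continuous (fun s => \int[H]_(r in D) G (arg s r) (- (al * p)))}.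
Proof.
move=> t0 hp dG mG GK; have [hq _] := ok_bounds hp.
apply: (@continuous_integral_bounded _ H D mD (fun s r => G (arg s r) (- (al * p)))
  K (t / 2) (2 * t)).
- by apply/andP; split; lra.
- exact: mG.
- move=> s r hs _; have s0 := thalf t0 hs.
  have h1 : deriv_at (fun s => arg s r) s (- (al / s)).
    by rewrite /arg; apply: deriv_atE; [repeat der1|rewrite /=; ring].
  have h2 : deriv_at (G ^~ (- (al * p))) (arg s r) (G' (arg s r) (- (al * p))).
    exact: dG (bound_lt hq).
  exact: deriv_at_continuous (@der_comp _ (G ^~ (- (al * p))) (fun s => arg s r) _ _ _ h2 h1).
- by move=> s r hs _; exact: GK.
Qed.

Let cp_pot (G G' : R -> R -> R) t p : ok p ->
  (forall x p, `|p| < pi -> is_derive p 1 (G x) (G' x p)) ->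
  (forall p, measurable_fun D (fun r => G (arg t r) (- (al * p)) : measurableTypeR R)) ->
  (forall x p, ok p -> `|G x (- (al * p))| <= K) ->
  {for p, continuous (fun p => \int[H]_(r in D) G (arg t r) (- (al * p)))}.
Proof.
move=> hp dG mG GK.
apply: (@continuous_integral_bounded _ H D mD (fun p r => G (arg t r) (- (al * p)))
  K (- del) (pi + del)).
- exact: hp.
- exact: mG.
- move=> s r hs _; have [hq _] := ok_bounds hs.
  have h1 : deriv_at (fun s => - (al * s)) s (- al).
    by apply: deriv_atE; [repeat der1|rewrite /=; ring].
  have h2 : deriv_at (G (arg t r)) (- (al * s)) (G' (arg t r) (- (al * s))).
    exact: dG (bound_lt hq).
  exact: deriv_at_continuous (@der_comp _ (G (arg t r)) (fun s => - (al * s)) _ _ _ h2 h1).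
- by move=> s r hs _; exact: GK.
Qed.

Let reK x p : ok p -> `|dlogre x (- (al * p))| <= K.
Proof. by move=> /ok_bounds[hp _]; have [] := dlog_le x hp. Qed.
Let imK x p : ok p -> `|dlogim x (- (al * p))| <= K.
Proof. by move=> /ok_bounds[hp _]; have [] := dlog_le x hp. Qed.

Let dt_potre t p : 0 < t -> ok p ->
  is_derive t 1 (potre ^~ p) (- (al / t) * Ere t p).
Proof.
move=> t0 hp; exact: (@dt_pot logre dlogre t p t0 hp (fun x s hs => der_logre x hs)
  (fun s => integrable_logre s (ok_bounds hp).1) (fun s => ire s hp) (fun x => reK x hp)).
Qed.

Let dt_potim t p : 0 < t -> ok p ->
  is_derive t 1 (potim ^~ p) (- (al / t) * Eim t p).
Proof.
move=> t0 hp; exact: (@dt_pot logim dlogim t p t0 hp (fun x s hs => der_logim x hs)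
  (fun s => ipotim s hp) (fun s => iim s hp) (fun x => imK x hp)).
Qed.

Let dp_potre t p : ok p -> is_derive p 1 (potre t) (al * Eim t p).
Proof.
move=> hp; have -> : al * Eim t p = - (-1 * al) * Eim t p by rewrite mulN1r opprK.
apply: (@dp_pot logre dlogim (-1) t p _ hp _
  (fun s hs => integrable_logre t (ok_bounds hs).1) (fun s hs => iim t hs) imK).
- by rewrite normrN1.
- by move=> x s hs; rewrite mulN1r; exact: der_logre_arg.
Qed.

Let dp_potim t p : ok p -> is_derive p 1 (potim t) (- (al * Ere t p)).
Proof.
move=> hp; have -> : - (al * Ere t p) = - (1 * al) * Ere t p by rewrite mul1r mulNr.
apply: (@dp_pot logim dlogre 1 t p _ hp _
  (fun s hs => ipotim t hs) (fun s hs => ire t hs) reK).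
- by rewrite normr1.
- by move=> x s hs; rewrite mul1r; exact: der_logim_arg.
Qed.

Let ct_re t p : 0 < t -> ok p -> {for t, continuous (Ere ^~ p)}.
Proof.
move=> t0 hp; exact: (@ct_pot dlogre d2logre t p t0 hp (fun x s hs => der_dlogre x hs)
  (fun s => mre1 s p) (fun x => reK x hp)).
Qed.
Let ct_im t p : 0 < t -> ok p -> {for t, continuous (Eim ^~ p)}.
Proof.
move=> t0 hp; exact: (@ct_pot dlogim d2logim t p t0 hp (fun x s hs => der_dlogim x hs)
  (fun s => mim1 s p) (fun x => imK x hp)).
Qed.
Let cp_re t p : ok p -> {for p, continuous (Ere t)}.
Proof.
move=> hp; exact: (@cp_pot dlogre (fun x p => - d2logim x p) t p hp
  (fun x s hs => der_dlogre_arg x hs) (mre1 t) reK).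
Qed.
Let cp_im t p : ok p -> {for p, continuous (Eim t)}.
Proof.
move=> hp; exact: (@cp_pot dlogim d2logre t p hp
  (fun x s hs => der_dlogim_arg x hs) (mim1 t) imK).
Qed.

Let Y t := ln lam + al * ln t.
Let Q p := al * p - al * pi.
(* [Lre + i Lim] is the logarithm of the function
   [exp(- theta E log(1 + R w^(- al))) / (1 + lam (- w)^al)] at [w = t e^(ip)]. *)
Let Lre t p := - theta * potre t p - logre (Y t) (Q p).
Let Lim t p := - theta * potim t p - logim (Y t) (Q p).
(** U + i V is t times the t-derivative of [Lre] + i [Lim]. The same pair gives the p-derivatives, -
    V for [Lre] and U for [Lim]. *)
Let U t p := theta * al * Ere t p - al * dlogre (Y t) (Q p).
Let V t p := theta * al * Eim t p - al * dlogim (Y t) (Q p).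
Let a t p := expR (Lre t p) * cos (Lim t p).
Let b t p := expR (Lre t p) * sin (Lim t p).
Let d t p := t^-1 * (U t p * a t p - V t p * b t p).

Let dY t : 0 < t -> deriv_at Y t (al / t).
Proof. by move=> t0; rewrite /Y; apply: deriv_atE; [repeat der1|rewrite /=; ring]. Qed.

Let dQ p : deriv_at Q p al.
Proof. by rewrite /Q; apply: deriv_atE; [repeat der1|rewrite /=; ring]. Qed.

Let Q_lt p : ok p -> `|Q p| < pi.
Proof. by move=> /ok_bounds[_ /bound_lt]. Qed.

Let dt_Lre t p : 0 < t -> ok p -> is_derive t 1 (Lre ^~ p) (U t p / t).
Proof.
move=> t0 hp; have hY : is_derive t 1 (fun s => logre (Y s) (Q p)) (dlogre (Y t) (Q p) * (al / t)).
  exact: der_logre1 (Q_lt hp) (dY t0).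
apply: (deriv_atE (is_derive_scale_sub (- theta) (dt_potre t0 hp) hY)).
by rewrite /U; move: (Ere _ _) (dlogre _ _) => x y; ring.
Qed.

Let dt_Lim t p : 0 < t -> ok p -> is_derive t 1 (Lim ^~ p) (V t p / t).
Proof.
move=> t0 hp; have hY : is_derive t 1 (fun s => logim (Y s) (Q p)) (dlogim (Y t) (Q p) * (al / t)).
  exact: der_logim1 (Q_lt hp) (dY t0).
apply: (deriv_atE (is_derive_scale_sub (- theta) (dt_potim t0 hp) hY)).
by rewrite /V; move: (Eim _ _) (dlogim _ _) => x y; ring.
Qed.

Let dp_Lre t p : ok p -> is_derive p 1 (Lre t) (- V t p).
Proof.
move=> hp; have hY : is_derive p 1 (fun s => logre (Y t) (Q s)) (- dlogim (Y t) (Q p) * al).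
  exact: der_logre2 (Q_lt hp) (dQ p).
apply: (deriv_atE (is_derive_scale_sub (- theta) (dp_potre t hp) hY)).
by rewrite /V; move: (Eim _ _) (dlogim _ _) => x y; ring.
Qed.

Let dp_Lim t p : ok p -> is_derive p 1 (Lim t) (U t p).
Proof.
move=> hp; have hY : is_derive p 1 (fun s => logim (Y t) (Q s)) (dlogre (Y t) (Q p) * al).
  exact: der_logim2 (Q_lt hp) (dQ p).
apply: (deriv_atE (is_derive_scale_sub (- theta) (dp_potim t hp) hY)).
by rewrite /U; move: (Ere _ _) (dlogre _ _) => x y; ring.
Qed.

Let dt_a t p : 0 < t -> ok p -> is_derive t 1 (a ^~ p) (d t p).
Proof.
move=> t0 hp; apply: (deriv_atE (is_derive_expR_cos (dt_Lre t0 hp) (dt_Lim t0 hp))).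
by rewrite /d -/(a t p) -/(b t p); move: (a t p) (b t p) (U t p) (V t p) => x y u v; ring.
Qed.

Let dt_b t p : 0 < t -> ok p -> {for t, continuous (b ^~ p)}.
Proof.
by move=> t0 hp; exact: is_derive_continuous (is_derive_expR_sin (dt_Lre t0 hp) (dt_Lim t0 hp)).
Qed.

Let dp_a t p : ok p -> {for p, continuous (a t)}.
Proof.
by move=> hp; exact: is_derive_continuous (is_derive_expR_cos (dp_Lre t hp) (dp_Lim t hp)).
Qed.

Let dp_b t p : 0 < t -> ok p -> is_derive p 1 (b t) (t * d t p).
Proof.
move=> t0 hp; apply: (deriv_atE (is_derive_expR_sin (dp_Lre t hp) (dp_Lim t hp))).
rewrite /d -/(a t p) -/(b t p); move: (a t p) (b t p) (U t p) (V t p) => x y u v.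
by rewrite mulrA divff ?gt_eqF//; ring.
Qed.

Let cont_comb (f1 u x v y : R -> R) s : {for s, continuous f1} ->
  {for s, continuous u} -> {for s, continuous x} ->
  {for s, continuous v} -> {for s, continuous y} ->
  {for s, continuous (fun s => f1 s * (u s * x s - v s * y s))}.
Proof. by move=> h1 h2 h3 h4 h5; apply: cvgM => //; apply: cvgB; apply: cvgM. Qed.

Let cont_lin (u v : R -> R) (k l s : R) : {for s, continuous u} ->
  {for s, continuous v} -> {for s, continuous (fun s => k * u s - l * v s)}.
Proof. by move=> h1 h2; apply: cvgB; apply: cvgMr. Qed.

Let ct_d t p : 0 < t -> ok p -> {for t, continuous (d ^~ p)}.
Proof.
move=> t0 hp; have tN0 : t != 0 by rewrite gt_eqF.
apply: (@cont_comb (fun t => t^-1) (U ^~ p) (a ^~ p) (V ^~ p) (b ^~ p)).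
- by apply: (@deriv_at_continuous _ (fun t => t^-1)); apply: (@der_inv _ (fun t => t)) => //; exact: der_id.
- apply: (@cont_lin (Ere ^~ p) (fun t => dlogre (Y t) (Q p))); first exact: ct_re.
  exact: deriv_at_continuous (der_dlogre1 (Q_lt hp) (dY t0)).
- exact: is_derive_continuous (dt_a t0 hp).
- apply: (@cont_lin (Eim ^~ p) (fun t => dlogim (Y t) (Q p))); first exact: ct_im.
  exact: deriv_at_continuous (der_dlogim1 (Q_lt hp) (dY t0)).
- exact: dt_b.
Qed.

Let cp_d t p : 0 < t -> ok p -> {for p, continuous (d t)}.
Proof.
move=> t0 hp; apply: (@cont_comb (fun=> t^-1) (U t) (a t) (V t) (b t)).
- exact: cst_continuous.
- apply: (@cont_lin (Ere t) (fun p => dlogre (Y t) (Q p))); first exact: cp_re.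
  exact: deriv_at_continuous (der_dlogre2 (Y t) (Q_lt hp) (dQ p)).
- exact: dp_a.
- apply: (@cont_lin (Eim t) (fun p => dlogim (Y t) (Q p))); first exact: cp_im.
  exact: deriv_at_continuous (der_dlogim2 (Y t) (Q_lt hp) (dQ p)).
- exact: is_derive_continuous (dp_b t0 hp).
Qed.

Definition log_mean s := \int[H]_(r in D) ln (1 + s `^ al * r).

Let J t := \int[H]_(r in D) ln (1 + expR (arg t r)).

Let JE t : potre t 0 = J t.
Proof. by apply: eq_Rintegral => r _; rewrite mulr0 oppr0 logre0. Qed.

Let J_log_mean t : 0 < t -> J t = log_mean t^-1.
Proof.
move=> t0; apply: eq_Rintegral => r; rewrite inE/D/= in_itv/= andbT => r0.
by rewrite expR_arg// mulrC /powR gt_eqF ?invr_gt0// lnV ?posrE// mulrN.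
Qed.

Let q0 : `|0 : R| <= q.
Proof. by rewrite normr0 ltW//; exact: lt_trans alpi0 alq. Qed.

Let iJ t : H.-integrable D (EFin \o (fun r => ln (1 + expR (arg t r)))).
Proof. by apply: eq_integrable (integrable_logre t q0) => // r _ /=; rewrite logre0. Qed.

Let J_ge0 t : 0 <= J t.
Proof. by apply: Rintegral_ge0 => r _; rewrite ln_ge0// lerDl expR_ge0. Qed.

Lemma log_mean_EFin s : 0 < s ->
  (\int[H]_(r in D) (ln (1 + s `^ al * r))%:E = (log_mean s)%:E)%E.
Proof.
move=> s0; rewrite /log_mean /Rintegral fineK//; apply: integrable_fin_num => //.
apply: eq_integrable (iJ s^-1) => // r /set_mem; rewrite /D/= in_itv/= andbT => r0.
by rewrite /= expR_arg// mulrC /powR gt_eqF// lnV ?posrE// mulrN opprK.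
Qed.

Let potre_ge t p : ok p -> ln c + J t <= potre t p.
Proof.
move=> hp; have [hq _] := ok_bounds hp.
have i0 := finite_measure_integrable_cst H (ln c) mD.
have -> : ln c + J t = \int[H]_(r in D) (ln c + ln (1 + expR (arg t r))).
  rewrite (RintegralD mD i0 (iJ t)) Rintegral_cst//; congr (_ + _).
  have -> : fine (H D) = 1 by rewrite HD.
  by rewrite mulr1.
apply: le_Rintegral => //.
- by apply: eq_integrable (integrableD mD i0 (iJ t)).
- exact: integrable_logre.
- by move=> r _; exact: logre_lb.
Qed.

Let C0 := expR (- (theta + 1) * ln c).
Let g t := expR (- theta * J t).

(** In [C0] the power theta of 1/c comes from the potential and one more from the denominator. The
    factor [g] makes the function small near w = 0, the last factor near infinity. *)
Let expLre_le t p : ok p -> expR (Lre t p) <= C0 * g t * (1 + expR (Y t))^-1.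
Proof.
move=> hp; have h1 := potre_ge t hp; have [_ hQ] := ok_bounds hp.
have h2 := logre_lb (Y t) hQ; have e0 := expR_gt0 (Y t).
have -> : (1 + expR (Y t))^-1 = expR (- ln (1 + expR (Y t))).
  by rewrite expRN lnK// posrE addr_gt0.
rewrite /C0 /g -!expRD ler_expR /Lre.
have h3 : theta * (ln c + J t) <= theta * potre t p by rewrite ler_pM2l.
by move: h2 h3; rewrite -/(Q p); move: (ln c) (J t) (potre t p) (logre _ _) (ln _) => x1 x2 x3 x4 x5; lra.
Qed.

Let g01 t : 0 < g t <= 1.
Proof.
rewrite expR_gt0 -expR0 ler_expR mulNr oppr_le0; apply: mulr_ge0 => //.
exact: ltW.
Qed.

Let Yi01 t : 0 < (1 + expR (Y t))^-1 <= 1.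
Proof.
have e0 := expR_gt0 (Y t); rewrite invr_gt0 addr_gt0//= invf_le1 ?addr_gt0//.
by rewrite lerDl ltW.
Qed.

Let expLre_C0 t p : ok p -> expR (Lre t p) <= C0.
Proof.
move=> hp; apply: (le_trans (expLre_le t hp)).
have /andP[y0 y1] := Yi01 t; have /andP[z0 z1] := g01 t.
have C00 : 0 < C0 := expR_gt0 _.
rewrite -mulrA ler_piMr ?(ltW C00)//; apply: mulr_ile1 => //; exact: ltW.
Qed.

Let cos_norm x : `|cos x| <= 1.
Proof. by rewrite ler_norml cos_geN1 cos_le1. Qed.
Let sin_norm x : `|sin x| <= 1.
Proof. by rewrite ler_norml sin_geN1 sin_le1. Qed.

Let a_norm t p : `|a t p| <= expR (Lre t p).
Proof. by rewrite /a normrM gtr0_norm ?expR_gt0// ler_piMr ?expR_ge0. Qed.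
Let b_norm t p : `|b t p| <= expR (Lre t p).
Proof. by rewrite /b normrM gtr0_norm ?expR_gt0// ler_piMr ?expR_ge0. Qed.

Let M := theta * al * K + al * K.

Let UV_bound t p : ok p -> `|U t p| <= M /\ `|V t p| <= M.
Proof.
move=> hp; have [hq hQ] := ok_bounds hp; have [k1 k2] := dlog_le (Y t) hQ.
have K0 : 0 <= K := le_trans (normr_ge0 _) k1.
have ta0 : 0 <= theta * al by rewrite mulr_ge0 ?(ltW theta0) ?(ltW al0).
have e1 : `|Ere t p| <= K.
  exact: (@Rintegral_le_bound _ H D mD _ K K0 (mre1 t p) (fun r _ => reK _ hp)).
have e2 : `|Eim t p| <= K.
  exact: (@Rintegral_le_bound _ H D mD _ K K0 (mim1 t p) (fun r _ => imK _ hp)).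
have key (x y : R) : `|x| <= K -> `|y| <= K -> `|theta * al * x - al * y| <= M.
  move=> hx hy; rewrite (le_trans (ler_normB _ _))// /M lerD//.
    by rewrite normrM (ger0_norm ta0) ler_wpM2l.
  by rewrite normrM (gtr0_norm al0) ler_pM2l.
by split; exact: key.
Qed.

Let d_bound t1 t p : 0 < t1 -> t1 <= t -> ok p -> `|d t p| <= t1^-1 * (M * C0 + M * C0).
Proof.
move=> t10 t1t hp; have t0 := lt_le_trans t10 t1t; have [hU hV] := UV_bound t hp.
have ha := le_trans (a_norm t p) (expLre_C0 t hp).
have hb := le_trans (b_norm t p) (expLre_C0 t hp).
rewrite /d normrM ler_pM//.
  by rewrite gtr0_norm ?invr_gt0// lef_pV2 ?posrE.
rewrite (le_trans (ler_normB _ _))// lerD// normrM ler_pM//.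
Qed.

Let md : measurable_fun setT
  (fun z : measurableTypeR R * measurableTypeR R => d z.1 z.2 : measurableTypeR R).
Proof. by rewrite /d /a /b /U /V /Lre /Lim /Y /Q; meas. Qed.

Let pi_ok : ok pi. Proof. by apply: ok_itv; rewrite lexx ltW. Qed.
Let zero_ok : ok 0. Proof. by apply: ok_itv; rewrite lexx ltW. Qed.

(** Here p runs over the whole of [0, pi]: all angles stay below [q] < pi, so the function is smooth
    up to both half lines. *)
Let rotation_n n :
  (\int[leb]_(t in `[harmonic n, n.+1%:R]) (t^-1 * (b t pi - b t 0))%:E =
   \int[leb]_(p in `[0%R, pi]) (a n.+1%:R p - a (harmonic n) p)%:E)%E.
Proof.
have u0 := @harmonic_gt0 R n.
have uw : harmonic n <= n.+1%:R :> R by rewrite (le_trans (harmonic_le1 _))// ler1n.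
apply: (@rotation _ a b d ((harmonic n)^-1 * (M * C0 + M * C0)) _ _ _ _ u0 uw (ltW pi0) md).
move=> t p /andP[ht _] /ok_itv hp; have t0 := lt_le_trans u0 ht; split.
- exact: dt_a.
- exact: dp_b.
- exact: ct_d.
- exact: cp_d.
- exact: d_bound.
Qed.

(** As R > 0 almost surely, ln (1 + R t^(- al)) increases to infinity when t decreases to 0, and its
    mean follows by monotone convergence. *)
Let g_cvg0 : g (harmonic n) @[n --> \oo] --> 0.
Proof.
pose f_ n r := (ln (1 + n.+1%:R `^ al * r))%:E.
have JE' n : (J (harmonic n))%:E = (\int[H]_(r in D) f_ n r)%E.
  rewrite /J /Rintegral fineK; last by apply: integrable_fin_num => //; exact: iJ.
  apply: eq_integral => r; rewrite inE/D/= in_itv/= andbT => r0.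
  have h0 := @harmonic_gt0 R n.
  by rewrite expR_arg// mulrC /f_ /powR gt_eqF// lnV ?posrE ?ltr0n// mulrN opprK.
have fE r : D r -> limn (f_ ^~ r) = +oo%E.
  rewrite /D/= in_itv/= andbT => r0; apply/cvg_lim => //; apply/cvgeyPge => A.
  have h : \forall n \near \oo, (@harmonic R n) `^ al < r * expR (- A).
    by apply: (@cvgr_lt _ _ _ _ _ _ (harmonic_powR_cvg0 al0)); rewrite mulr_gt0 ?expR_gt0.
  apply: filterS h => n h; have n0 : 0 < n.+1%:R :> R by rewrite ltr0n.
  have p0 : 0 < n.+1%:R `^ al :> R by rewrite powR_gt0.
  have hE : (@harmonic R n) `^ al = (n.+1%:R `^ al)^-1.
    have -> : @harmonic R n = n.+1%:R^-1 by [].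
    by rewrite /powR !gt_eqF ?invr_gt0// lnV ?posrE// mulrN expRN.
  rewrite /f_ lee_fin -[A]expRK ler_ln ?posrE ?expR_gt0 ?addr_gt0 ?mulr_gt0//.
  rewrite hE expRN ltr_pdivlMr ?expR_gt0// mulrC ltr_pdivrMr// in h.
  by rewrite mulrC; move: h; lra.
have cJ : ((J (harmonic n))%:E @[n --> \oo] --> +oo)%E.
  under eq_fun do rewrite JE'.
  have -> : (+oo%E : \bar R) = (\int[H]_(r in D) limn (f_ ^~ r))%E.
    rewrite (eq_integral (cst +oo%E)); last by move=> r /set_mem /fE.
    by rewrite integral_cst// [X in (_ * X)%E](_ : _ = 1%E) ?mule1//; exact: HD.
  apply: cvg_monotone_convergence => //.
  - by move=> n; apply/measurable_EFinP; meas.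
  - move=> n r; rewrite /D/= in_itv/= andbT => r0; rewrite lee_fin ln_ge0// lerDl.
    by rewrite mulr_ge0 ?powR_ge0// ltW.
  - move=> r; rewrite /D/= in_itv/= andbT => r0 m n mn; rewrite lee_fin.
    have h k : 0 < 1 + k.+1%:R `^ al * r.
      by rewrite ltr_pwDl// mulr_ge0 ?powR_ge0// ltW.
    rewrite ler_ln ?posrE ?h// lerD2l ler_pM2r// ge0_ler_powR ?(ltW al0) ?nnegrE ?ler0n//.
    by rewrite ler_nat.
have {}cJ : J (harmonic n) @[n --> \oo] --> +oo by apply/cvgeryP.
apply/cvgrPdist_lt => e e0.
have h : \forall n \near \oo, (1 - ln e) / theta <= J (harmonic n).
  by move/cvgryPge : cJ => /(_ ((1 - ln e) / theta)).
apply: filterS h => n h; rewrite sub0r normrN gtr0_norm ?expR_gt0//.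
rewrite -[ltRHS]lnK ?posrE// ltr_expR.
by move: h; rewrite ler_pdivrMr// mulrC; lra.
Qed.

(** The arc of radius n + 1 is small because of 1 / (1 + lam t^al), the arc of radius 1/(n + 1)
    because of [g]. *)
Let vertical_cvg0 :
  (\int[leb]_(p in `[0%R, pi]) (a n.+1%:R p - a (harmonic n) p)%:E @[n --> \oo] --> 0)%E.
Proof.
pose eps n : R := (C0 * (lam^-1 * (@harmonic R n) `^ al) + C0 * g (harmonic n)) * pi.
have eps0 : eps n @[n --> \oo] --> 0.
  rewrite -(mul0r pi); apply: cvgMl.
  have h : C0 * (lam^-1 * 0) + C0 * 0 = 0 by rewrite !mulr0 addr0.
  rewrite -h; apply: cvgD; apply: cvgMr => //.
  by apply: cvgMr; exact: harmonic_powR_cvg0.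
have ma s : measurable_fun setT (a s : measurableTypeR R -> measurableTypeR R).
  have h1 : measurable_fun setT (potre s : measurableTypeR R -> measurableTypeR R).
    exact: mpotre_arg.
  have h2 : measurable_fun setT (potim s : measurableTypeR R -> measurableTypeR R).
    exact: mpotim_arg.
  by rewrite /a /Lre /Lim /Y /Q; meas.
have Hn n : (`|\int[leb]_(p in `[0%R, pi]) (a n.+1%:R p - a (harmonic n) p)%:E|
    <= (eps n)%:E)%E.
  have -> : eps n = (C0 * (lam^-1 * (@harmonic R n) `^ al) + C0 * g (harmonic n)) * (pi - 0).
    by rewrite subr0.
  apply: abse_integral_itv_le; first exact: ltW.
    by have h1 := ma n.+1%:R; have h2 := ma (harmonic n); apply: measurable_fun_add => //; exact: measurable_fun_opp.
  move=> p /ok_itv hp; rewrite (le_trans (ler_normB _ _))// lerD//.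
  - rewrite (le_trans (a_norm _ _))// (le_trans (expLre_le _ hp))//.
    have C00 : 0 < C0 := expR_gt0 _.
    have /andP[z0 z1] := g01 n.+1%:R; have /andP[y0 y1] := Yi01 n.+1%:R.
    rewrite -mulrA ler_pM2l// (@le_trans _ _ (1 + expR (Y n.+1%:R))^-1)//.
      by rewrite ler_piMl ?(ltW y0).
    have -> : lam^-1 * (@harmonic R n) `^ al = (expR (Y n.+1%:R))^-1.
      rewrite /Y expRD lnK ?posrE// invfM; congr (_ * _).
      have -> : @harmonic R n = n.+1%:R^-1 by [].
      by rewrite /powR gt_eqF ?invr_gt0 ?ltr0n// lnV ?posrE ?ltr0n// mulrN expRN.
    by rewrite lef_pV2 ?posrE ?addr_gt0 ?expR_gt0// lerDr.
  - rewrite (le_trans (a_norm _ _))// (le_trans (expLre_le _ hp))//.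
    have C00 : 0 < C0 := expR_gt0 _.
    have /andP[z0 z1] := g01 (harmonic n); have /andP[y0 y1] := Yi01 (harmonic n).
    by rewrite ler_piMr// mulr_ge0// ltW.
have fin n : (\int[leb]_(p in `[0%R, pi]) (a n.+1%:R p - a (harmonic n) p)%:E)%E \is a fin_num.
  by rewrite -abse_fin_num ge0_fin_numE// (le_lt_trans (Hn n))// ltry.
apply/fine_cvgP; split; first by apply: nearW => n; exact: fin.
apply: (@squeeze_cvgr _ _ _ _ (fun n => - eps n) eps) => //; last first.
  by rewrite -oppr0; exact: cvgN.
apply: nearW => n.
by rewrite -ler_norml /= -lee_fin -abse_EFin fineK.
Qed.

(** (pi t)^-1 Im exp(- theta ([potre] + i [potim])) at p = pi: the claimed density, in terms of the
    potential. *)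
Definition mean_density t :=
  pi^-1 * (sin (theta * - potim t pi) * expR (- theta * potre t pi) * t^-1).

(** Serves [mean_density_ge0]: theta (- [potim]) lies in [0, al theta pi], a part of [0, pi] because
    al theta < 1, and there the sine is nonnegative. *)
Lemma potim_pi_bounds t : 0 <= - potim t pi <= al * pi.
Proof.
have hpi : 0 <= al * pi < pi by rewrite (ltW alpi0) alpi.
have E : - potim t pi = \int[H]_(r in D) logim (arg t r) (al * pi).
  rewrite -mulN1r /potim -RintegralZl//; last exact: ipotim pi_ok.
  apply: eq_Rintegral => r _.
  by rewrite logimN mulN1r opprK.
rewrite E; apply/andP; split.
  by apply: Rintegral_ge0 => r _; case/andP: (logim_bounds (arg t r) hpi).
rewrite (le_trans (ler_norm _))//; apply: (@Rintegral_le_bound _ H D mD); first exact: ltW.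
  by rewrite /arg; meas.
move=> r _; have /andP[h1 h2] := logim_bounds (arg t r) hpi.
by rewrite ger0_norm.
Qed.

Lemma mean_density_ge0 t : 0 < t -> 0 <= mean_density t.
Proof.
move=> t0; rewrite /mean_density; have /andP[h1 h2] := potim_pi_bounds t.
rewrite mulr_ge0 ?invr_ge0 ?(ltW pi0)// mulr_ge0 ?invr_ge0 ?(ltW t0)//.
rewrite mulr_ge0 ?expR_ge0//; apply: sin_ge0_pi.
rewrite mulr_ge0 ?(ltW theta0)//= (@le_trans _ _ (theta * (al * pi)))//.
  by rewrite ler_pM2l.
by rewrite mulrA ger_pMl// mulrC ltW.
Qed.

Lemma measurable_mean_density (A : set (measurableTypeR R)) :
  measurable_fun A (mean_density : measurableTypeR R -> measurableTypeR R).
Proof.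
have h1 : measurable_fun setT (potre ^~ pi : measurableTypeR R -> measurableTypeR R).
  exact: mpotre_mod.
have h2 : measurable_fun setT (potim ^~ pi : measurableTypeR R -> measurableTypeR R).
  exact: mpotim_mod.
by apply: measurable_funTS; rewrite /mean_density; meas.
Qed.

Let b_pi t : 0 < t -> t^-1 * b t pi = pi * (mean_density t * (1 + lam * t `^ al)^-1).
Proof.
move=> t0; have EY : expR (Y t) = lam * t `^ al.
  by rewrite /Y expRD lnK ?posrE// /powR gt_eqF.
have l0 : 0 < 1 + lam * t `^ al by rewrite addr_gt0// mulr_gt0// powR_gt0.
rewrite /b /Lre /Lim /Q subrr logre0 logim0 subr0 EY expRD expRN lnK ?posrE//.
rewrite /mean_density mulrN -mulNr.
have p0 := pi0; move: (sin _) (expR _) (1 + lam * _) l0 => x y z z0.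
by move: (@pi R) p0 => P P0; field; rewrite !gt_eqF.
Qed.

(** At p = 0 the potential is real. The imaginary part of the inverse of the denominator is e^(-
    [logre]) sin [logim] at angle al pi, which equals [dlogim], hence a ratio density. *)
Let b_zero t : 0 < t ->
  t^-1 * b t 0 = pi * (expR (- (theta * log_mean t^-1)) * ratio_density al lam^-1 t).
Proof.
move=> t0; have hap : `|al * pi| < pi by rewrite ger0_norm ?(ltW alpi0).
have pim0 : potim t 0 = 0.
  transitivity (\int[H]_(r in D) (0 : R)); last by rewrite Rintegral_cst// mul0r.
  by apply: eq_Rintegral => r _; rewrite mulr0 oppr0 logim0.
have -> : b t 0 = expR (- theta * J t) * dlogim (Y t) (al * pi).
  rewrite /b /Lre /Lim pim0 mulr0 sub0r JE /Q mulr0 sub0r logreN logimN opprK.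
  rewrite expRD -mulrA; congr (_ * _).
  have h1 := expR_logre_sin (Y t) hap; have h2 := expR_logre (Y t) hap.
  have N0 := sqn_gt0 (Y t) hap.
  rewrite /dlogim -h1 expRN -[in RHS](sqr_sqrtr (ltW N0)) -h2.
  have := expR_gt0 (logre (Y t) (al * pi)).
  by move: (expR _) (sin _) => x y x0; field; rewrite gt_eqF.
rewrite -J_log_mean// /ratio_density lnV ?posrE// opprK mulNr [Y t]addrC.
have p0 := pi0; move: (expR _) (dlogim _ _) => x y.
by move: (@pi R) p0 => P P0; field; rewrite !gt_eqF.
Qed.

Let mlog_mean : measurable_fun setT (fun t : measurableTypeR R => log_mean t^-1 : measurableTypeR R).
Proof.
apply: (@measurable_fun_Rintegral _ H D mD _ _ (fun t r => ln (1 + t^-1 `^ al * r))).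
by meas.
Qed.

(** The integrands differ by ([b t pi] - [b t 0]) / (pi t), whose integral over [1/(n + 1), n + 1]
    is that of the arcs and tends to 0. The right side is integrable by comparison with a ratio
    density; the left one is only known to be nonnegative, which is enough to pass to the limit. *)
Lemma stieltjes_mean_density :
  (\int[leb]_(t in D) (mean_density t * (1 + lam * t `^ al)^-1)%:E =
   \int[leb]_(t in D) (expR (- (theta * log_mean t^-1)) * ratio_density al lam^-1 t)%:E)%E.
Proof.
have li0 : 0 < lam^-1 by rewrite invr_gt0.
pose f1 t := mean_density t * (1 + lam * t `^ al)^-1.
pose f2 t := expR (- (theta * log_mean t^-1)) * ratio_density al lam^-1 t.
have mf1 : measurable_fun setT (f1 : measurableTypeR R -> measurableTypeR R).
  by have h := @measurable_mean_density setT; rewrite /f1; meas.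
have mf2 : measurable_fun setT (f2 : measurableTypeR R -> measurableTypeR R).
  apply: measurable_fun_mul; last by apply: measurable_ratio_density; meas.
  by have h := mlog_mean; meas.
have if2 : leb.-integrable D (EFin \o f2).
  apply: (le_integrable mD _ _ (integrable_ratio_density al0 al1 li0)).
    by apply/measurable_EFinP; exact: measurable_funTS.
  move=> t; rewrite /D/= in_itv/= andbT => t0; rewrite lee_fin normrM ler_piMl//.
  rewrite gtr0_norm ?expR_gt0// -expR0 ler_expR oppr_le0 mulr_ge0 ?(ltW theta0)//.
  by rewrite -J_log_mean.
have f10 t : D t -> 0 <= f1 t.
  rewrite /D/= in_itv/= andbT => t0; rewrite mulr_ge0 ?mean_density_ge0//.
  by rewrite invr_ge0 addr_ge0// mulr_ge0 ?powR_ge0// ltW.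
apply: (ge0_integral_exhaust harmonic_homo succ_homo itv0yE) => //.
  exact: measurable_funTS.
have sub n : (`[harmonic n, n.+1%:R]%classic : set R) `<=` D.
  move=> t; rewrite /D/= !in_itv/= andbT => /andP[h _].
  exact: lt_le_trans (harmonic_gt0 n) h.
have [_ c2] := @dominated_exhaust R (fun=> f2) f2 (fun t => `|f2 t|) (@harmonic R)
  (fun n => n.+1%:R) D 0 harmonic_homo succ_homo itv0yE
  (fun=> measurable_funTS mf2) (measurable_funTS mf2) (integrable_abse if2)
  (fun t _ _ => @cvg_cst _ _ _ _ _) (fun n t _ _ => lexx _).
pose B t := t^-1 * (b t pi - b t 0).
have BE n (t : measurableTypeR R) : t \in (`[harmonic n, n.+1%:R]%classic : set R) ->
    (f1 t)%:E = ((pi^-1)%:E * (B t)%:E + (f2 t)%:E)%E.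
  move=> /set_mem /sub; rewrite /D/= in_itv/= andbT => t0.
  rewrite -EFinM -EFinD; congr EFin; rewrite /B mulrBr b_pi// b_zero// -/(f1 t) -/(f2 t).
  have p0 := pi0; move: (f1 t) (f2 t) => x y.
  by move: (@pi R) p0 => P P0; field; rewrite gt_eqF.
have mI n : measurable (`[harmonic n, n.+1%:R]%classic : set (measurableTypeR R)).
  exact: measurable_itv.
have iB n : leb.-integrable (`[harmonic n, n.+1%:R]%classic : set (measurableTypeR R)) (EFin \o B).
  apply: measurable_bounded_integrable => //.
  - change (leb `[harmonic n, n.+1%:R] < +oo)%E.
    by rewrite lebesgue_measure_itv/=; case: ifP => _ //; rewrite -EFinB ltry.
  - have mb p : measurable_fun setT (b ^~ p : measurableTypeR R -> measurableTypeR R).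
      have h1 : measurable_fun setT (potre ^~ p : measurableTypeR R -> measurableTypeR R).
        exact: mpotre_mod.
      have h2 : measurable_fun setT (potim ^~ p : measurableTypeR R -> measurableTypeR R).
        exact: mpotim_mod.
      by rewrite /b /Lre /Lim /Y /Q; meas.
    apply: measurable_funTS; have h1 := mb pi; have h2 := mb 0; rewrite /B.
    apply: measurable_fun_mul; first by apply: measurable_funV; exact: measurable_id.
    by apply: measurable_fun_add => //; exact: measurable_fun_opp.
  - exists ((harmonic n)^-1 * (C0 + C0)); split; first exact: num_real.
    move=> x Cx t; rewrite /= in_itv/= => /andP[ht _].
    apply: le_trans (ltW Cx); have h0 := @harmonic_gt0 R n.
    have t0 := lt_le_trans h0 ht.
    rewrite /B normrM ler_pM//.
      by rewrite gtr0_norm ?invr_gt0// lef_pV2 ?posrE.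
    rewrite (le_trans (ler_normB _ _))// lerD// (le_trans (b_norm _ _))//; exact: expLre_C0.
have if2n n : leb.-integrable (`[harmonic n, n.+1%:R]%classic : set (measurableTypeR R)) (EFin \o f2).
  by apply: integrableS if2 => //; exact: sub.
have E n : (\int[leb]_(t in `[harmonic n, n.+1%:R]) (f1 t)%:E =
    (pi^-1)%:E * \int[leb]_(p in `[0%R, pi]) (a n.+1%:R p - a (harmonic n) p)%:E +
    \int[leb]_(t in `[harmonic n, n.+1%:R]) (f2 t)%:E)%E.
  rewrite -rotation_n (eq_integral _ _ (BE n)).
  rewrite (integralD (mI n) (integrableZl (mI n) pi^-1 (iB n)) (if2n n)).
  by rewrite (integralZl (mI n) (iB n)).
have c1 : ((pi^-1)%:E * \int[leb]_(p in `[0%R, pi]) (a n.+1%:R p - a (harmonic n) p)%:E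
    @[n --> \oo] --> (pi^-1)%:E * 0)%E by apply: cvgeZl => //; exact: vertical_cvg0.
rewrite mule0 in c1.
have c3 : ((pi^-1)%:E * \int[leb]_(p in `[0%R, pi]) (a n.+1%:R p - a (harmonic n) p)%:E +
    \int[leb]_(t in `[harmonic n, n.+1%:R]) (f2 t)%:E
    @[n --> \oo] --> 0 + \int[leb]_(t in D) (f2 t)%:E)%E by apply: cvgeD c1 c2.
rewrite add0e in c3.
by under eq_fun do rewrite E.
Qed.

End log_potential.

(** * Tonelli on a rectangle *)

Section tonelli.
Context {R : realType}.
Variables (m1 m2 : {sigma_finite_measure set (measurableTypeR R) -> \bar R}).

(** [F] has a sign on the rectangle only, so it is first extended by 0. *)
Lemma tonelli_rect (A B : set (measurableTypeR R))
    (F : measurableTypeR R * measurableTypeR R -> \bar R) :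
  measurable A -> measurable B -> measurable_fun setT F ->
  (forall x y, A x -> B y -> 0 <= F (x, y))%E ->
  (\int[m1]_(x in A) \int[m2]_(y in B) F (x, y) =
   \int[m2]_(y in B) \int[m1]_(x in A) F (x, y))%E.
Proof.
move=> mA mB mF F0; pose G := (F \_ (A `*` B))%E.
have mG : measurable_fun setT G.
  apply/(measurable_restrictT _ (measurableX mA mB)).
  exact: measurable_funTS.
have G0 w : (0 <= G w)%E.
  rewrite /G patchE; case: ifPn => // /set_mem; case: w => x y [/= Ax By].
  exact: F0.
have GE x y : G (x, y) = if (x \in A) && (y \in B) then F (x, y) else 0%E.
  by rewrite /G patchE in_setX.
have L : (\int[m1]_(x in A) \int[m2]_(y in B) F (x, y) =
    \int[m1]_x \int[m2]_y G (x, y))%E.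
  rewrite integral_mkcond; apply: eq_integral => x _; rewrite patchE.
  case: ifPn => xA.
    rewrite integral_mkcond; apply: eq_integral => y _.
    by rewrite patchE GE xA.
  by rewrite integral0_eq// => y _; rewrite GE (negbTE xA).
rewrite L (fubini_tonelli G mG G0).
rewrite [RHS]integral_mkcond; apply: eq_integral => y _; rewrite patchE.
case: ifPn => yB; last by rewrite integral0_eq// => x _; rewrite GE (negbTE yB) andbF.
rewrite [RHS]integral_mkcond; apply: eq_integral => x _.
by rewrite patchE GE yB andbT.
Qed.

End tonelli.

(** * Averaging over H: distribution function and logarithmic potential *)

Section mixture.
Context {R : realType}.
Local Notation leb := (@lebesgue_measure R).
Variables (al : R) (H : probability (measurableTypeR R) R).
Hypotheses (al0 : 0 < al) (al1 : al < 1) (HD : H `]0, +oo[%classic = 1%E)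
  (Hlog : (\int[H]_(x in `]0%R, +oo[) (ln (1 + x))%:E < +oo)%E).
Implicit Types x y r : R.

Let D : set (measurableTypeR R) := `]0, +oo[%classic.
Let mD : measurable D. Proof. exact: measurable_itv. Qed.
Let pi0 : 0 < pi :> R. Proof. exact: pi_gt0. Qed.
Let alpi0 : 0 < al * pi. Proof. exact: mulr_gt0. Qed.
Let alpi : `|al * pi| < pi. Proof. by rewrite gtr0_norm// gtr_pMl. Qed.

Let D_gt0 x : D x -> 0 < x. Proof. by rewrite /D/= in_itv/= andbT. Qed.

Let mrd2 : measurable_fun setT (fun w : measurableTypeR R * measurableTypeR R =>
  ratio_density al w.2 w.1 : measurableTypeR R).
Proof. by apply: measurable_ratio_density; meas. Qed.

Let ird y : 0 < y -> H.-integrable D (EFin \o (ratio_density al ^~ y)).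
Proof.
move=> y0; pose C := pi^-1 * (y^-1 * (cos (al * pi / 2)) ^- 2).
apply: (@integrable_of_bounded _ _ _ mD _ C).
  by apply: measurable_ratio_density; meas.
move=> r _; rewrite /ratio_density /C normrM gtr0_norm ?invr_gt0// ler_pM2l ?invr_gt0//.
rewrite normrM gtr0_norm ?invr_gt0// ler_pM2l ?invr_gt0//.
by have [] := dlog_bound (al * ln y - ln r) alpi.
Qed.

Let sin0 : 0 < sin (pi * al).
Proof. by apply: sin_gt0_pi; rewrite mulrC alpi0/=; move: alpi; rewrite gtr0_norm. Qed.

Lemma rhoHE y : 0 < y -> rhoH al H y = \int[H]_(r in D) ratio_density al r y.
Proof.
move=> y0; have p0 := pi0; have s0 := sin0.
have k0 : 0 < sin (pi * al) / pi by rewrite divr_gt0.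
have E : \int[H]_(r in D) rho_kernel al y r =
    \int[H]_(r in D) ((sin (pi * al) / pi)^-1 * ratio_density al r y).
  apply: eq_Rintegral => r /set_mem/D_gt0 r0.
  by rewrite -(ratio_densityE al0 al1 r0 y0) mulKf// gt_eqF.
by rewrite /rhoH E RintegralZl ?mulVKf ?gt_eqF//; exact: ird.
Qed.

Lemma rhoH_EFin y : 0 < y -> (rhoH al H y)%:E = (\int[H]_(r in D) (ratio_density al r y)%:E)%E.
Proof.
by move=> y0; rewrite rhoHE// /Rintegral fineK//; apply: integrable_fin_num => //; exact: ird.
Qed.

Lemma rhoH_ge0 y : 0 < y -> 0 <= rhoH al H y.
Proof.
by move=> y0; rewrite rhoHE//; apply: Rintegral_ge0 => r _; exact: ratio_density_ge0.
Qed.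

Lemma measurable_rhoH (A : set (measurableTypeR R)) :
  measurable_fun A (rhoH al H : measurableTypeR R -> measurableTypeR R).
Proof.
apply: measurable_funTS; apply: measurable_fun_mul; first by meas.
apply: (@measurable_fun_Rintegral _ H D mD _ _ (rho_kernel al)).
by rewrite /rho_kernel; meas.
Qed.

(** Tonelli turns integrals against [rhoH] into averages over H of integrals against ratio
    densities. As h has to be nonnegative on the whole line, it is applied to truncations by
    [Num.max]. *)
Lemma integral_rhoH (A : set (measurableTypeR R)) (h : measurableTypeR R -> \bar R) :
  measurable A -> A `<=` D -> measurable_fun setT h -> (forall y, 0 <= h y)%E ->
  (\int[leb]_(y in A) (h y * (rhoH al H y)%:E) =
   \int[H]_(r in D) \int[leb]_(y in A) (h y * (ratio_density al r y)%:E))%E.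
Proof.
move=> mA AD mh h0.
have mF : measurable_fun setT (fun w : measurableTypeR R * measurableTypeR R =>
    (h w.1 * (ratio_density al w.2 w.1)%:E)%E).
  apply: emeasurable_funM; last exact/measurable_EFinP.
  exact: measurableT_comp mh measurable_fst.
rewrite -(@tonelli_rect _ leb H A D _ mA mD mF); last first.
  by move=> y r /AD/D_gt0 y0 _; rewrite mule_ge0// lee_fin ratio_density_ge0.
apply: eq_integral => y /set_mem /AD/D_gt0 y0.
rewrite rhoH_EFin//= ge0_integralZl//.
  by apply/measurable_EFinP; apply: measurable_ratio_density; meas.
by move=> r _; rewrite lee_fin ratio_density_ge0.
Qed.

Lemma integral_rhoH_le x : 0 < x -> density_law (rhoH al H) `]-oo, x]%classic =
  (\int[H]_(r in D) ((al * pi)^-1 * logim (al * ln x - ln r) (al * pi))%:E)%E.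
Proof.
move=> x0; rewrite /density_law.
have -> : `]-oo, x]%classic `&` `]0, +oo[%classic = `]0, x]%classic :> set R.
  apply/seteqP; split => y /=; rewrite !in_itv/= andbT; first by move=> [-> ->].
  by move=> /andP[-> ->].
transitivity (\int[leb]_(y in `]0%R, x]) (cst 1 y * (rhoH al H y)%:E))%E.
  by apply: eq_integral => y _; rewrite mul1e.
rewrite integral_rhoH//; last by move=> y; rewrite /D/= !in_itv/= andbT => /andP[].
apply: eq_integral => r /set_mem/D_gt0 r0; rewrite -(integral_ratio_density_le al0 al1 r0 x0).
by apply: eq_integral => y _; rewrite mul1e.
Qed.

Let alpi01 : 0 <= al * pi < pi.
Proof. by rewrite ltW//=; move: alpi; rewrite gtr0_norm. Qed.

(** Averaging the distribution functions of X_al r^(1/al) writes al pi [Upsilon] as a mean of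
    arguments; [logim_reflect] then takes the complement to al pi. *)
Lemma Upsilon_potim x : 0 < x -> - potim al H x pi = al * pi * (1 - Upsilon al H x).
Proof.
move=> x0; have ap := alpi0.
have mL (u : R -> R) : measurable_fun D (u : measurableTypeR R -> measurableTypeR R) ->
    measurable_fun D (fun r => logim (u r) (al * pi) : measurableTypeR R).
  by move=> mu; meas.
have iL (u : R -> R) : measurable_fun D (u : measurableTypeR R -> measurableTypeR R) ->
    H.-integrable D (EFin \o (fun r => logim (u r) (al * pi))).
  move=> mu; apply: (@integrable_of_bounded _ _ _ mD _ (al * pi)); first exact: mL.
  by move=> r _; have /andP[h1 h2] := logim_bounds (u r) alpi01; rewrite ger0_norm.
have m1 : measurable_fun D (fun r => al * ln x - ln r : measurableTypeR R) by meas.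
have m2 : measurable_fun D (fun r => ln r - al * ln x : measurableTypeR R) by meas.
have U : Upsilon al H x = (al * pi)^-1 * \int[H]_(r in D) logim (al * ln x - ln r) (al * pi).
  by rewrite /Upsilon integral_rhoH_le// -(RintegralZl _ mD (iL _ m1)).
have E : \int[H]_(r in D) logim (al * ln x - ln r) (al * pi) =
    al * pi - \int[H]_(r in D) logim (ln r - al * ln x) (al * pi).
  have ic := finite_measure_integrable_cst H (al * pi) mD.
  have cE : \int[H]_(r in D) (al * pi) = al * pi.
    rewrite Rintegral_cst//; have -> : fine (H D) = 1 by rewrite HD.
    by rewrite mulr1.
  rewrite -[X in X - _]cE -(RintegralB mD ic (iL _ m2)); apply: eq_Rintegral => r _.
  by rewrite -logim_reflect opprB.
have -> : - potim al H x pi = \int[H]_(r in D) logim (ln r - al * ln x) (al * pi).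
  rewrite -mulN1r /potim -RintegralZl//.
    by apply: eq_Rintegral => r _; rewrite logimN mulN1r opprK.
  have i2 := iL _ m2; have i3 := integrableZl mD (-1) i2.
  by apply: eq_integrable i3 => // r _; rewrite /= logimN -EFinM mulN1r.
rewrite U E; move: (\int[H]_(r in D) _) => W.
by move: (al * pi) ap => P P0; field; rewrite gt_eqF.
Qed.

Lemma log1p_rhoH lam : 0 < lam ->
  (\int[leb]_(y in D) ((ln (1 + lam * y))%:E * (rhoH al H y)%:E) =
   (al^-1)%:E * \int[H]_(r in D) (ln (1 + lam `^ al * r))%:E)%E.
Proof.
move=> l0.
transitivity (\int[leb]_(y in D) ((Num.max 0 (ln (1 + lam * y)))%:E * (rhoH al H y)%:E))%E.
  apply: eq_integral => y /set_mem/D_gt0 y0; rewrite max_r// ln_ge0// lerDl.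
  by rewrite mulr_ge0// ltW.
rewrite integral_rhoH//; last 2 first.
- apply/measurable_EFinP; apply: measurable_maxr; first exact: measurable_cst.
  by meas.
- by move=> y; rewrite lee_fin le_max lexx.
rewrite -ge0_integralZl//; last 3 first.
- by apply/measurable_EFinP; meas.
- move=> r /D_gt0 r0; rewrite lee_fin ln_ge0// lerDl.
  by rewrite mulr_ge0 ?powR_ge0// ltW.
- by rewrite lee_fin invr_ge0 ltW.
apply: eq_integral => r /set_mem/D_gt0 r0; rewrite -EFinM.
have [_ <-] := log1p_ratio_density al0 al1 r0 l0.
apply: eq_integral => y /set_mem/D_gt0 y0; rewrite max_r -?EFinM; last first.
  by rewrite ln_ge0// lerDl mulr_ge0// ltW.
by rewrite mulrC.
Qed.


(** ln |x - y| changes sign, so Tonelli is applied to its two parts, whose integrals in y are [A r]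
    and [B r]. Since |x - y| <= (1 + x) (1 + y), the logarithmic moment of H makes [A] integrable.
    So is [C] = A - B, known from [lnabs_ratio_density], and therefore B. *)
Lemma logpot_potre x : 0 < x -> logpot al H x = ln x + al^-1 * potre al H x pi.
Proof.
move=> x0; pose P y : R := Num.max (ln `|x - y|) 0; pose N y : R := Num.max (- ln `|x - y|) 0.
have mln : measurable_fun setT (fun y : measurableTypeR R => ln `|x - y| : measurableTypeR R) by meas.
have mP : measurable_fun setT (P : measurableTypeR R -> measurableTypeR R).
  by apply: measurable_maxr => //; exact: measurable_cst.
have mN : measurable_fun setT (N : measurableTypeR R -> measurableTypeR R).
  by apply: measurable_maxr; [exact: measurable_fun_opp|exact: measurable_cst].
have P0 y : 0 <= P y by rewrite le_max lexx orbT.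
have N0 y : 0 <= N y by rewrite le_max lexx orbT.
have maxM (u v : R) : 0 <= v -> Num.max (u * v) 0 = Num.max u 0 * v.
  by move=> v0; rewrite maxr_pMl// mul0r.
pose L (k : R -> R) (y : R) : R := ln `|x - y| * k y.
have posE (k : R -> R) y : 0 <= k y ->
    ((EFin \o L k)^\+ y = (P y)%:E * (k y)%:E)%E.
  by move=> k0; rewrite funeposE/= -EFin_max maxM// EFinM.
have negE (k : R -> R) y : 0 <= k y ->
    ((EFin \o L k)^\- y = (N y)%:E * (k y)%:E)%E.
  by move=> k0; rewrite funenegE/= -EFin_max -mulNr maxM// EFinM.
pose A r := \int[leb]_(y in D) (P y * ratio_density al r y).
pose B r := \int[leb]_(y in D) (N y * ratio_density al r y).
pose C r := ln x + al^-1 * logre (ln r - al * ln x) (al * pi).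
have key r : 0 < r ->
  [/\ (\int[leb]_(y in D) ((P y)%:E * (ratio_density al r y)%:E) = (A r)%:E)%E,
      (\int[leb]_(y in D) ((N y)%:E * (ratio_density al r y)%:E) = (B r)%:E)%E &
      A r - B r = C r].
  move=> r0; have [i0 I0] := lnabs_ratio_density al0 al1 r0 x0.
  have i1 : leb.-integrable D (EFin \o L (ratio_density al r)).
    by apply: eq_integrable i0 => // y _ /=; rewrite mulrC.
  have pE : (\int[leb]_(y in D) (EFin \o L (ratio_density al r))^\+ y =
      \int[leb]_(y in D) ((P y)%:E * (ratio_density al r y)%:E))%E.
    by apply: eq_integral => y /set_mem/D_gt0 y0; rewrite posE// ratio_density_ge0.
  have nE : (\int[leb]_(y in D) (EFin \o L (ratio_density al r))^\- y =
      \int[leb]_(y in D) ((N y)%:E * (ratio_density al r y)%:E))%E.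
    by apply: eq_integral => y /set_mem/D_gt0 y0; rewrite negE// ratio_density_ge0.
  have fp := integrable_fin_num mD (integrable_funepos mD i1).
  have fn := integrable_fin_num mD (integrable_funeneg mD i1).
  rewrite pE in fp; rewrite nE in fn.
  have EA : (\int[leb]_(y in D) ((P y)%:E * (ratio_density al r y)%:E) = (A r)%:E)%E.
    by rewrite /A /Rintegral fineK//; under eq_integral do rewrite EFinM.
  have EB : (\int[leb]_(y in D) ((N y)%:E * (ratio_density al r y)%:E) = (B r)%:E)%E.
    by rewrite /B /Rintegral fineK//; under eq_integral do rewrite EFinM.
  split=> //; apply: EFin_inj; rewrite EFinB -EA -EB -pE -nE -integralE.
  by rewrite -/(C r) in I0; rewrite -I0; apply: eq_integral => y _ /=; rewrite mulrC.
have mA : measurable_fun D (A : measurableTypeR R -> measurableTypeR R).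
  apply: measurable_funTS.
  apply: (@measurable_fun_Rintegral _ leb D mD _ _ (fun r y => P y * ratio_density al r y)).
  apply: measurable_fun_mul; first exact: measurableT_comp mP measurable_snd.
  by apply: measurable_ratio_density; meas.
have hq : `|al * pi| <= (al * pi + pi) / 2.
  by have := alpi; rewrite (gtr0_norm alpi0) => h; lra.
have iC : H.-integrable D (EFin \o C).
  have i1 := finite_measure_integrable_cst H (ln x) mD.
  have i2 := integrableZl mD al^-1 (@integrable_logre _ al H al0 al1 Hlog x _ hq).
  by apply: eq_integrable (integrableD mD i1 i2).
have A_ge0 r : 0 < r -> 0 <= A r.
  move=> r0; apply: Rintegral_ge0 => y /D_gt0 y0.
  by rewrite mulr_ge0// ratio_density_ge0.
have A_le r : 0 < r -> A r <= ln (1 + x) + al^-1 * ln (1 + r).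
  move=> r0; have [EA _ _] := key r r0; rewrite -lee_fin -EA.
  have [i1 I1] := log1p_ratio_density al0 al1 r0 ltr01.
  have i0 := integrable_ratio_density al0 al1 r0.
  have -> : ((ln (1 + x) + al^-1 * ln (1 + r))%:E =
     \int[leb]_(y in D) ((ln (1 + x))%:E * (ratio_density al r y)%:E +
        (ratio_density al r y * ln (1 + 1 * y))%:E))%E.
    rewrite (integralD mD (integrableZl mD _ i0) i1) (integralZl mD i0) I1.
    by rewrite integral_ratio_density// mule1 powR1 mul1r.
  apply: ge0_le_integral => //.
  - by move=> y /D_gt0 y0; rewrite mule_ge0// lee_fin// ratio_density_ge0.
  - apply: emeasurable_funM; apply/measurable_EFinP; first exact: measurable_funTS.
    by apply: measurable_ratio_density; meas.
  - apply: emeasurable_funD; last by case/integrableP: i1.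
    by case/integrableP: (integrableZl mD (ln (1 + x)) i0).
  - move=> y /D_gt0 y0; have d0 := ratio_density_ge0 al0 al1 r y0.
    rewrite -!EFinM -EFinD lee_fin [_ * ln _]mulrC -mulrDl ler_wpM2r//.
    have l1 : 0 < ln (1 + x) by rewrite ln_gt0// ltrDl.
    have l2 : 0 < ln (1 + 1 * y) by rewrite ln_gt0// mul1r ltrDl.
    rewrite /P ge_max; apply/andP; split; last by lra.
    (* At y = x the convention ln 0 = 0 keeps the bound true. *)
    have [xy|xy] := eqVneq x y.
      have -> : x - y = 0 by rewrite xy subrr.
      by rewrite normr0 ln0//; lra.
    rewrite -lnM ?posrE ?mul1r ?addr_gt0// ler_ln ?posrE ?normr_gt0 ?subr_eq0// ?mulr_gt0 ?addr_gt0//.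
    have h := mulr_gt0 x0 y0.
    by rewrite ler_norml; apply/andP; split; nra.
have iA : H.-integrable D (EFin \o A).
  have i1 := finite_measure_integrable_cst H (ln (1 + x)) mD.
  have i2 := integrableZl mD al^-1 (integrable_log1p Hlog).
  apply: (le_integrable mD _ _ (integrableD mD i1 i2)).
    exact/measurable_EFinP.
  move=> r /D_gt0 r0; rewrite /= lee_fin ger0_norm ?A_ge0//.
  by rewrite (le_trans (A_le r r0))// ler_norm.
have BE : {in D, B =1 (fun r => A r - C r)}.
  by move=> r /set_mem/D_gt0 r0; have [_ _ <-] := key r r0; rewrite opprB addrC subrK.
have iB : H.-integrable D (EFin \o B).
  by apply: eq_integrable (integrableB mD iA iC) => // r rD /=; rewrite BE.
have -> : logpot al H x = \int[H]_(r in D) A r - \int[H]_(r in D) B r.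
  rewrite /logpot /Rintegral integralE -fineB; last 2 first.
  - exact: (integrable_fin_num mD iA).
  - exact: (integrable_fin_num mD iB).
  congr (fine (_ - _)).
  - transitivity (\int[leb]_(y in D) ((P y)%:E * (rhoH al H y)%:E))%E.
      by apply: eq_integral => y /set_mem/D_gt0 y0; rewrite -posE// rhoH_ge0.
    rewrite integral_rhoH//; first by apply: eq_integral => r /set_mem/D_gt0 r0; have [-> _ _] := key r r0.
    exact/measurable_EFinP.
  - transitivity (\int[leb]_(y in D) ((N y)%:E * (rhoH al H y)%:E))%E.
      by apply: eq_integral => y /set_mem/D_gt0 y0; rewrite -negE// rhoH_ge0.
    rewrite integral_rhoH//; first by apply: eq_integral => r /set_mem/D_gt0 r0; have [_ -> _] := key r r0.
    exact/measurable_EFinP.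
rewrite -(RintegralB mD iA iB).
have AB : {in D, (fun r => A r - B r) =1 C}.
  by move=> r /set_mem/D_gt0 r0; have [_ _ <-] := key r r0.
rewrite (eq_Rintegral _ AB) /C.
have i1 := finite_measure_integrable_cst H (ln x) mD.
have i3 := @integrable_logre _ al H al0 al1 Hlog x _ hq.
rewrite (RintegralD mD i1 (integrableZl mD al^-1 i3)) Rintegral_cst//.
have -> : fine (H D) = 1 by rewrite HD.
rewrite mulr1 (RintegralZl _ mD i3); congr (_ + _ * _).
by apply: eq_Rintegral => r _; rewrite logreN.
Qed.

(** As 1 / (1 + x/t) = 1 - 1 / (1 + t/x), [recip_ratio_density] at 1/x applies. This stands in for
    the symmetry of X_al under inversion. *)
Lemma recip_inv_ratio_density lam x : 0 < lam -> 0 <= x ->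
  (\int[leb]_(t in D) (ratio_density al lam^-1 t * (1 + t^-1 * x)^-1)%:E =
   ((1 + lam * x `^ al)^-1)%:E)%E.
Proof.
move=> l0; have li0 : 0 < lam^-1 by rewrite invr_gt0.
rewrite le_eqVlt => /predU1P[<-|x0].
  rewrite powR0 ?gt_eqF// mulr0 addr0 invr1 -(integral_ratio_density al0 al1 li0).
  by apply: eq_integral => t _; rewrite mulr0 addr0 invr1 mulr1.
have xi0 : 0 < x^-1 by rewrite invr_gt0.
have i0 := integrable_ratio_density al0 al1 li0.
have I1 := recip_ratio_density al0 al1 li0 xi0.
have i1 : leb.-integrable D (EFin \o (fun t => ratio_density al lam^-1 t * (1 + x^-1 * t)^-1)).
  apply: (integrable_of_finite _ _ I1).
    apply: measurable_fun_mul; last by meas.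
    by apply: measurable_ratio_density; meas.
  move=> t /D_gt0 t0; rewrite mulr_ge0 ?ratio_density_ge0//.
  by rewrite invr_ge0 addr_ge0// mulr_ge0// ltW.
transitivity (\int[leb]_(t in D) ((ratio_density al lam^-1 t)%:E -
    (ratio_density al lam^-1 t * (1 + x^-1 * t)^-1)%:E))%E.
  apply: eq_integral => t /set_mem/D_gt0 t0; rewrite -EFinB; congr EFin.
  have h : x + t != 0 by rewrite gt_eqF// addr_gt0.
  move: (ratio_density _ _ _) => z; field.
  by rewrite h !gt_eqF.
rewrite (integralB mD i0 i1) I1 integral_ratio_density// -EFinB; congr EFin.
have xa : 0 < x `^ al by rewrite powR_gt0.
have -> : x^-1 `^ al = (x `^ al)^-1.
  by rewrite /powR !gt_eqF// lnV ?posrE// mulrN expRN.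
move: (x `^ al) xa => X X0; field.
have h : 0 < lam * X by rewrite mulr_gt0.
by rewrite !gt_eqF//= ?addr_gt0.
Qed.

End mixture.

(** * Laws carried by a half line *)

Section nonneg_laws.
Context {R : realType}.
Implicit Types (lam : R).
Let D : set (measurableTypeR R) := `]0, +oo[%classic.
Let Dc : set (measurableTypeR R) := `[0, +oo[%classic.

Lemma integral_nonneg_support (m : {measure set (measurableTypeR R) -> \bar R})
    (h : measurableTypeR R -> \bar R) : m `]-oo, 0[%classic = 0%E ->
  measurable_fun setT h -> (forall x, 0 <= h x)%E ->
  (\int[m]_(x in Dc) h x = \int[m]_x h x)%E.
Proof.
move=> m0 mh h0; have mN : measurable (`]-oo, 0[%classic : set (measurableTypeR R)) by exact: measurable_itv.
have mDc : measurable Dc by exact: measurable_itv.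
have E : setT = Dc `|` `]-oo, 0[%classic :> set (measurableTypeR R).
  apply/seteqP; split => x //= _; rewrite /Dc/= !in_itv/= andbT.
  by case: (leP 0 x) => ?; [left|right].
rewrite [in RHS]E ge0_integral_setU//; last 2 first.
- by rewrite -E.
- apply/disj_setPS => x []; rewrite /Dc/= !in_itv/= andbT => h1 h2.
  by move: (le_lt_trans h1 h2); rewrite ltxx.
rewrite [X in (_ + X)%E](_ : _ = 0%E) ?adde0//.
by apply: null_set_integral => //; exact: measurable_funTS.
Qed.

Lemma integral_pos_support (m : {measure set (measurableTypeR R) -> \bar R})
    (h : measurableTypeR R -> \bar R) : m `]-oo, 0]%classic = 0%E ->
  measurable_fun setT h -> (forall x, (0 <= x)%R -> 0 <= h x)%E ->
  (\int[m]_(x in Dc) h x = \int[m]_(x in D) h x)%E.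
Proof.
move=> m0 mh h0; have mD : measurable D by exact: measurable_itv.
have m1 : measurable ([set 0] : set (measurableTypeR R)) by exact: measurable_set1.
have E : Dc = D `|` [set 0].
  apply/seteqP; split => x; rewrite /D /Dc/= !in_itv/= !andbT.
    by rewrite le_eqVlt => /predU1P[<-|]; [right|left].
  by case=> [/ltW//|->].
rewrite E ge0_integral_setU//; last 3 first.
- exact: measurable_funTS.
- move=> x; rewrite -E /Dc/= in_itv/= andbT; exact: h0.
- apply/disj_setPS => x [] /[swap]/= ->; rewrite /D/= in_itv/= ltxx//.
rewrite [X in (_ + X)%E](_ : _ = 0%E) ?adde0//.
apply: null_set_integral => //; first exact: measurable_funTS.
apply/eqP; rewrite -measure_le0 -m0; apply: le_measure; rewrite ?inE//.
by move=> x ->; rewrite /= in_itv/= lexx.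
Qed.

(** The atom at 0 contributes ln 1 = 0. *)
Lemma mix_zero_log1p (p lam : R) (nu : {measure set (measurableTypeR R) -> \bar R}) :
  0 <= p <= 1 -> 0 < lam ->
  (\int[mix_zero p nu]_(x in Dc) (ln (1 + lam * x))%:E =
   p%:E * \int[nu]_(x in Dc) (ln (1 + lam * x))%:E)%E.
Proof.
move=> /andP[p0 p1] l0; have q0 : 0 <= 1 - p by rewrite subr_ge0.
have mDc : measurable Dc by exact: measurable_itv.
have ml : measurable_fun Dc (fun x : measurableTypeR R => (ln (1 + lam * x))%:E).
  by apply/measurable_EFinP; meas.
have l_ge0 x : Dc x -> (0 <= (ln (1 + lam * x))%:E)%E.
  rewrite /Dc/= in_itv/= andbT => x0; rewrite lee_fin ln_ge0// lerDl.
  by rewrite mulr_ge0// ltW.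
pose m1 := mscale (NngNum p0) nu.
pose m2 := mscale (NngNum q0) (dirac (0 : measurableTypeR R)).
transitivity (\int[measure_add m1 m2]_(x in Dc) (ln (1 + lam * x))%:E)%E.
  congr (integral _ _ _); apply/funext => A.
  by rewrite measure_addE /m1 /m2 /mscale/= /mix_zero.
rewrite ge0_integral_measure_add// ge0_integral_mscale// ge0_integral_mscale//.
rewrite [X in (_ + X)%E](_ : _ = 0%E) ?adde0//.
by rewrite integral_dirac// mulr0 addr0 ln1 mule0 mule0.
Qed.

End nonneg_laws.

(** * The density of M *)

Section dirichlet_mean_density.
Context {R : realType}.
Local Notation leb := (@lebesgue_measure R).
Variables (al theta : R) (H : probability (measurableTypeR R) R).
Hypotheses (al0 : 0 < al) (al1 : al < 1) (theta0 : 0 < theta) (altheta1 : al * theta < 1)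
  (HD : H `]0, +oo[%classic = 1%E)
  (Hlog : (\int[H]_(x in `]0%R, +oo[) (ln (1 + x))%:E < +oo)%E).
Implicit Types x lam : R.
Let D : set (measurableTypeR R) := `]0, +oo[%classic.
Let Dc : set (measurableTypeR R) := `[0, +oo[%classic.
Let mD : measurable D. Proof. exact: measurable_itv. Qed.
Let mDc : measurable Dc. Proof. exact: measurable_itv. Qed.
Let DcD : Dc `&` D = D.
Proof. by apply/setIidr => x; rewrite /D /Dc/= !in_itv/= !andbT => /ltW. Qed.

Lemma log1p_density_law_rhoH lam : 0 < lam ->
  (\int[density_law (rhoH al H)]_(x in Dc) (ln (1 + lam * x))%:E =
   (al^-1 * log_mean al H lam)%:E)%E.
Proof.
move=> l0.
have [nu nuE] := density_law_measure (rhoH_ge0 H al0 al1) (@measurable_rhoH _ al H D).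
transitivity (\int[density_law (rhoH al H)]_(x in Dc) (Num.max 0 (ln (1 + lam * x)))%:E)%E.
  rewrite nuE; apply: eq_integral => y /set_mem; rewrite /Dc/= in_itv/= andbT => y0.
  by rewrite max_r// ln_ge0// lerDl mulr_ge0// ltW.
rewrite integral_density_law//; last 4 first.
- exact: rhoH_ge0.
- exact: measurable_rhoH.
- by apply/measurable_EFinP; apply: measurable_maxr; [exact: measurable_cst|meas].
- by move=> x; rewrite lee_fin le_max lexx.
rewrite DcD EFinM -log_mean_EFin// -log1p_rhoH//; apply: eq_integral => y /set_mem.
rewrite /D/= in_itv/= andbT => y0; rewrite max_r// ln_ge0// lerDl.
by rewrite mulr_ge0// ltW.
Qed.

(** The weight al theta of the mixture meets the factor 1/al of [log1p_density_law_rhoH] and leaves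
    theta. *)
Lemma dirichlet_mean_rhoH_stieltjes (M : probability (measurableTypeR R) R) lam :
  dirichlet_mean_law 1 (mix_zero (al * theta) (density_law (rhoH al H))) M -> 0 < lam ->
  (\int[M]_(x in Dc) ((1 + lam * x)^-1)%:E = (expR (- (theta * log_mean al H lam)))%:E)%E.
Proof.
move=> [_ hM] l0; have := hM lam l0.
have [nu nuE] := density_law_measure (rhoH_ge0 H al0 al1) (@measurable_rhoH _ al H D).
have p01 : 0 <= al * theta <= 1 by rewrite mulr_ge0 ?ltW.
have E1 : (\int[M]_(x in Dc) ((1 + lam * x)^-1)%:E =
    \int[M]_(x in Dc) ((1 + lam * x) `^ (- 1))%:E)%E.
  apply: eq_integral => x /set_mem; rewrite /Dc/= in_itv/= andbT => x0.
  by rewrite powR_inv1// addr_ge0// mulr_ge0// ltW.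
rewrite E1 => ->; rewrite nuE mix_zero_log1p// -nuE log1p_density_law_rhoH//.
rewrite mul1e -EFinM/=; congr (expR (- _))%:E.
by move: (log_mean _ _ _) => L; field; rewrite gt_eqF.
Qed.

(** Uniqueness with exponent al. Averaging 1 / (1 + M/T) over M and T = X_al lam^(-1/al) in the two
    orders gives the transform of M^al and the right side of [stieltjes_mean_density]. *)
Lemma dirichlet_mean_rhoH_density (M : probability (measurableTypeR R) R) :
  dirichlet_mean_law 1 (mix_zero (al * theta) (density_law (rhoH al H))) M ->
  forall A, measurable A -> M A = density_law (mean_density al theta H) A.
Proof.
move=> hM A mA.
have fge0 x : 0 < x -> 0 <= mean_density al theta H x by exact: mean_density_ge0.
have mf := @measurable_mean_density _ al theta H D.
have [nu nuE] := density_law_measure fge0 mf.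
have nu0 : nu `]-oo, 0[%classic = 0%E.
  rewrite -nuE /density_law; have -> : `]-oo, 0[%classic `&` `]0, +oo[%classic = set0 :> set R.
    apply/seteqP; split => x //=; rewrite !in_itv/= andbT => -[h1 h2].
    by have := lt_trans h1 h2; rewrite ltxx.
  by rewrite integral_set0.
rewrite nuE; apply: (stieltjes_measure_unique al0 hM.1 nu0) => // lam l0.
have li0 : 0 < lam^-1 by rewrite invr_gt0.
have P0 x : 0 < 1 + lam * x `^ al by rewrite ltr_pwDl// mulr_ge0 ?powR_ge0 ?ltW.
have R0 : (\int[nu]_(x in Dc) ((1 + lam * x `^ al)^-1)%:E =
    \int[leb]_(t in D) (mean_density al theta H t * (1 + lam * t `^ al)^-1)%:E)%E.
  rewrite -nuE integral_density_law//; last 2 first.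
  - by apply/measurable_EFinP; meas.
  - by move=> x; rewrite lee_fin invr_ge0 ltW.
  by rewrite DcD; apply: eq_integral => t _; rewrite -EFinM mulrC.
rewrite R0 stieltjes_mean_density//.
pose F (w : measurableTypeR R * measurableTypeR R) : \bar R :=
  (ratio_density al lam^-1 w.1 * (1 + w.1^-1 * w.2)^-1)%:E.
have mF : measurable_fun setT F.
  apply/measurable_EFinP; apply: measurable_fun_mul; last by meas.
  by apply: measurable_ratio_density; meas.
transitivity (\int[leb]_(t in D) \int[M]_(x in Dc) F (t, x))%E; last first.
  apply: eq_integral => t /set_mem; rewrite /D/= in_itv/= andbT => t0.
  have ti0 : 0 < t^-1 by rewrite invr_gt0.
  rewrite EFinM -(dirichlet_mean_rhoH_stieltjes hM ti0) muleC -ge0_integralZl//.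
  - by apply/measurable_EFinP; meas.
  - move=> x; rewrite /Dc/= in_itv/= andbT => x0.
    by rewrite lee_fin invr_ge0 addr_ge0// mulr_ge0// ltW.
  - by rewrite lee_fin ratio_density_ge0.
rewrite tonelli_rect//; last first.
  move=> t x; rewrite /D /Dc/= !in_itv/= !andbT => t0 x0; rewrite lee_fin.
  by rewrite mulr_ge0 ?ratio_density_ge0// invr_ge0 addr_ge0// mulr_ge0// invr_ge0 ltW.
apply: eq_integral => x /set_mem; rewrite /Dc/= in_itv/= andbT => x0.
by rewrite -(recip_inv_ratio_density al0 al1 l0 x0).
Qed.

(** The term ln x by which [logpot] differs from [potre] / al produces the power x^(al theta), and
    t^-1 lowers its exponent by 1. *)
Lemma mean_density_explicit x : 0 < x ->
  mean_density al theta H x =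
  pi^-1 * sin (pi * theta * al * (1 - Upsilon al H x)) *
  expR (- (theta * al * logpot al H x)) * x `^ (al * theta - 1).
Proof.
move=> x0; rewrite /mean_density Upsilon_potim// logpot_potre//.
have -> : theta * (al * pi * (1 - Upsilon al H x)) = pi * theta * al * (1 - Upsilon al H x) by ring.
have -> : x `^ (al * theta - 1) = expR (theta * al * ln x) * x^-1.
  by rewrite /powR gt_eqF// mulrBl mul1r expRD expRN lnK// [al * _]mulrC.
rewrite -!mulrA; congr (_ * (_ * _)); rewrite [RHS]mulrA -expRD; congr (expR _ * _).
by move: (potre _ _ _ _) (ln x) => y z; field; rewrite gt_eqF.
Qed.

Lemma dirichlet_mean_rhoH_has_density (M : probability (measurableTypeR R) R) :
  dirichlet_mean_law 1 (mix_zero (al * theta) (density_law (rhoH al H))) M ->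
  has_density M (fun x =>
    pi^-1 * sin (pi * theta * al * (1 - Upsilon al H x)) *
    expR (- (theta * al * logpot al H x)) * x `^ (al * theta - 1)).
Proof.
move=> hM; split.
- by move=> x x0; rewrite -mean_density_explicit//; apply: mean_density_ge0.
- apply: (eq_measurable_fun (mean_density al theta H)); last exact: measurable_mean_density.
  by move=> x /set_mem; rewrite /= in_itv/= andbT => x0; rewrite mean_density_explicit.
- move=> A mA; rewrite (dirichlet_mean_rhoH_density hM)//.
  apply: eq_integral => x /set_mem[_]; rewrite /= in_itv/= andbT => x0.
  by rewrite mean_density_explicit.
Qed.

End dirichlet_mean_density.

(** * The transform of Beta(a, 1 - a) *)

Section beta.
Context {R : realType}.
Local Notation leb := (@lebesgue_measure R).
Variable a : R.
Hypothesis a01 : 0 < a < 1.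
Implicit Types x z : R.
Let I01 : set (measurableTypeR R) := `]0, 1[%classic.
Let mI : measurable I01. Proof. exact: measurable_itv. Qed.
Let a0 : 0 < a. Proof. by case/andP: a01. Qed.
Let a1 : a < 1. Proof. by case/andP: a01. Qed.
Let I_in x : I01 x -> 0 < x < 1. Proof. by rewrite /I01/= in_itv. Qed.

Let w x : R := expR ((a - 1) * ln x - a * ln (1 - x)).

Let w_ge0 x : 0 <= w x. Proof. exact: expR_ge0. Qed.
Let mw (A : set (measurableTypeR R)) : measurable_fun A (w : measurableTypeR R -> measurableTypeR R).
Proof. by rewrite /w; meas. Qed.

Let beta_weightE x : 0 < x < 1 -> beta_weight a (1 - a) x = w x.
Proof.
move=> /andP[x0 x1]; rewrite /beta_weight /w /powR !gt_eqF ?subr_gt0// -expRD.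
by congr expR; ring.
Qed.

(** At each point of ]0, 1[ one factor of the weight has base at least 1/2 and exponent in [-1, 0],
    hence is at most 2. Twice the sum of the factors then dominates, and it has an elementary
    bounded primitive. *)
Let iw : leb.-integrable I01 (EFin \o w).
Proof.
pose m x : R := 2 * (expR ((a - 1) * ln x) + expR (- a * ln (1 - x))).
pose F x : R := 2 * (a^-1 * expR (a * ln x) - (1 - a)^-1 * expR ((1 - a) * ln (1 - x))).
have b0 : 0 < 1 - a by rewrite subr_gt0.
have im : leb.-integrable I01 (EFin \o m).
  apply: (@integrable_of_bounded_primitive _ m F (fun n => harmonic n / 2)
    (fun n => 1 - harmonic n / 2) _ (2 * (a^-1 + (1 - a)^-1)) _ _ _ itv01E).
  - by move=> i j ij; rewrite ler_pM2r// harmonic_homo.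
  - by move=> i j ij; rewrite lerD2l lerN2 ler_pM2r// harmonic_homo.
  - by move=> n; have := @harmonic_le1 R n; lra.
  - by move=> x _; rewrite mulr_ge0// addr_ge0// expR_ge0.
  - by rewrite /m; meas.
  - by move=> x /I_in/andP[x0 x1]; have h : 0 < 1 - x by [lra]; rewrite /m; contl.
  - move=> x /I_in/andP[x0 x1]; have h : 0 < 1 - x by lra.
    rewrite /F; derl; rewrite /= /m.
    have -> : expR ((a - 1) * ln x) = expR (a * ln x) * x^-1.
      by rewrite mulrBl mul1r expRD expRN lnK.
    have -> : expR (- a * ln (1 - x)) = expR ((1 - a) * ln (1 - x)) * (1 - x)^-1.
      by rewrite -[in RHS](lnK h) -expRN -expRD; congr expR; rewrite expRK; ring.
    move: (ln x) (ln (1 - x)) (expR _) (expR _) => l1 l2 e1 e2; field.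
    by rewrite !gt_eqF.
  - move=> x /I_in/andP[x0 x1]; have h : 0 < 1 - x by lra.
    have ai : 0 < a^-1 by rewrite invr_gt0.
    have bi : 0 < (1 - a)^-1 by rewrite invr_gt0.
    have e1 (k y : R) : 0 < k -> 0 < y < 1 -> expR (k * ln y) <= 1.
      by move=> k0 /andP[y0 y1]; rewrite -expR0 ler_expR pmulr_rle0// ln_le0// ltW.
    rewrite normrM ger0_norm// ler_pM2l// (le_trans (ler_normB _ _))// lerD//.
      rewrite normrM !gtr0_norm ?expR_gt0// ler_piMr ?(ltW ai)// e1//.
      by rewrite x0.
    rewrite normrM !gtr0_norm ?expR_gt0// ler_piMr ?(ltW bi)// e1//.
    by rewrite h/=; lra.
apply: (le_integrable mI _ _ im).
  by apply/measurable_EFinP; exact: mw.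
move=> x /I_in/andP[x0 x1]; have h : 0 < 1 - x by lra.
rewrite lee_fin ger0_norm// (le_trans _ (ler_norm _))// /w /m expRD.
have key (k y : R) : -1 <= k -> k <= 0 -> 2^-1 <= y -> y < 1 -> expR (k * ln y) <= 2.
  move=> k1 k0 y2 y1; have y0 : 0 < y by lra.
  rewrite -(@lnK _ 2) ?posrE// ler_expR.
  have : ln 2^-1 <= ln y by rewrite ler_ln ?posrE.
  have : ln y <= 0 by rewrite ln_le0// ltW.
  rewrite lnV ?posrE//; move: (ln y) (ln 2) => u v; nra.
have e1 := expR_ge0 ((a - 1) * ln x); have e2 := expR_ge0 (- a * ln (1 - x)).
have a0' := a0; have a1' := a1.
rewrite -mulNr; have [x2|x2] := leP x 2^-1.
  have : expR (- a * ln (1 - x)) <= 2 by apply: key; lra.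
  by move: (expR ((a - 1) * _)) (expR (- a * _)) e1 e2 => u v u0 v0 H; nra.
have : expR ((a - 1) * ln x) <= 2 by apply: key; lra.
by move: (expR ((a - 1) * _)) (expR (- a * _)) e1 e2 => u v u0 v0 H; nra.
Qed.

Let B : R := \int[leb]_(y in I01) beta_weight a (1 - a) y.

Let BE : (\int[leb]_(y in I01) (w y)%:E)%E = B%:E.
Proof.
have <- : \int[leb]_(y in I01) w y = B.
  by apply: eq_Rintegral => y /set_mem/I_in h; rewrite beta_weightE.
by rewrite /Rintegral fineK//; exact: integrable_fin_num.
Qed.

(** Both exponents are negative, so the weight is at least 1 on ]0, 1[. *)
Let B_gt0 : 0 < B.
Proof.
suff : (1%:E <= B%:E)%E by rewrite lee_fin; exact: lt_le_trans.
rewrite -BE; apply: (@le_trans _ _ (\int[leb]_(y in I01) cst 1%:E y)%E).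
  rewrite integral_cst//.
  change (1%:E <= 1%:E * leb `]0%R, 1%R[)%E.
  by rewrite lebesgue_measure_itv/= lte_fin ltr01 sube0 mule1.
apply: ge0_le_integral => //.
- by apply/measurable_EFinP; exact: mw.
- move=> y /I_in/andP[y0 y1]; rewrite lee_fin -[leLHS]expR0 ler_expR.
  have l1 : ln y <= 0 by rewrite ln_le0// ltW.
  have l2 : ln (1 - y) <= 0 by rewrite ln_le0//; lra.
  by have := a0; have := a1; nra.
Qed.

Let bf := (fun x => beta_weight a (1 - a) x / B) \_ I01.

Let bf_ge0 x : 0 < x -> 0 <= bf x.
Proof.
move=> _; rewrite /bf patchE; case: ifPn => // /set_mem/I_in h.
by rewrite beta_weightE// divr_ge0// ltW.
Qed.

Let mbf (A : set (measurableTypeR R)) : measurable_fun A (bf : measurableTypeR R -> measurableTypeR R).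
Proof.
apply: measurable_funTS; apply/(measurable_restrictT _ mI).
by rewrite /beta_weight; meas.
Qed.

Let IDI : `]0, +oo[%classic `&` I01 = I01.
Proof. by apply/setIidr => x /I_in/andP[x0 _]; rewrite /= in_itv/= x0. Qed.

Let integral_bf (h : R -> R) : (\int[leb]_(x in `]0%R, +oo[) (h x * bf x)%:E =
  \int[leb]_(x in I01) (h x * (B^-1 * w x))%:E)%E.
Proof.
have E : (fun x => (h x * bf x)%:E) = (fun x => (h x * (beta_weight a (1 - a) x / B))%:E) \_ I01.
  apply/funext => x; rewrite /bf !patchE; case: ifP => // _; by rewrite mulr0.
rewrite (_ : (\int[leb]_(x in _) _)%E = (\int[leb]_(x in `]0%R, +oo[)
   ((fun x => (h x * (beta_weight a (1 - a) x / B))%:E) \_ I01) x)%E); last by rewrite -E.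
rewrite -integral_mkcondr IDI; apply: eq_integral => x /set_mem/I_in hx.
by rewrite beta_weightE// [w x * _]mulrC.
Qed.

Lemma beta_law_probability : exists P : probability (measurableTypeR R) R,
  beta_law a (1 - a) = P :> (set (measurableTypeR R) -> \bar R).
Proof.
apply: density_law_probability; [exact: bf_ge0|exact: mbf|].
transitivity (\int[leb]_(x in `]0%R, +oo[) (1 * bf x)%:E)%E.
  by apply: eq_integral => x _; rewrite mul1r.
rewrite (integral_bf (fun=> 1)).
transitivity (\int[leb]_(x in I01) ((B^-1)%:E * (w x)%:E))%E.
  by apply: eq_integral => x _; rewrite mul1r EFinM.
by rewrite (integralZl mI iw) BE -EFinM mulVf// gt_eqF.
Qed.

(* The substitution [y = F z x] multiplies the Beta(a, 1 - a) weight by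
   [(1 + z)^a / (1 + z x)]. *)
Let F z x : R := x * (1 + z) / (1 + z * x).

Let den z x : 0 <= z -> 0 < x < 1 -> 0 < 1 + z * x.
Proof. by move=> z0 /andP[x0 x1]; rewrite ltr_pwDl// mulr_ge0// ltW. Qed.

Let F01 z x : 0 <= z -> 0 < x < 1 -> 0 < F z x < 1.
Proof.
move=> z0 x01; have d := den z0 x01; case/andP: x01 => x0 x1.
have z1 : 0 < 1 + z by rewrite ltr_pwDl.
rewrite /F ltr_pdivrMr// mul1r divr_gt0 ?mulr_gt0//=.
by lra.
Qed.

Let dF z x : 0 <= z -> 0 < x < 1 -> is_derive x 1 (F z) ((1 + z) / (1 + z * x) ^+ 2).
Proof.
move=> z0 x01; have d := den z0 x01; have dN : 1 + z * x != 0 by rewrite gt_eqF.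
by rewrite /F; derl; rewrite /=; field.
Qed.

Let wF z x : 0 <= z -> 0 < x < 1 ->
  w (F z x) * ((1 + z) / (1 + z * x) ^+ 2) = expR (a * ln (1 + z)) * (w x * (1 + z * x)^-1).
Proof.
move=> z0 x01; have d := den z0 x01; case/andP: (x01) => x0 x1.
have z1 : 0 < 1 + z by rewrite ltr_pwDl.
have E1 : 1 - F z x = (1 - x) / (1 + z * x) by rewrite /F; field; rewrite gt_eqF.
have x1' : 0 < 1 - x by lra.
have -> : (1 + z) / (1 + z * x) ^+ 2 = expR (ln (1 + z) - (ln (1 + z * x) + ln (1 + z * x))).
  by rewrite expRD expRN expRD !lnK// expr2.
have -> : (1 + z * x)^-1 = expR (- ln (1 + z * x)) by rewrite expRN lnK.
rewrite /w E1 /F !lnM ?posrE ?mulr_gt0 ?invr_gt0// !lnV ?posrE// -!expRD.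
by congr expR; ring.
Qed.

Let moebius_segment z b1 b2 : 0 <= z -> 0 < b1 -> b1 <= b2 -> b2 < 1 ->
  (\int[leb]_(x in `[F z b1, F z b2]) (w x)%:E =
   \int[leb]_(x in `[b1, b2]) (expR (a * ln (1 + z)) * (w x * (1 + z * x)^-1))%:E)%E.
Proof.
move=> z0 b10 b12 b21.
have I x : x \in `[b1, b2] -> 0 < x < 1.
  by rewrite in_itv/= => /andP[h1 h2]; rewrite (lt_le_trans b10)//= (le_lt_trans h2).
have Io x : x \in `]b1, b2[ -> 0 < x < 1.
  by rewrite in_itv/= => /andP[h1 h2]; rewrite (lt_trans b10)//= (lt_trans h2).
have F'E x : 0 < x < 1 -> derive1 (F z) x = (1 + z) / (1 + z * x) ^+ 2.
  by move=> hx; rewrite derive1E; have [_ ->] := dF z0 hx.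
have I1 : b1 \in `[b1, b2] by rewrite in_itv/= lexx.
have I2 : b2 \in `[b1, b2] by rewrite in_itv/= lexx andbT.
have cF' x : 0 < x < 1 -> {for x, continuous (derive1 (F z))}.
  move=> hx; rewrite /prop_for /continuous_at F'E//.
  have d := den z0 hx; have dN : (1 + z * x) * (1 + z * x) != 0 by rewrite mulf_neq0// gt_eqF.
  have c : {for x, continuous (fun x => (1 + z) * ((1 + z * x) * (1 + z * x))^-1)} by contl.
  rewrite expr2; apply: cvg_trans c; apply: near_eq_cvg.
  have : \forall y \near x, y \in `]0, 1[ by apply: near_in_itvoo; rewrite in_itv.
  by apply: filterS => y; rewrite in_itv/= => hy; rewrite F'E// expr2.
have cF x : 0 < x < 1 -> {for x, continuous (F z)}.
  by move=> hx; exact: is_derive_continuous (dF z0 hx).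
rewrite integration_by_substitution_increasing//.
- by apply: eq_integral => x /set_mem xI; congr EFin; rewrite -wF ?I//= /GRing.mul/= F'E ?I.
- move=> x y /I hx /I hy xy; have dx := den z0 hx; have dy := den z0 hy.
  rewrite /F ltr_pdivrMr// mulrAC ltr_pdivlMr// -subr_gt0.
  rewrite (_ : _ - _ = (1 + z) * (y - x)); last by ring.
  by rewrite mulr_gt0 ?subr_gt0// ltr_pwDl.
- by move=> x /Io hx; exact: cF'.
- by apply: (cvgP (derive1 (F z) b1)); apply: cvg_at_right_filter; exact: cF' (I _ I1).
- by apply: (cvgP (derive1 (F z) b2)); apply: cvg_at_left_filter; exact: cF' (I _ I2).
- split.
  + by move=> x /Io hx; exact: @ex_derive _ _ _ _ _ _ _ (dF z0 hx).
  + by apply: cvg_at_right_filter; exact: cF (I _ I1).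
  + by apply: cvg_at_left_filter; exact: cF (I _ I2).
- apply: continuous_in_subspaceT => x /set_mem; rewrite /= in_itv/= => /andP[h1 h2].
  have /andP[f1 _] := F01 z0 (I _ I1); have /andP[_ f2] := F01 z0 (I _ I2).
  have x0 : 0 < x := lt_le_trans f1 h1.
  have x1 : 0 < 1 - x by rewrite subr_gt0 (le_lt_trans h2).
  by rewrite /w; contl.
Qed.

(** The substitution is made on segments inside ]0, 1[, where the weight is continuous; their images
    under [F z] exhaust ]0, 1[ again. *)
Let moebius z : 0 <= z ->
  B%:E = (\int[leb]_(x in I01) (expR (a * ln (1 + z)) * (w x * (1 + z * x)^-1))%:E)%E.
Proof.
move=> z0; rewrite -BE; pose u n := @harmonic R n / 2; pose v n := 1 - @harmonic R n / 2.
have hu : {homo u : m n / (m <= n)%N >-> n <= m}.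
  by move=> i j ij; rewrite /u ler_pM2r// harmonic_homo.
have hv : {homo v : m n / (m <= n)%N >-> m <= n}.
  by move=> i j ij; rewrite /v lerD2l lerN2 ler_pM2r// harmonic_homo.
have uv n : u n <= v n by have := @harmonic_le1 R n; rewrite /u /v; lra.
have u01 n : 0 < u n < 1.
  by have := @harmonic_le1 R n; have := @harmonic_gt0 R n; rewrite /u => ? ?; apply/andP; split; lra.
have v01 n : 0 < v n < 1.
  by have := @harmonic_le1 R n; have := @harmonic_gt0 R n; rewrite /v => ? ?; apply/andP; split; lra.
have Fh x y : 0 < x < 1 -> 0 < y < 1 -> x <= y -> F z x <= F z y.
  move=> hx hy xy; have dx := den z0 hx; have dy := den z0 hy.
  rewrite /F ler_pdivrMr// mulrAC ler_pdivlMr// -subr_ge0.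
  rewrite (_ : _ - _ = (1 + z) * (y - x)); last by ring.
  by rewrite mulr_ge0 ?subr_ge0// addr_ge0.
have IE : I01 = \bigcup_n `[F z (u n), F z (v n)]%classic.
  apply/seteqP; split => [y /I_in/andP[y0 y1]|y [n _]]; last first.
    rewrite /I01/= !in_itv/= => /andP[h1 h2].
    have /andP[f1 _] := F01 z0 (u01 n); have /andP[_ f2] := F01 z0 (v01 n).
    by rewrite (lt_le_trans f1)//= (le_lt_trans h2).
  (* The preimage of y under [F z]. *)
  pose x := y / (1 + z * (1 - y)).
  have dy : 0 < 1 + z * (1 - y) by rewrite ltr_pwDl// mulr_ge0// subr_ge0 ltW.
  have x01 : 0 < x < 1.
    rewrite divr_gt0//= ltr_pdivrMr// mul1r.
    by have : 0 < (1 + z) * (1 - y) by [rewrite mulr_gt0 ?subr_gt0// ltr_pwDl]; lra.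
  have : I01 x by rewrite /I01/= in_itv.
  rewrite /I01 itv01E => -[n _]; rewrite /= in_itv/= => /andP[h1 h2]; exists n => //.
  have <- : F z x = y.
    rewrite /F /x; field.
    have h : 1 + z * (1 - y) + z * y = 1 + z by ring.
    by rewrite h !gt_eqF// ltr_pwDl.
  rewrite /= in_itv/=; apply/andP; split; first exact: (Fh _ _ (u01 n) x01).
  exact: (Fh _ _ x01 (v01 n)).
have iK : leb.-integrable I01 (EFin \o (fun x => expR (a * ln (1 + z)) * (w x * (1 + z * x)^-1))).
  apply: (le_integrable mI _ _ (integrableZl mI (expR (a * ln (1 + z))) iw)).
    by apply/measurable_EFinP; have h := @mw I01; meas.
  move=> x /I_in hx; have d := den z0 hx.
  rewrite -EFinM lee_fin !normrM ler_wpM2l// ler_piMr//.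
  rewrite gtr0_norm ?invr_gt0// invf_le1// lerDl mulr_ge0//.
  by case/andP: hx => /ltW.
have [_ c] := @dominated_exhaust R (fun=> (fun x => expR (a * ln (1 + z)) * (w x * (1 + z * x)^-1)))
  (fun x => expR (a * ln (1 + z)) * (w x * (1 + z * x)^-1)) (fun x => `|expR (a * ln (1 + z)) * (w x * (1 + z * x)^-1)|)
  u v I01 0 hu hv itv01E
  (fun=> (measurable_EFinP _ _).1 (measurable_int _ iK)) ((measurable_EFinP _ _).1 (measurable_int _ iK))
  (integrable_abse iK) (fun t _ _ => @cvg_cst _ _ _ _ _) (fun n t _ _ => lexx _).
apply: (ge0_integral_exhaust (u := fun n => F z (u n)) (w := fun n => F z (v n)) _ _ IE) => //.
- by move=> i j ij; apply: Fh => //; exact: hu.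
- by move=> i j ij; apply: Fh => //; exact: hv.
- exact: mw.
- have E n : (\int[leb]_(x in `[F z (u n), F z (v n)]) (w x)%:E =
     \int[leb]_(x in `[u n, v n]) (expR (a * ln (1 + z)) * (w x * (1 + z * x)^-1))%:E)%E.
    case/andP: (u01 n) => h1 _; case/andP: (v01 n) => _ h2.
    exact: moebius_segment.
  by under eq_fun do rewrite E.
Qed.

(** By [moebius] the normalising constant is (1 + z)^a times the integral of the weight over 1 + z
    x, so it cancels and its value is never computed. *)
Lemma beta_law_stieltjes z : 0 <= z ->
  (\int[beta_law a (1 - a)]_(x in `[0%R, +oo[) ((1 + z * x)^-1)%:E = ((1 + z) `^ (- a))%:E)%E.
Proof.
move=> z0; have z1 : 0 < 1 + z by rewrite ltr_pwDl.
have DcD : `[0, +oo[%classic `&` `]0, +oo[%classic = `]0, +oo[%classic :> set R.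
  by apply/setIidr => x; rewrite /= !in_itv/= !andbT => /ltW.
have mDc : measurable (`[0, +oo[%classic : set (measurableTypeR R)) by exact: measurable_itv.
have [nu nuE] := density_law_measure bf_ge0 (@mbf _).
(* [integral_density_law] requires a nonnegative integrand on the whole line; the absolute value
   changes nothing on [0, oo[. *)
have -> : (\int[beta_law a (1 - a)]_(x in `[0%R, +oo[) ((1 + z * x)^-1)%:E =
    \int[density_law bf]_(x in `[0%R, +oo[) (`|(1 + z * x)^-1|)%:E)%E.
  rewrite /beta_law -/B -/bf nuE; apply: eq_integral => x /set_mem.
  rewrite /= in_itv/= andbT => x0; rewrite ger0_norm// invr_ge0 addr_ge0//.
  exact: mulr_ge0.
rewrite (integral_density_law bf_ge0 (@mbf _) mDc); last 2 first.
- by apply/measurable_EFinP; meas.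
- by move=> x; rewrite lee_fin.
rewrite DcD; under eq_integral do rewrite -EFinM.
rewrite (integral_bf (fun x => `|(1 + z * x)^-1|)).
pose C := expR (a * ln (1 + z)).
have C0 : 0 < C := expR_gt0 _.
pose k x := w x * (1 + z * x)^-1.
have ik : leb.-integrable I01 (EFin \o k).
  apply: (le_integrable mI _ _ iw).
    by apply/measurable_EFinP; rewrite /k; have h := @mw I01; meas.
  move=> x /I_in hx; have d := den z0 hx.
  rewrite lee_fin normrM ler_piMr// gtr0_norm ?invr_gt0// invf_le1// lerDl mulr_ge0//.
  by case/andP: hx => /ltW.
have E : (\int[leb]_(x in I01) (`|(1 + z * x)^-1| * (B^-1 * w x))%:E =
    (B^-1)%:E * \int[leb]_(x in I01) (k x)%:E)%E.
  rewrite -(integralZl mI ik); apply: eq_integral => x /set_mem/I_in hx.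
  have d := den z0 hx; rewrite gtr0_norm ?invr_gt0// -EFinM /k; congr EFin.
  by move: (w x) ((1 + z * x)^-1) => p q; ring.
have M : (C%:E * \int[leb]_(x in I01) (k x)%:E = B%:E)%E.
  by rewrite -(integralZl mI ik) (moebius z0).
have fk : (\int[leb]_(x in I01) (k x)%:E)%E \is a fin_num by exact: integrable_fin_num.
rewrite E; move: M; rewrite -(fineK fk) -!EFinM => -[M]; congr EFin.
rewrite -M /powR gt_eqF// mulNr expRN -/C invfM.
by rewrite -mulrA mulVf ?mulr1// gt_eqF// -(pmulr_rgt0 _ C0) M.
Qed.

End beta.

(** * The product representations *)

Section product_laws.
Context {R : realType}.
Local Notation leb := (@lebesgue_measure R).
Local Notation law := (probability (measurableTypeR R) R).
Variables (al theta : R) (H : law).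
Hypotheses (al0 : 0 < al) (al1 : al < 1) (theta0 : 0 < theta) (altheta1 : al * theta < 1)
  (Hpos : H `]-oo, 0]%classic = 0%E)
  (Hlog : (\int[H]_(x in `]0%R, +oo[) (ln (1 + x))%:E < +oo)%E).
Implicit Types x y lam : R.
Let D : set (measurableTypeR R) := `]0, +oo[%classic.
Let Dc : set (measurableTypeR R) := `[0, +oo[%classic.
Let mDc : measurable Dc. Proof. exact: measurable_itv. Qed.
Let neg : set (measurableTypeR R) := `]-oo, 0[%classic.
Let mneg : measurable neg. Proof. exact: measurable_itv. Qed.
Let DcD : Dc `&` D = D.
Proof. by apply/setIidr => x; rewrite /D /Dc/= !in_itv/= !andbT => /ltW. Qed.
Let D_gt0 x : D x -> 0 < x. Proof. by rewrite /D/= in_itv/= andbT. Qed.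
Let Dc_ge0 x : Dc x -> 0 <= x. Proof. by rewrite /Dc/= in_itv/= andbT. Qed.

Lemma pos_law_mass : H `]0, +oo[%classic = 1%E.
Proof.
have mN : measurable (`]-oo, 0]%classic : set (measurableTypeR R)) by exact: measurable_itv.
have -> : `]0, +oo[%classic = ~` `]-oo, 0]%classic :> set (measurableTypeR R).
  apply/seteqP; split => x; rewrite /= !in_itv/= andbT.
    by rewrite ltNge => /negP.
  by move/negP; rewrite -ltNge.
by rewrite probability_setC// [X in (_ - X)%E]Hpos sube0.
Qed.

Let log_meanE lam : 0 < lam ->
  (\int[H]_(x in Dc) (ln (1 + lam `^ al * x))%:E = (log_mean al H lam)%:E)%E.
Proof.
move=> l0; rewrite integral_pos_support//; first exact: log_mean_EFin.
  by apply/measurable_EFinP; meas.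
by move=> x x0; rewrite lee_fin ln_ge0// lerDl mulr_ge0 ?powR_ge0.
Qed.

Lemma dirichlet_mean_root_stieltjes (tau : R) (Mt : law) lam :
  dirichlet_mean_law tau H Mt -> 0 < lam ->
  (\int[Mt]_(w in Dc) ((1 + lam `^ al * w) `^ (- tau))%:E =
   (expR (- (tau * log_mean al H lam)))%:E)%E.
Proof.
move=> [_ hM] l0; rewrite (hM (lam `^ al)) ?powR_gt0// log_meanE//.
Qed.

Lemma rho_ge0 y : 0 < y -> 0 <= rho al y.
Proof. by move=> y0; rewrite (rho_ratio_density al0 al1)// ratio_density_ge0. Qed.

Lemma measurable_rho (A : set (measurableTypeR R)) :
  measurable_fun A (rho al : measurableTypeR R -> measurableTypeR R).
Proof. by rewrite /rho; meas. Qed.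

Let integral_rho (h : measurableTypeR R -> R) : measurable_fun setT (h : measurableTypeR R -> measurableTypeR R) ->
  (forall x, 0 <= x -> 0 <= h x) ->
  (\int[density_law (rho al)]_(x in Dc) (h x)%:E =
   \int[leb]_(y in D) (ratio_density al 1 y * h y)%:E)%E.
Proof.
move=> mh h0; have [nu nuE] := density_law_measure rho_ge0 (@measurable_rho D).
transitivity (\int[density_law (rho al)]_(x in Dc) (`|h x|)%:E)%E.
  by rewrite nuE; apply: eq_integral => y /set_mem/Dc_ge0 y0; rewrite ger0_norm// h0.
rewrite (integral_density_law rho_ge0 (@measurable_rho D) mDc); last 2 first.
- by apply/measurable_EFinP; exact: measurable_fun_norm.
- by move=> x; rewrite lee_fin.
rewrite DcD; apply: eq_integral => y /set_mem/D_gt0 y0.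
by rewrite ger0_norm ?h0 ?ltW// (rho_ratio_density al0 al1)// -EFinM mulrC.
Qed.

Lemma rho_stieltjes lam : 0 <= lam ->
  (\int[density_law (rho al)]_(x in Dc) ((1 + lam * x)^-1)%:E = ((1 + lam `^ al)^-1)%:E)%E.
Proof.
move=> l0; rewrite (integral_rho (h := fun x => (1 + lam * x)^-1)); last 2 first.
- by meas.
- by move=> x x0; rewrite invr_ge0 addr_ge0// mulr_ge0.
move: l0; rewrite le_eqVlt => /predU1P[<-|l0].
  rewrite powR0 ?gt_eqF// addr0 invr1 -(integral_ratio_density al0 al1 ltr01).
  by apply: eq_integral => y _; rewrite mul0r addr0 invr1 mulr1.
by rewrite (recip_ratio_density al0 al1 ltr01 l0) mulr1.
Qed.

Lemma rho_probability : exists P : law,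
  density_law (rho al) = P :> (set (measurableTypeR R) -> \bar R).
Proof.
apply: density_law_probability; [exact: rho_ge0|exact: measurable_rho|].
rewrite -(integral_ratio_density al0 al1 ltr01).
by apply: eq_integral => y /set_mem/D_gt0 y0; rewrite (rho_ratio_density al0 al1).
Qed.

Lemma density_law_neg (f : R -> R) : density_law f neg = 0%E.
Proof.
rewrite /density_law; have -> : neg `&` `]0, +oo[%classic = set0 :> set R.
  apply/seteqP; split => x //=; rewrite /neg/= !in_itv/= andbT => -[h1 h2].
  by have := lt_trans h1 h2; rewrite ltxx.
by rewrite integral_set0.
Qed.

(** The shape al theta cancels the factor 1/al of E log (1 + lam X_al). The value lam = 0, outside
    the characterization, occurs because lam w^(1/al) vanishes at w = 0. *)
Lemma mean_rho_power (My : law) lam :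
  dirichlet_mean_law (al * theta) (density_law (rho al)) My -> 0 <= lam ->
  (\int[My]_(y in Dc) ((1 + lam * y) `^ (- (al * theta)))%:E =
   ((1 + lam `^ al) `^ (- theta))%:E)%E.
Proof.
move=> [My0 hM]; rewrite le_eqVlt => /predU1P[<-|l0].
  rewrite powR0 ?gt_eqF// addr0 powR1.
  transitivity (\int[My]_(y in Dc) cst 1%:E y)%E.
    by apply: eq_integral => y _; rewrite mul0r addr0 powR1.
  rewrite (integral_nonneg_support My0)//.
  by rewrite integral_cst// mul1e; exact: probability_setT.
rewrite (hM lam l0) (integral_rho (h := fun x => ln (1 + lam * x))); last 2 first.
- by meas.
- by move=> x x0; rewrite ln_ge0// lerDl mulr_ge0// ltW.
have [_ ->] := log1p_ratio_density al0 al1 ltr01 l0.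
rewrite mulr1 -EFinM/=; congr EFin.
have h : 0 < 1 + lam `^ al by rewrite addr_gt0// powR_gt0.
have -> : (1 + lam `^ al) `^ (- theta) = expR (- theta * ln (1 + lam `^ al)).
  by rewrite /powR gt_eqF.
congr expR; move: (ln _) => L; field; rewrite gt_eqF//.
Qed.

(** The kernel of [stieltjes_measure_unique] for the exponent 1. As powers are nonnegative for every
    real base, [k] is nonnegative on the whole line, unlike (1 + lam x)^-1. *)
Let k lam x : R := (1 + lam * x `^ 1)^-1.
Let k_ge0 lam x : 0 < lam -> 0 <= k lam x.
Proof. by move=> l0; rewrite invr_ge0 addr_ge0// mulr_ge0 ?powR_ge0// ltW. Qed.
Let kE lam x : 0 <= x -> k lam x = (1 + lam * x)^-1.
Proof. by move=> x0; rewrite /k powRr1. Qed.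
Let mk lam d (T : measurableType d) (A : set T) (f : T -> measurableTypeR R) :
  measurable_fun A f -> measurable_fun A (fun t => (k lam (f t))%:E).
Proof. by move=> mf; apply/measurable_EFinP; rewrite /k; meas. Qed.

Let rootE lam x : 0 < lam -> 0 <= x -> (lam * x `^ al^-1) `^ al = lam `^ al * x.
Proof.
move=> l0 x0; rewrite powRM ?powR_ge0 ?(ltW l0)// -powRrM mulVf ?gt_eqF//.
by rewrite powRr1.
Qed.

Section root_product.
Variables P W : law.
Hypotheses (P0 : P neg = 0%E) (W0 : W neg = 0%E).
Let phi (w : measurableTypeR R * measurableTypeR R) : measurableTypeR R := w.1 * w.2 `^ al^-1.
Let mphi : measurable_fun setT phi. Proof. by rewrite /phi; meas. Qed.
Let nu : {measure set (measurableTypeR R) -> \bar R} :=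
  measure_function_pushforward__canonical__measure_function_Measure (P \x W)%E mphi.

(** A negative product forces a negative first factor, the power being nonnegative. *)
Let nu_neg : nu neg = 0%E.
Proof.
have sub : phi @^-1` neg `<=` neg `*` setT.
  move=> [x y]; rewrite /neg/= !in_itv/= => h; split => //.
  rewrite ltNge; apply/negP => x0; move: h; rewrite ltNge => /negP; apply.
  by rewrite mulr_ge0 ?powR_ge0.
have mS : measurable (neg `*` setT : set (measurableTypeR R * measurableTypeR R)) by exact: measurableX.
have mpre : measurable (phi @^-1` neg) by rewrite -[X in measurable X]setTI; exact: mphi.
have E1 : ((P \x W)%E (neg `*` setT) <= 0)%E.
  by rewrite product_measure1E// [X in (X * _)%E]P0 mul0e.
apply/eqP; rewrite -measure_le0.
exact: (le_trans (le_measure (P \x W)%E (mem_set mpre) (mem_set mS) sub) E1).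
Qed.

(** Uniqueness reduces the equality of laws to that of transforms; Tonelli with the nonnegative
    kernel [k] splits the transform of the pushforward into iterated integrals. *)
Lemma root_product_law (M : law) : M neg = 0%E ->
  (forall lam, 0 < lam -> (\int[M]_(x in Dc) ((1 + lam * x)^-1)%:E =
    \int[W]_(w in Dc) \int[P]_(x in Dc) ((1 + lam * w `^ al^-1 * x)^-1)%:E)%E) ->
  forall A, measurable A -> M A = prod_root_law al P W A.
Proof.
move=> M0 hM A mA; change (M A = nu A).
apply: (stieltjes_measure_unique ltr01 M0 nu_neg) => // lam l0.
transitivity (\int[M]_(x in Dc) ((1 + lam * x)^-1)%:E)%E.
  by apply: eq_integral => x /set_mem/Dc_ge0 x0; rewrite -/(k lam x) kE.
rewrite hM//.
have mkid : measurable_fun setT (fun x : measurableTypeR R => (k lam x)%:E) by exact: mk.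
have k0 x : (0 <= (k lam x)%:E)%E by rewrite lee_fin k_ge0.
pose F (w : measurableTypeR R * measurableTypeR R) := (k lam (phi w))%:E.
have mF : measurable_fun setT F by exact: mk.
have F0 w : (0 <= F w)%E by exact: k0.
transitivity (\int[nu]_(x in Dc) (k lam x)%:E)%E; last by [].
rewrite (integral_nonneg_support nu_neg)//.
transitivity (\int[(P \x W)%E]_w F w)%E; last first.
  by rewrite (ge0_integral_pushforward mphi)//.
rewrite (fubini_tonelli2 F mF F0).
rewrite -(integral_nonneg_support W0); last 2 first.
- exact: (measurable_fun_fubini_tonelli_G F mF F0).
- by move=> w; apply: integral_ge0.
apply: eq_integral => w /set_mem/Dc_ge0 w0; rewrite /fubini_G.
have mh : measurable_fun setT (fun x : measurableTypeR R => F (x, w)).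
  exact: (measurableT_comp mF (measurable_pair2 w)).
transitivity (\int[P]_x F (x, w))%E; last by [].
rewrite -(integral_nonneg_support P0 mh (fun x => F0 (x, w))).
apply: eq_integral => x /set_mem/Dc_ge0 x0.
by rewrite /F/= kE ?mulr_ge0 ?powR_ge0// /phi/= -mulrA [x * _]mulrC.
Qed.

End root_product.

Section root_product3.
Variables B Y W : law.
Hypotheses (B0 : B neg = 0%E) (Y0 : Y neg = 0%E) (W0 : W neg = 0%E).
Let phi (w : measurableTypeR R * (measurableTypeR R * measurableTypeR R)) : measurableTypeR R :=
  w.1 * w.2.1 * w.2.2 `^ al^-1.
Let mphi : measurable_fun setT phi.
Proof.
have m2 : measurable_fun setT (fun w : measurableTypeR R * (measurableTypeR R * measurableTypeR R) => w.2.1 : measurableTypeR R).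
  by apply: (measurableT_comp measurable_fst); exact: measurable_snd.
have m3 : measurable_fun setT (fun w : measurableTypeR R * (measurableTypeR R * measurableTypeR R) => w.2.2 : measurableTypeR R).
  by apply: (measurableT_comp measurable_snd); exact: measurable_snd.
apply: measurable_fun_mul; last exact: measurable_fun_powR.
by apply: measurable_fun_mul => //; exact: measurable_fst.
Qed.
Let YW : probability (measurableTypeR R * measurableTypeR R)%type R := (Y \x W)%E.
Let nu : {measure set (measurableTypeR R) -> \bar R} :=
  measure_function_pushforward__canonical__measure_function_Measure (B \x YW)%E mphi.

Let nu_neg : nu neg = 0%E.
Proof.
pose S1 : set (measurableTypeR R * (measurableTypeR R * measurableTypeR R)) := neg `*` setT.
pose S2 : set (measurableTypeR R * (measurableTypeR R * measurableTypeR R)) := setT `*` (neg `*` setT).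
have mS1 : measurable S1 by exact: measurableX.
have mS2 : measurable S2 by apply: measurableX => //; exact: measurableX.
have sub : phi @^-1` neg `<=` S1 `|` S2.
  move=> [x [y z]]; rewrite /phi /neg/= in_itv/= => h.
  have [x0|x0] := ltP x 0; first by left; rewrite /S1/= /neg/= in_itv.
  have [y0|y0] := ltP y 0; first by right; rewrite /S2/= /neg/= in_itv.
  by exfalso; move: h; rewrite ltNge => /negP; apply; rewrite !mulr_ge0 ?powR_ge0.
have mpre : measurable (phi @^-1` neg) by rewrite -[X in measurable X]setTI; exact: mphi.
have E1 : (B \x YW)%E S1 = 0%E.
  by rewrite product_measure1E// [X in (X * _)%E]B0 mul0e.
have YW0 : YW (neg `*` setT) = 0%E.
  by change ((Y \x W)%E (neg `*` setT) = 0%E); rewrite product_measure1E// [X in (X * _)%E]Y0 mul0e.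
have E2 : (B \x YW)%E S2 = 0%E.
  rewrite product_measure1E//; last exact: measurableX.
  by rewrite [X in (_ * X)%E]YW0 mule0.
have E3 : ((B \x YW)%E S1 + (B \x YW)%E S2 <= 0)%E by rewrite E1 E2 adde0.
apply/eqP; rewrite -measure_le0.
apply: (le_trans (le_measure (B \x YW)%E (mem_set mpre) (mem_set (measurableU _ _ mS1 mS2)) sub)).
exact: (le_trans (measureU2 _ mS1 mS2) E3).
Qed.

Lemma root_product3_law (M : law) : M neg = 0%E ->
  (forall lam, 0 < lam -> (\int[M]_(x in Dc) ((1 + lam * x)^-1)%:E =
    \int[W]_(w in Dc) \int[Y]_(y in Dc) \int[B]_(b in Dc)
       ((1 + lam * w `^ al^-1 * y * b)^-1)%:E)%E) ->
  forall A, measurable A -> M A = prod3_root_law al B Y W A.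
Proof.
move=> M0 hM A mA; change (M A = nu A).
apply: (stieltjes_measure_unique ltr01 M0 nu_neg) => // lam l0.
transitivity (\int[M]_(x in Dc) ((1 + lam * x)^-1)%:E)%E.
  by apply: eq_integral => x /set_mem/Dc_ge0 x0; rewrite -/(k lam x) kE.
rewrite hM//.
have mkid : measurable_fun setT (fun x : measurableTypeR R => (k lam x)%:E) by exact: mk.
have k0 x : (0 <= (k lam x)%:E)%E by rewrite lee_fin k_ge0.
pose F (w : measurableTypeR R * (measurableTypeR R * measurableTypeR R)) := (k lam (phi w))%:E.
have mF : measurable_fun setT F by exact: mk.
have F0 w : (0 <= F w)%E by exact: k0.
transitivity (\int[nu]_(x in Dc) (k lam x)%:E)%E; last by [].
rewrite (integral_nonneg_support nu_neg)//.
transitivity (\int[(B \x YW)%E]_w F w)%E; last first.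
  by rewrite (ge0_integral_pushforward mphi)//.
rewrite (fubini_tonelli2 F mF F0).
pose G (v : measurableTypeR R * measurableTypeR R) := (\int[B]_b F (b, v))%E.
have mG : measurable_fun setT G by exact: (measurable_fun_fubini_tonelli_G F mF F0).
have G0 v : (0 <= G v)%E by apply: integral_ge0.
transitivity (\int[(Y \x W)%E]_v G v)%E; last by [].
rewrite (fubini_tonelli2 G mG G0).
rewrite -(integral_nonneg_support W0); last 2 first.
- exact: (measurable_fun_fubini_tonelli_G G mG G0).
- by move=> w; apply: integral_ge0.
apply: eq_integral => w /set_mem/Dc_ge0 w0; rewrite /fubini_G.
have mh : measurable_fun setT (fun y : measurableTypeR R => G (y, w)).
  exact: (measurableT_comp mG (measurable_pair2 w)).
transitivity (\int[Y]_y G (y, w))%E; last by [].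
rewrite -(integral_nonneg_support Y0 mh (fun y => G0 (y, w))).
apply: eq_integral => y /set_mem/Dc_ge0 y0; rewrite /G.
have mh2 : measurable_fun setT (fun b : measurableTypeR R => F (b, (y, w))).
  exact: (measurableT_comp mF (measurable_pair2 (y, w))).
rewrite -(integral_nonneg_support B0 mh2 (fun b => F0 (b, (y, w)))).
apply: eq_integral => b /set_mem/Dc_ge0 b0.
rewrite /F/= kE ?mulr_ge0 ?powR_ge0// /phi/=; congr (_^-1)%:E.
by ring.
Qed.

End root_product3.

Lemma dirichlet_mean_rhoH_prod3 (M My Mt : law) :
  dirichlet_mean_law 1 (mix_zero (al * theta) (density_law (rhoH al H))) M ->
  dirichlet_mean_law (al * theta) (density_law (rho al)) My ->
  dirichlet_mean_law theta H Mt ->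
  forall A, measurable A ->
    M A = prod3_root_law al (beta_law (al * theta) (1 - al * theta)) My Mt A.
Proof.
move=> hM hY hW A mA; have a01 : 0 < al * theta < 1 by rewrite mulr_gt0.
have [B BE] := beta_law_probability a01; rewrite BE.
apply: root_product3_law => //; [by rewrite -BE; exact: density_law_neg|exact: hY.1|exact: hW.1|exact: hM.1|].
move=> lam l0; rewrite (dirichlet_mean_rhoH_stieltjes al0 al1 theta0 altheta1 Hlog hM l0).
rewrite -(dirichlet_mean_root_stieltjes hW l0); apply: eq_integral => w /set_mem/Dc_ge0 w0.
have lw0 : 0 <= lam * w `^ al^-1 by rewrite mulr_ge0 ?powR_ge0// ltW.
rewrite -rootE// -(mean_rho_power hY lw0); apply: eq_integral => y /set_mem/Dc_ge0 y0.
by rewrite -BE beta_law_stieltjes// mulr_ge0.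
Qed.

End product_laws.

(** * The case theta = 1 *)

Section theta_one.
Context {R : realType}.
Local Notation leb := (@lebesgue_measure R).
Local Notation law := (probability (measurableTypeR R) R).
Variables (al : R) (H : law).
Hypotheses (al0 : 0 < al) (al1 : al < 1)
  (Hpos : H `]-oo, 0]%classic = 0%E)
  (Hlog : (\int[H]_(x in `]0%R, +oo[) (ln (1 + x))%:E < +oo)%E).
Let D : set (measurableTypeR R) := `]0, +oo[%classic.
Let Dc : set (measurableTypeR R) := `[0, +oo[%classic.
Let mD : measurable D. Proof. exact: measurable_itv. Qed.
Let mDc : measurable Dc. Proof. exact: measurable_itv. Qed.
Let D_gt0 x : D x -> 0 < x. Proof. by rewrite /D/= in_itv/= andbT. Qed.
Let Dc_ge0 x : Dc x -> 0 <= x. Proof. by rewrite /Dc/= in_itv/= andbT. Qed.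
Let DcD : Dc `&` D = D.
Proof. by apply/setIidr => x; rewrite /D /Dc/= !in_itv/= !andbT => /ltW. Qed.

Variables M M1 : law.
Hypotheses (hM : dirichlet_mean_law 1 (mix_zero al (density_law (rhoH al H))) M)
  (hM1 : dirichlet_mean_law 1 H M1).

(** Both sides equal exp(- [log_mean al H lam]), because the exponent in the characterization of
    M_1(H) is 1 as well. *)
Let stieltjes_M lam : 0 < lam ->
  (\int[M]_(x in Dc) ((1 + lam * x)^-1)%:E = \int[M1]_(w in Dc) ((1 + lam `^ al * w)^-1)%:E)%E.
Proof.
move=> l0; have hM' : dirichlet_mean_law 1 (mix_zero (al * 1) (density_law (rhoH al H))) M by rewrite mulr1.
have a1 : al * 1 < 1 by rewrite mulr1.
rewrite (dirichlet_mean_rhoH_stieltjes al0 al1 ltr01 a1 Hlog hM' l0).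
rewrite -(dirichlet_mean_root_stieltjes al0 al1 Hpos Hlog hM1 l0).
apply: eq_integral => w /set_mem/Dc_ge0 w0.
by rewrite powR_inv1// addr_ge0// mulr_ge0 ?powR_ge0.
Qed.

Lemma dirichlet_mean_rhoH_prod A : measurable A ->
  M A = prod_root_law al (density_law (rho al)) M1 A.
Proof.
move=> mA; have [P PE] := rho_probability al0 al1; rewrite PE.
apply: root_product_law => //; [by rewrite -PE density_law_neg|exact: hM1.1|exact: hM.1|].
move=> lam l0; rewrite stieltjes_M//; apply: eq_integral => w /set_mem/Dc_ge0 w0.
have lw0 : 0 <= lam * w `^ al^-1 by rewrite mulr_ge0 ?powR_ge0// ltW.
rewrite -PE rho_stieltjes// powRM ?powR_ge0 ?(ltW l0)// -powRrM mulVf ?gt_eqF//.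
by rewrite powRr1.
Qed.

(** Given the value r of M_1(H), the product X_al r^(1/al) has density [ratio_density al r].
    Averaging [recip_ratio_density] over r gives the right side of [stieltjes_M]. *)
Lemma dirichlet_mean_rhoH_mixture_density (f : R -> R) : has_density M1 f ->
  has_density M (fun x => sin (pi * al) / pi *
    \int[lebesgue_measure]_(r in `]0, +oo[) (rho_kernel al x r * f r)).
Proof.
move=> [f0 mf fE].
have f1 : (\int[leb]_(r in D) (f r)%:E = 1)%E.
  have := fE setT measurableT; rewrite /density_law setTI => <-.
  exact: probability_setT.
have if_ : leb.-integrable D (EFin \o f).
  by apply: (integrable_of_finite mf _ f1) => x /D_gt0; exact: f0.
(* [f] is measurable on ]0, oo[ only; its extension by 0 gives joint measurability on the plane. *)
pose fD := f \_ D.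
have mfD : measurable_fun setT (fD : measurableTypeR R -> measurableTypeR R).
  exact/(measurable_restrictT _ mD).
have fDE r : D r -> fD r = f r by move=> Dr; rewrite /fD patchE mem_set.
pose g x := \int[leb]_(r in D) (ratio_density al r x * f r).
have alpi : `|al * pi| < pi.
  by rewrite ger0_norm ?mulr_ge0 ?pi_ge0 ?(ltW al0)// gtr_pMl// pi_gt0.
have ig x : 0 < x -> leb.-integrable D (EFin \o (fun r => ratio_density al r x * f r)).
  (* For fixed x the ratio density is bounded in r, so a multiple of [f] dominates. *)
  move=> x0; pose C := pi^-1 * (x^-1 * (cos (al * pi / 2)) ^- 2).
  apply: (le_integrable mD _ _ (integrableZl mD C if_)).
    apply/measurable_EFinP; apply: measurable_fun_mul; last exact: mf.
    by apply: measurable_ratio_density; meas.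
  move=> r _; rewrite -EFinM lee_fin [leLHS]normrM [leRHS]normrM ler_wpM2r//.
  rewrite (le_trans _ (ler_norm C))// /ratio_density /C.
  rewrite normrM gtr0_norm ?invr_gt0 ?pi_gt0// ler_pM2l ?invr_gt0 ?pi_gt0//.
  rewrite normrM gtr0_norm ?invr_gt0// ler_pM2l ?invr_gt0//.
  by have [] := dlog_bound (al * ln x - ln r) alpi.
have g0 x : 0 < x -> 0 <= g x.
  by move=> x0; apply: Rintegral_ge0 => r /D_gt0 r0; rewrite mulr_ge0 ?f0// ratio_density_ge0.
have gfin x : 0 < x -> (g x)%:E = (\int[leb]_(r in D) (ratio_density al r x * f r)%:E)%E.
  by move=> x0; rewrite /g /Rintegral fineK//; apply: integrable_fin_num => //; exact: ig.
have mg (A : set (measurableTypeR R)) : measurable_fun A (g : measurableTypeR R -> measurableTypeR R).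
  apply: measurable_funTS.
  have -> : g = (fun x => \int[leb]_(r in D) (ratio_density al r x * fD r)).
    by apply/funext => x; apply: eq_Rintegral => r /set_mem Dr; rewrite fDE.
  apply: (@measurable_fun_Rintegral _ leb D mD _ _ (fun x r => ratio_density al r x * fD r)).
  apply: measurable_fun_mul; first by apply: measurable_ratio_density; meas.
  exact: measurableT_comp mfD measurable_snd.
have sin0 : 0 < sin (pi * al).
  apply: sin_gt0_pi; rewrite mulrC mulr_gt0 ?pi_gt0//=.
  by move: alpi; rewrite gtr0_norm// mulr_gt0 ?pi_gt0.
have E x : 0 < x -> sin (pi * al) / pi *
    \int[leb]_(r in D) (rho_kernel al x r * f r) = g x.
  move=> x0; have c0 : 0 < sin (pi * al) / pi by rewrite divr_gt0// pi_gt0.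
  have -> : \int[leb]_(r in D) (rho_kernel al x r * f r) =
     \int[leb]_(r in D) ((sin (pi * al) / pi)^-1 * (ratio_density al r x * f r)).
    apply: eq_Rintegral => r /set_mem/D_gt0 r0.
    by rewrite -(ratio_densityE al0 al1 r0 x0) -[_ / _ * _ * f r]mulrA mulKf// gt_eqF.
  rewrite RintegralZl//; last exact: ig.
  by rewrite mulVKf// gt_eqF.
split.
- by move=> x x0; rewrite E// g0.
- apply: (eq_measurable_fun g); last exact: mg.
  by move=> x /set_mem/D_gt0 x0; rewrite E.
- move=> A mA; have -> : density_law (fun x => sin (pi * al) / pi *
     \int[lebesgue_measure]_(r in `]0, +oo[) (rho_kernel al x r * f r)) A = density_law g A.
    by apply: eq_integral => x /set_mem[_ /D_gt0 x0]; rewrite E.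
  have [nu nuE] := density_law_measure g0 (mg D).
  have nu0 : nu `]-oo, 0[%classic = 0%E by rewrite -nuE density_law_neg.
  rewrite nuE; apply: (stieltjes_measure_unique ltr01 hM.1 nu0) => // lam l0.
  have P0 x : 0 < 1 + lam * x `^ 1 by rewrite ltr_pwDl// mulr_ge0 ?powR_ge0 ?ltW.
  transitivity (\int[M]_(x in Dc) ((1 + lam * x)^-1)%:E)%E.
    by apply: eq_integral => x /set_mem/Dc_ge0 x0; rewrite powRr1.
  rewrite stieltjes_M//.
  have la0 : 0 < lam `^ al by rewrite powR_gt0.
  transitivity (\int[density_law f]_(w in Dc) (`|(1 + lam `^ al * w)^-1|)%:E)%E.
    have [mu muE] := density_law_measure f0 mf; rewrite muE.
    have -> : (\int[M1]_(w in Dc) ((1 + lam `^ al * w)^-1)%:E =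
        \int[mu]_(w in Dc) ((1 + lam `^ al * w)^-1)%:E)%E.
      apply: eq_measure_integral => S mS _; have hS : M1 S = mu S by rewrite fE// muE.
      exact: hS.
    apply: eq_integral => w /set_mem/Dc_ge0 w0; rewrite ger0_norm//.
    by rewrite invr_ge0 addr_ge0// mulr_ge0// ltW.
  rewrite (integral_density_law f0 mf mDc); last 2 first.
  - by apply/measurable_EFinP; meas.
  - by move=> x; rewrite lee_fin.
  rewrite -nuE (integral_density_law g0 (mg D) mDc); last 2 first.
  - by apply/measurable_EFinP; meas.
  - by move=> x; rewrite lee_fin invr_ge0 ltW.
  rewrite DcD.
  pose F (w : measurableTypeR R * measurableTypeR R) : \bar R :=
    (ratio_density al w.2 w.1 * fD w.2 * (1 + lam * w.1 `^ 1)^-1)%:E.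
  have mF : measurable_fun setT F.
    apply/measurable_EFinP; apply: measurable_fun_mul; last by meas.
    apply: measurable_fun_mul; first by apply: measurable_ratio_density; meas.
    exact: measurableT_comp mfD measurable_snd.
  transitivity (\int[leb]_(r in D) \int[leb]_(x in D) F (x, r))%E.
    apply: eq_integral => r /set_mem Dr; have r0 := D_gt0 Dr.
    rewrite ger0_norm; last by rewrite invr_ge0 addr_ge0// mulr_ge0 ?ltW//.
    rewrite -(recip_ratio_density al0 al1 r0 l0) muleC -ge0_integralZl//.
    - apply: eq_integral => x /set_mem/D_gt0 x0; rewrite -EFinM /F/= fDE//.
      by rewrite powRr1 ?(ltW x0)//; congr EFin; ring.
    - apply/measurable_EFinP; apply: measurable_fun_mul; last by meas.
      by apply: measurable_ratio_density; meas.
    - move=> x /D_gt0 x0; rewrite lee_fin mulr_ge0 ?ratio_density_ge0//.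
      by rewrite invr_ge0 addr_ge0// mulr_ge0 ?ltW//.
    - by rewrite lee_fin f0.
  rewrite -tonelli_rect//; last first.
    move=> x r /D_gt0 x0 Dr; rewrite lee_fin fDE// mulr_ge0 ?invr_ge0 ?(ltW (P0 x))//.
    by rewrite mulr_ge0 ?ratio_density_ge0// f0// D_gt0.
  apply: eq_integral => x /set_mem/D_gt0 x0; rewrite gfin// -ge0_integralZl//.
  - by apply: eq_integral => r /set_mem Dr; rewrite /F/= fDE// -EFinM mulrC.
  - by apply/measurable_EFinP; case/integrableP: (ig x x0) => /measurable_EFinP.
  - by move=> r /D_gt0 r0; rewrite lee_fin mulr_ge0 ?ratio_density_ge0// f0.
  - by rewrite lee_fin invr_ge0 ltW.
Qed.

End theta_one.

Theorem theorem5p2 (R : realType) (al theta : R)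
    (H : probability (measurableTypeR R) R)
    (al01 : 0 < al < 1) (theta0 : 0 < theta) (altheta01 : 0 < al * theta < 1)
    (Hpos : H `]-oo, 0]%classic = 0%E)
    (Hlog : (\int[H]_(x in `]0%R, +oo[) (ln (1 + x))%:E < +oo)%E) :
  (forall M : probability (measurableTypeR R) R,
    dirichlet_mean_law 1 (mix_zero (al * theta) (density_law (rhoH al H))) M ->
    (forall My Mt : probability (measurableTypeR R) R,
      dirichlet_mean_law (al * theta) (density_law (rho al)) My ->
      dirichlet_mean_law theta H Mt ->
      forall A, measurable A ->
        M A = prod3_root_law al
                (beta_law (al * theta) (1 - al * theta)) My Mt A) /\
    has_density M (fun x =>
      pi^-1 * sin (pi * theta * al * (1 - Upsilon al H x)) *
      expR (- (theta * al * logpot al H x)) * x `^ (al * theta - 1))) /\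
  (theta = 1 ->
    forall M M1 : probability (measurableTypeR R) R,
    dirichlet_mean_law 1 (mix_zero al (density_law (rhoH al H))) M ->
    dirichlet_mean_law 1 H M1 ->
    (forall A, measurable A ->
      M A = prod_root_law al (density_law (rho al)) M1 A) /\
    (forall f : R -> R, has_density M1 f ->
      has_density M (fun x => sin (pi * al) / pi *
        \int[lebesgue_measure]_(r in `]0, +oo[) (rho_kernel al x r * f r)))).
Proof.
case/andP: al01 => al0 al1; case/andP: altheta01 => _ altheta1.
split.
  move=> M hM; split; first by move=> My Mt hY hW A mA; exact: dirichlet_mean_rhoH_prod3 hM hY hW A mA.
  exact: (dirichlet_mean_rhoH_has_density al0 al1 theta0 altheta1 (pos_law_mass Hpos) Hlog hM).
move=> _ M M1 hM hM1; split.
  by move=> A mA; exact: dirichlet_mean_rhoH_prod hM hM1 A mA.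
by move=> f; exact: dirichlet_mean_rhoH_mixture_density hM hM1 f.
Qed.
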